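(* Let $r>0$, let $Y$ be a ball quasi-Banach function space on $\mathbb R^n$ that is $r$-convex with constant one, and put $X=Y^r$ with norm $\|h\|_{X}=\||h|^{1/r}\|_Y^r$. For $q>0$ and $C>0$ consider the inequality $$\left\|\Big(\sum_{j=1}^N(\mathcal M_r f_j)^q\Big)^{1/q}\right\|_Y\le C\left\|\Big(\sum_{j=1}^N|f_j|^q\Big)^{1/q}\right\|_Y .\qquad(\ast)$$ Say that $(\ast)$ holds uniformly with exponent $q$ and constant $C$ if it holds for every $N\in\mathbb N$ and every finite family $\{f_j\}_{j=1}^N\subset L^r_{\mathrm{loc}}(\mathbb R^n)$ for which the right-hand side is finite ($C$ being independent of $N$ and of the family). (i) The following statements are equivalent. (a) $\mathcal M:X\to X$ and $\mathcal M:X'\to X'$ are bounded. (b) There exist $q>r$ and $C>0$ such that $(\ast)$ holds uniformly with exponent $q$ and constant $C$. (c) For every $q>r$ there is $C>0$ such that $(\ast)$ holds uniformly with exponent $q$ and constant $C$. (d) There is a constant $C_{\mathrm{sp}}>0$ such that $\|\mathcal A_{\mathscr S,r}f\|_Y\le C_{\mathrm{sp}}\|f\|_Y$ for every finite $1/2$-sparse subcollection $\mathscr S$ of every dyadic grid and every $f\in Y\cap L^r_{\mathrm{loc}}(\mathbb R^n)$. Each of these conditions implies $Y\subset L^r_{\mathrm{loc}}(\mathbb R^n)$. Moreover, for $q>r$, $(\ast)$ holds uniformly with exponent $q$ and constant $C$ if and only if $$\left\|\Big(\sum_{j=1}^N(\mathcal M h_j)^{q/r}\Big)^{r/q}\right\|_X\le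 C^r\left\|\Big(\sum_{j=1}^N|h_j|^{q/r}\Big)^{r/q}\right\|_X$$ for every $N\in\mathbb N$ and every finite family $\{h_j\}_{j=1}^N$ of measurable functions for which the right-hand side is finite. (ii) Let $q>0$ and suppose that there is a finite constant $C$ such that $(\ast)$ holds uniformly with exponent $q$ and constant $C$. Then necessarily $q>r$ and $Y\subset L^r_{\mathrm{loc}}(\mathbb R^n)$. In particular, no such uniform estimate can hold when $0<q\le r$. (iii) Fix $q>r$ and suppose that $(\ast)$ holds uniformly with exponent $q$ and constant $C$. Then, for every sequence $\{f_j\}_{j=1}^\infty$ of measurable functions with $\big(\sum_{j=1}^\infty|f_j|^q\big)^{1/q}\in Y$, $$\left\|\Big(\sum_{j=1}^\infty(\mathcal M_r f_j)^q\Big)^{1/q}\right\|_Y\le C\left\|\Big(\sum_{j=1}^\infty|f_j|^q\Big)^{1/q}\right\|_Y .$$ Conversely, this estimate for all such sequences implies that $(\ast)$ holds uniformly with exponent $q$ and the same constant $C$. (iv) Suppose that $Y\subset L^r_{\mathrm{loc}}(\mathbb R^n)$. The following statements are equivalent, and the constant $C$ may be chosen to be the same in (a)--(c). (a) There is $C>0$ such that $\|\mathcal M_r f\|_Y\le C\|f\|_Y$ for all $f\in Y$. (b) There is $C>0$ such that, for every $N\in\mathbb N$ and every finite family $\{f_j\}_{j=1}^N$ with $\max_{1\le j\le N}|f_j|\in Y$, $\ \big\|\max_{1\le j\le N}\mathcal M_r f_j\big\|_Y\le C\big\|\max_{1\le j\le N}|f_j|\big\|_Y$. (c) There is $C>0$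 such that, for every sequence $\{f_j\}_{j=1}^\infty$ with $\sup_j|f_j|\in Y$, $\ \big\|\sup_j\mathcal M_r f_j\big\|_Y\le C\big\|\sup_j|f_j|\big\|_Y$.
   Context: Functions on $\mathbb R^n$ are identified when equal a.e. (Lebesgue measure). Ball quasi-Banach function space $Y$: a quasi-Banach space of measurable functions on $\mathbb R^n$ such that (1) if $f\in Y$ and $|g|\le|f|$ a.e. with $g$ measurable, then $g\in Y$ and $\|g\|_Y\le\|f\|_Y$; (2) (Fatou) if $f_k\in Y$, $0\le f_k\uparrow f$ a.e. and $\sup_k\|f_k\|_Y<\infty$, then $f\in Y$ and $\|f\|_Y=\sup_k\|f_k\|_Y$; (3) $\mathbf 1_B\in Y$ for every ball $B$. If a (possibly extended-valued) measurable function is not in a space, its (quasi-)norm is taken to be $+\infty$. $Y$ is $r$-convex with constant one if $\big\|(|f|^r+|g|^r)^{1/r}\big\|_Y\le(\|f\|_Y^r+\|g\|_Y^r)^{1/r}$ for all $f,g\in Y$. The space $Y^r=\{h:\ |h|^{1/r}\in Y\}$ has quasi-norm $\|h\|_{Y^r}=\||h|^{1/r}\|_Y^r$, which is a norm when $Y$ is $r$-convex with constant one; then $Y^r$ is a Banach lattice satisfying (1)--(3). Köthe associate space: $X'=\{g \text{ measurable}:\ \|g\|_{X'}:=\sup_{\|f\|_X\le1}\int_{\mathbb R^n}|fg|\,dx<\infty\}$. Operators: $\mathcal M f(x)=\sup_Q\mathbf 1_Q(x)\langle|f|\rangle_Q\in[0,\infty]$ over all axis-parallel cubes $Q\subset\mathbb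 R^n$, where $\langle f\rangle_Q=\frac1{|Q|}\int_Q f$ (integrals of $|f|$ may be $+\infty$; $0\cdot\infty=0$); $\mathcal M_rf=[\mathcal M(|f|^r)]^{1/r}$; for a finite collection $\mathscr S$ of cubes, $\mathcal A_{\mathscr S}f=\sum_{Q\in\mathscr S}\langle|f|\rangle_Q\mathbf 1_Q$ and $\mathcal A_{\mathscr S,r}f=[\mathcal A_{\mathscr S}(|f|^r)]^{1/r}$. $L^r_{\mathrm{loc}}(\mathbb R^n)$ is the set of measurable $f$ with $|f|^r$ locally integrable. An operator $T$ is bounded on $Z$ if there is $C<\infty$ with $\|Tf\|_Z\le C\|f\|_Z$ for all $f\in Z$. Dyadic grid: a collection $\mathscr D=\bigcup_{k\in\mathbb Z}\mathscr D_k$ of half-open cubes $\prod_{i=1}^n[a_i,a_i+\ell)$ such that each $\mathscr D_k$ is a partition of $\mathbb R^n$ into cubes of side length $2^{-k}$; every $Q\in\mathscr D_k$ is contained in a unique cube of $\mathscr D_{k-1}$ and is the disjoint union of exactly $2^n$ cubes of $\mathscr D_{k+1}$; and any $P,Q\in\mathscr D$ satisfy $P\cap Q=\varnothing$, $P\subset Q$ or $Q\subset P$. A collection $\mathscr S$ of cubes is $\eta$-sparse ($0<\eta<1$) if there are pairwise disjoint measurable sets $E_Q\subset Q$, $Q\in\mathscr S$, with $|E_Q|\ge\eta|Q|$. *)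

(* Defs.v *)
From HB Require Import structures.
From mathcomp Require Import all_boot all_order all_algebra.
From mathcomp Require Import all_classical all_reals all_analysis.

Set Implicit Arguments.
Unset Strict Implicit.
Unset Printing Implicit Defensive.

Import Order.TTheory GRing.Theory Num.Theory numFieldNormedType.Exports.

Local Open Scope classical_set_scope.
Local Open Scope ring_scope.

(* mathcomp-analysis has Lebesgue measure only on the line.  On R^(n+1) we take
   the outer measure given by countable covers by half-open boxes, and then
   Caratheodory's sigma-algebra, i.e. all Lebesgue measurable sets.  The
   dimension is n.+1 because the statements are about R^m with m >= 1. *)
Section lebesgue_outer.
Variables (R : realType) (n : nat).
Local Notation V := 'rV[R]_n.+1.

(* [BSide true x] is the endpoint x included on the left and excluded on the
   right; [BSide false x] is the converse.  Hence (true, true) is [a, b[,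
   (true, false) is [a, b], (false, true) is ]a, b[ in each coordinate. *)
Definition box (s t : bool) (a b : V) : set V :=
  [set x | forall i,
    x ord0 i \in Interval (BSide s (a ord0 i)) (BSide t (b ord0 i))].

Definition box_volume (a b : V) : R :=
  \prod_(i < n.+1) Num.max 0 (b ord0 i - a ord0 i).

Definition box_cover (X : set V) : set (nat -> V * V) :=
  [set c | X `<=` \bigcup_k box true true (c k).1 (c k).2].

Definition lebesgue_outer (X : set V) : \bar R :=
  ereal_inf [set (\sum_(k <oo) (box_volume (c k).1 (c k).2)%:E)%E
            | c in box_cover X].

Let vol (p : V * V) : \bar R := (box_volume p.1 p.2)%:E.

Let vol_ge0 p : (0 <= vol p)%E.
Proof.
by rewrite lee_fin; apply: prodr_ge0 => i _; rewrite le_max lexx.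
Qed.

Lemma lebesgue_outer_ge0 X : (0 <= lebesgue_outer X)%E.
Proof.
by apply: le_ereal_inf_tmp => _ [c _ <-]; apply: nneseries_ge0 => k _ _; exact: (vol_ge0 (c k)).
Qed.

Lemma lebesgue_outer0 : lebesgue_outer set0 = 0%E.
Proof.
apply/eqP; rewrite eq_le lebesgue_outer_ge0 andbT.
apply: ereal_inf_lbound; exists (fun=> (0, 0)) => /=; first by move=> ?.
apply: eseries0 => k _ _; rewrite /box_volume big_ord_recl subrr.
by rewrite maxxx mul0r.
Qed.

Lemma le_lebesgue_outer : {homo lebesgue_outer : A B / A `<=` B >-> (A <= B)%E}.
Proof.
move=> A B AB; apply/ereal_inf_le_tmp => _ [c Bc <-].
by exists c => //; apply: subset_trans AB Bc.
Qed.

Lemma lebesgue_outer_sigma_subadditive : sigma_subadditive lebesgue_outer.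
Proof.
move=> A; have [[i ioo]|] := pselect (exists i, lebesgue_outer (A i) = +oo%E).
  rewrite (eseries_pinfty _ _ ioo) ?leey// => k _.
  by rewrite -ltNye (lt_le_trans _ (lebesgue_outer_ge0 _)).
rewrite -forallNE => Aoo.
suff add2e (e : {posnum R}) : (lebesgue_outer (\bigcup_k A k) <=
    \sum_(i <oo) lebesgue_outer (A i) + e%:num%:E)%E.
  by apply/lee_addgt0Pr => _/posnumP[].
rewrite (le_trans _ (epsilon_trick _ _ _))//; last first.
  by move=> k; exact: lebesgue_outer_ge0.
pose P k (c : nat -> V * V) := box_cover (A k) c /\
  (\sum_(i <oo) vol (c i) <=
   lebesgue_outer (A k) + (e%:num / (2 ^ k.+1)%:R)%:E)%E.
have [G PG] : {G : nat -> nat -> V * V & forall k, P k (G k)}.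
  apply: (@choice _ _ P) => k; rewrite /P /lebesgue_outer.
  set S := (X in ereal_inf X); move infS : (ereal_inf S) => iS.
  case: iS infS => [r Sr|Soo|Soo].
  - have en1 : 0 < e%:num / (2 ^ k.+1)%:R by [].
    have /(lb_ereal_inf_adherent en1) : ereal_inf S \is a fin_num by rewrite Sr.
    move=> [x [c Ac <-] xS].
    by exists c; split => //; rewrite -Sr; exact/ltW.
  - by have := Aoo k; rewrite /lebesgue_outer Soo.
  - suff : lbound S 0%E by move/le_ereal_inf_tmp; rewrite Soo.
    by move=> /= _ [c _ <-]; apply: nneseries_ge0 => i _ _; exact: vol_ge0.
pose volG := vol \o uncurry G.
have volG_ge0 x : (0 <= volG x)%E by exact: vol_ge0.
apply: (@le_trans _ _ (\esum_(i in setT) volG i)%E).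
  apply: ereal_inf_lbound => /=.
  have /card_esym/ppcard_eqP[f] := card_nat2.
  exists (uncurry G \o f).
    move=> t [i _ Ait]; have [j _ Gijt] := (PG i).1 _ Ait.
    by exists (f^-1%FUN (i, j)) => //=; rewrite invK ?inE.
  rewrite -(esum_pred_image volG _ xpredT) ?[fun=> _]set_true//.
  by rewrite image_eq.
rewrite (_ : esum _ _ = (\sum_(i <oo) \sum_(j <oo ) vol (G i j))%E); last first.
  pose J : nat -> set (nat * nat) := fun i => [set (i, j) | j in setT].
  rewrite (_ : setT = \bigcup_k J k); last first.
    by rewrite predeqE => -[a b]; split => // _; exists a => //; exists b.
  rewrite esum_bigcupT /=; last 2 first.
    - apply/trivIsetP => i j _ _ ij.
      rewrite predeqE => -[p m] /=; split => //= -[] [_] _ [<-{p} _].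
      by move=> [m' _] [] /esym/eqP; rewrite (negbTE ij).
    - by move=> /= p; exact: volG_ge0.
  rewrite -(image_id [set: nat]) -fun_true esum_pred_image//; last first.
    by move=> p _; exact: esum_ge0.
  apply: eq_eseriesr => /= j _.
  rewrite -(esum_pred_image volG (pair j) predT)//=; last first.
    by move=> ? ? _ _; exact: (@can_inj _ _ _ snd).
  by congr esum; rewrite predeqE => -[a b]; split; move=> [i _ <-]; exists i.
apply: lee_lim.
- apply: is_cvg_nneseries => k *.
  by apply: nneseries_ge0 => m *; exact: vol_ge0.
- apply: is_cvg_nneseries => k *; apply: adde_ge0 => //.
  exact: lebesgue_outer_ge0.
- by near=> k; apply: lee_sum => i _; exact: (PG i).2.
Unshelve. all: by end_near. Qed.

HB.instance Definition _ := isOuterMeasure.Build R V lebesgue_outer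
  lebesgue_outer0 lebesgue_outer_ge0 le_lebesgue_outer
  lebesgue_outer_sigma_subadditive.

End lebesgue_outer.

(* R^(n+1): row vectors with the sigma-algebra of Lebesgue measurable sets. *)
Definition Rn (R : realType) (n : nat) : Type :=
  caratheodory_type (@lebesgue_outer R n).

HB.instance Definition _ (R : realType) (n : nat) :=
  Measurable.on (Rn R n).

Definition lebesgue_Rn (R : realType) (n : nat) : set (Rn R n) -> \bar R :=
  @lebesgue_outer R n.

HB.instance Definition _ (R : realType) (n : nat) :=
  isMeasure.Build _ (Rn R n) R (@lebesgue_Rn R n)
    (@caratheodory_measure0 _ _ (@lebesgue_outer R n))
    (@caratheodory_measure_ge0 _ _ (@lebesgue_outer R n))
    (@caratheodory_measure_sigma_additive _ _ (@lebesgue_outer R n)).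

Section function_spaces.
Variables (R : realType) (n : nat).
Local Notation T := (Rn R n).
Local Notation mu := (@lebesgue_Rn R n).
Implicit Types (f g h : T -> R) (Q : set T).

(* A space of functions: the set of its elements and its (quasi-)norm, whose
   values outside the space are irrelevant. *)
Record fspace := Fspace {
  carrier :> (T -> R) -> Prop;
  fnorm : (T -> R) -> R }.

(* Membership of an extended-valued function, identified with a real-valued one
   when it is finite a.e. *)
Definition xmem (Z : fspace) (f : T -> \bar R) : Prop :=
  {ae mu, forall x, f x \is a fin_num} /\ Z (fine \o f).

Definition xnorm (Z : fspace) (f : T -> \bar R) : \bar R :=
  if `[< xmem Z f >] then (fnorm Z (fine \o f))%:E else +oo%E.

Definition euclidean_ball (c : T) (rho : R) : set T :=
  [set x : T | \sum_(i < n.+1) ((x : 'rV[R]_n.+1) ord0 i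
                 - (c : 'rV[R]_n.+1) ord0 i) ^+ 2 < rho ^+ 2].

(* Compatibility with a.e. equality follows from [bqb_ideal]. *)
Record ball_quasi_banach (Y : fspace) : Prop := {
  bqb_measurable : forall f, Y f -> measurable_fun setT f;
  bqb_zero : Y (fun=> 0);
  bqb_add : forall f g, Y f -> Y g -> Y (fun x => f x + g x);
  bqb_scale : forall c f, Y f -> Y (fun x => c * f x);
  bqb_norm_ge0 : forall f, Y f -> 0 <= fnorm Y f;
  bqb_norm_eq0 : forall f, Y f -> fnorm Y f = 0 -> {ae mu, forall x, f x = 0};
  bqb_normZ : forall c f, Y f -> fnorm Y (fun x => c * f x) = `|c| * fnorm Y f;
  bqb_normD : exists K : R, forall f g, Y f -> Y g ->
    fnorm Y (fun x => f x + g x) <= K * (fnorm Y f + fnorm Y g);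
  bqb_complete : forall F : nat -> T -> R, (forall k, Y (F k)) ->
    (forall e : R, 0 < e -> exists N : nat, forall k m : nat,
      (N <= k)%N -> (N <= m)%N -> fnorm Y (fun x => F k x - F m x) < e) ->
    exists2 f, Y f & fnorm Y (fun x => F k x - f x) @[k --> \oo] --> (0 : R);
  bqb_ideal : forall f g, Y f -> measurable_fun setT g ->
    {ae mu, forall x, `|g x| <= `|f x|} -> Y g /\ fnorm Y g <= fnorm Y f;
  bqb_fatou : forall (F : nat -> T -> R) f, (forall k, Y (F k)) ->
    measurable_fun setT f ->
    {ae mu, forall x, [/\ forall k, 0 <= F k x,
                          forall k, F k x <= F k.+1 x
                        & F k x @[k --> \oo] --> f x]} ->
    (exists S : R, forall k, fnorm Y (F k) <= S) ->
    Y f /\ fnorm Y f = sup (range (fun k => fnorm Y (F k)));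
  bqb_ball : forall (c : T) (rho : R), 0 < rho ->
    Y (\1_(euclidean_ball c rho) : T -> R) }.

Definition convex_const_one (r : R) (Y : fspace) : Prop :=
  forall f g, Y f -> Y g ->
    (xnorm Y (fun x => ((`|f x| `^ r + `|g x| `^ r) `^ r^-1)%:E)
     <= ((fnorm Y f `^ r + fnorm Y g `^ r) `^ r^-1)%:E)%E.

Definition power_space (Y : fspace) (r : R) : fspace := Fspace
  [set h : T -> R | measurable_fun setT h /\ Y (fun x => `|h x| `^ r^-1)]
  (fun h => fnorm Y (fun x => `|h x| `^ r^-1) `^ r).

Definition kothe_norm (X : fspace) g : \bar R :=
  ereal_sup [set (\int[mu]_x (`|f x * g x|)%:E)%E
            | f in [set f : T -> R | X f /\ fnorm X f <= 1]].

Definition kothe_associate (X : fspace) : fspace := Fspace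
  [set g : T -> R | measurable_fun setT g /\ (kothe_norm X g < +oo)%E]
  (fun g => fine (kothe_norm X g)).

Definition cube Q : Prop := exists (s t : bool) (a : 'rV[R]_n.+1) (l : R),
  0 < l /\ Q = box s t a (a + const_mx l).

Definition half_open_cube (l : R) Q : Prop := exists a : 'rV[R]_n.+1,
  0 < l /\ Q = box true true a (a + const_mx l).

Definition average Q f : \bar R :=
  ((fine (mu Q))^-1%:E * \int[mu]_(x in Q) (f x)%:E)%E.

Definition maximal f (x : T) : \bar R :=
  ereal_sup [set ((\1_Q x)%:E * average Q (fun y => `|f y|%R))%E
            | Q in [set Q | cube Q]].

Definition maximal_r (r : R) f (x : T) : \bar R :=
  (maximal (fun y => `|f y| `^ r)%R x `^ r^-1)%E.

Definition sparse_op (S : set (set T)) f (x : T) : \bar R :=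
  (\sum_(Q \in S) average Q (fun y => `|f y|%R) * (\1_Q x)%:E)%E.

Definition sparse_op_r (S : set (set T)) (r : R) f (x : T) : \bar R :=
  (sparse_op S (fun y => `|f y| `^ r)%R x `^ r^-1)%E.

Definition Lr_loc (r : R) : set (T -> R) :=
  [set f : T -> R | measurable_fun setT f /\
    forall K : set 'rV[R]_n.+1, compact K ->
      (\int[mu]_(x in (K : set T)) (`|f x| `^ r)%:E < +oo)%E].

Definition bounded_on (A : (T -> R) -> T -> \bar R) (Z : fspace) : Prop :=
  exists C : R, forall f, Z f -> (xnorm Z (A f) <= (C * fnorm Z f)%:E)%E.

Definition dyadic_grid (D : set (set T)) : Prop :=
  exists Dk : int -> set (set T),
    [/\ D = \bigcup_k Dk k,
        forall k Q, Dk k Q -> half_open_cube ((2 : R) ^ (- k)) Q,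
        forall k, partition (Dk k) id [set: T],
        forall k Q, Dk k Q ->
          (exists! P, Dk (k - 1) P /\ Q `<=` P) /\
          (exists F : set (set T), [/\ F `<=` Dk (k + 1),
             (F #= `I_(2 ^ n.+1))%card, trivIset F id & Q = \bigcup_(P in F) P])
      & forall P Q, D P -> D Q -> [\/ P `&` Q = set0, P `<=` Q | Q `<=` P]].

Definition sparse (eta : R) (S : set (set T)) : Prop :=
  exists E : set T -> set T,
    trivIset S E /\
    forall Q, S Q ->
      [/\ measurable (E Q), E Q `<=` Q & (eta%:E * mu Q <= mu (E Q))%E].

Definition vector_valued_bound (Y : fspace) (r q C : R) : Prop :=
  forall (N : nat) (f : 'I_N -> T -> R),
    (forall j, Lr_loc r (f j)) ->
    let F := fun x => ((\sum_(j < N) `|f j x| `^ q) `^ q^-1)%:E in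
    (xnorm Y F < +oo ->
     xnorm Y (fun x => (\sum_(j < N) maximal_r r (f j) x `^ q) `^ q^-1)
     <= C%:E * xnorm Y F)%E.

Definition vector_valued_bound_power (Y : fspace) (r q C : R) : Prop :=
  let X := power_space Y r in
  forall (N : nat) (h : 'I_N -> T -> R),
    (forall j, measurable_fun setT (h j)) ->
    let H := fun x => ((\sum_(j < N) `|h j x| `^ (q / r)) `^ (r / q))%:E in
    (xnorm X H < +oo ->
     xnorm X (fun x => (\sum_(j < N) maximal (h j) x `^ (q / r)) `^ (r / q))
     <= (C `^ r)%:E * xnorm X H)%E.

Definition vector_valued_bound_seq (Y : fspace) (r q C : R) : Prop :=
  forall f : nat -> T -> R,
    (forall j, measurable_fun setT (f j)) ->
    let F := fun x => ((\sum_(j <oo) (`|f j x| `^ q)%:E) `^ q^-1)%E in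
    xmem Y F ->
    (xnorm Y (fun x => (\sum_(j <oo) maximal_r r (f j) x `^ q) `^ q^-1)
     <= C%:E * xnorm Y F)%E.

Definition sparse_bound (Y : fspace) (r C : R) : Prop :=
  forall D S : set (set T),
    dyadic_grid D -> finite_set S -> S `<=` D -> sparse 2^-1 S ->
    forall f, Y f -> Lr_loc r f ->
      (xnorm Y (sparse_op_r S r f) <= (C * fnorm Y f)%:E)%E.

Definition maximal_r_bound (Y : fspace) (r C : R) : Prop :=
  forall f, Y f -> (xnorm Y (maximal_r r f) <= (C * fnorm Y f)%:E)%E.

Definition maximal_r_bound_max (Y : fspace) (r C : R) : Prop :=
  forall (N : nat) (f : 'I_N -> T -> R),
    (forall j, measurable_fun setT (f j)) ->
    let F := fun x => \big[Num.max/0]_(j < N) `|f j x| in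
    Y F ->
    (xnorm Y (fun x => \big[maxe/0]_(j < N) maximal_r r (f j) x)
     <= (C * fnorm Y F)%:E)%E.

Definition maximal_r_bound_sup (Y : fspace) (r C : R) : Prop :=
  forall f : nat -> T -> R,
    (forall j, measurable_fun setT (f j)) ->
    let F := fun x => ereal_sup (range (fun j => `|f j x|%:E)) in
    xmem Y F ->
    (xnorm Y (fun x => ereal_sup (range (fun j => maximal_r r (f j) x)))
     <= C%:E * xnorm Y F)%E.

End function_spaces.

(* Main.v *)
(* Put X = Y^r and s = q/r; raising functions to the power r turns every
   statement into one about the maximal operator M on the Banach lattice X.
   Shifted dyadic grids dominate M by finitely many maximal operators of finite
   trees of cubes.

   (a) => (c).  With F = (sum |h_j|^s)^(1/s), a stopping-time argument on a finite
   tree gives  int (sum (M_D h_j)^s)^(1/s) g <= C int MF Mg, and the bounds of M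
   on X and X' together with X'' = X (Lorentz-Luxemburg) conclude.

   (b) => (d).  For a sparse family let a_Q be the average of |f| on Q, let T_Q be
   the sum of a_P over P containing Q, and T = sum a_Q 1_Q.  Apply the vector-valued
   bound to h_Q = b_Q 1_(E_Q) with b_Q = a_Q^(1/s) T_Q^(1-1/s).  Since
   (T/2)^s <= sum a_Q T_Q^(s-1) 1_Q = sum b_Q^s 1_Q and b_Q 1_Q <= 2 M h_Q, this
   bounds |T| by |sup b_Q 1_(E_Q)| <= d |T| + d^(1-s) |Mf|, and d small absorbs |T|.

   (d) => (a).  The cubes at which the stopping time jumps form a sparse family S,
   the tree maximal function is at most 2 A_S f, and A_S is self-adjoint, which
   handles X'.

   If q <= r, thin slabs of a cube violate the inequality, because M of the
   indicator of a slab decays like the inverse of the distance, whose q/r-th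
   powers sum to at least a harmonic sum. *)
Require Import Defs.
From mathcomp Require Import all_boot all_order all_algebra.
From mathcomp Require Import all_classical all_reals all_analysis measurable_realfun.
From mathcomp Require Import ring lra zify.
Set Implicit Arguments.
Unset Strict Implicit.
Unset Printing Implicit Defensive.
Import Order.TTheory GRing.Theory Num.Theory numFieldNormedType.Exports.
Local Open Scope classical_set_scope.
Local Open Scope ring_scope.

(** * Stopping times on finite trees *)

(** The tree argument linearises the [s]-norm: with [u] the stopped average of [F], one has a <= a^s
    u^(1-s) + u, and a^s is a sum of s-th powers of running maxima, which telescope along the
    levels. An increment can be summed only if the part of h_j that causes it has size [u]; so h_j
    is replaced by its conditional expectation at the next jump, which has the same average over the
    current class and an [s]-norm of at most 2 A u. No constant depends on the depth of the tree or
    on the number of functions, so monotone limits and the Fatou property carry the bounds to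
    R^(n+1). The identity X'' = X needs a functional that separates a function from a convex set. It
    is obtained as the residual of a nearest point in L^2 of a cube. Local integrability is the
    delicate point: the vector-valued and the sparse bounds speak only of functions in L^r_loc,
    whereas the inclusion of Y in L^r_loc is a conclusion. Both are first applied to bounded
    functions; the Fatou property then bounds M on all of X, and finiteness of a maximal function at
    a single point gives local integrability. *)

Section powR_lemmas.
Variable R : realType.
Implicit Types (a b m x y s : R).

Lemma young_powR s a b : 1 < s -> 0 <= a -> 0 <= b ->
  a * b `^ (s - 1) <= s^-1 * a `^ s + (1 - s^-1) * b `^ s.
Proof.
move=> s1 a0 b0.
have s0 : 0 < s by lra.
have t0 : 0 < s / (s - 1) by apply: divr_gt0; lra.
have h : s^-1 + (s / (s - 1))^-1 = 1 by field; apply/andP; split; lra.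

have := conjugate_powR a0 (powR_ge0 b (s - 1)) s0 t0 h.
rewrite -powRrM; have -> : (s - 1) * (s / (s - 1)) = s by field; lra.
have -> : (s / (s - 1))^-1 = 1 - s^-1 by field; apply/andP; split; lra.
by rewrite [s^-1 * _]mulrC [(1 - _) * _]mulrC.
Qed.

(** Young's inequality for m a^(s-1), rearranged. It trades increments of s-th powers for increments
    of (s-1)-th powers times [m], which leaves one factor to be averaged. *)
Lemma powR_diff_le s m a : 1 < s -> 0 <= a -> a <= m ->
  m `^ s - a `^ s <= s / (s - 1) * ((m `^ (s - 1) - a `^ (s - 1)) * m).
Proof.
move=> s1 a0 am; have m0 : 0 <= m by exact: le_trans am.
have := young_powR s1 m0 a0.
have <- := mulr_powRB1 m0 (lt_trans ltr01 s1).
set A := a `^ s; set B := m `^ (s - 1); set D := a `^ (s - 1) => h.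
have s0 : 0 < s - 1 by lra.
have -> : s / (s - 1) * ((B - D) * m) = (s * (m * B) - s * (m * D)) / (s - 1).
  by field; lra.
rewrite ler_pdivlMr //.
have : s * (m * D) <= s * (s^-1 * (m * B) + (1 - s^-1) * A).
  by rewrite ler_pM2l //; lra.
rewrite mulrDr !mulrA divff ?mul1r; last lra.
have -> : s * (1 - s^-1) = s - 1 by field; lra.
by nra.
Qed.

(** Young's inequality for [h j / F] and [c j], summed over [j]. The bound is linear in [F], so it
    can serve as a test inequality for [minkowski_of_dual]. *)
Lemma sum_mul_powR_le (J : finType) s F (h c : J -> R) : 1 < s -> 0 <= F ->
  (forall j, 0 <= h j) -> (forall j, 0 <= c j) ->
  \sum_j h j `^ s <= F `^ s ->
  \sum_j h j * c j `^ (s - 1) <= F * (s^-1 + (1 - s^-1) * \sum_j c j `^ s).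
Proof.
move=> s1 F0 h0 c0 hF; have s0 : s != 0 by lra.
have [F00|Fn0] := eqVneq F 0.
  rewrite F00 mul0r big1// => j _.
  suff -> : h j = 0 by rewrite mul0r.
  apply: (@powR_eq0_eq0 _ _ s); apply/eqP; rewrite eq_le powR_ge0 andbT.
  apply: le_trans (le_trans hF _); last by rewrite F00 powR0.
  by rewrite (bigD1 j)//= lerDl sumr_ge0// => i _; exact: powR_ge0.
have Fp : 0 < F by rewrite lt_def Fn0.
have -> : \sum_j h j * c j `^ (s - 1) = F * \sum_j h j / F * c j `^ (s - 1).
  by rewrite mulr_sumr; apply: eq_bigr => j _; field.
rewrite ler_pM2l//.
apply: (@le_trans _ _ (\sum_j (s^-1 * (h j / F) `^ s + (1 - s^-1) * c j `^ s))).
  by apply: ler_sum => j _; apply: young_powR => //; apply: divr_ge0.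
rewrite big_split/= -!mulr_sumr lerD2r ger_pMr ?invr_gt0; last lra.
under eq_bigr => j _ do rewrite powRM ?invr_ge0//.
rewrite -mulr_suml -(powR_inv1 F0) -powRrM mulN1r powRN.
by rewrite ler_pdivrMr ?powR_gt0// mul1r.
Qed.

Lemma le_of_sum_powR (J : finType) s F (h : J -> R) j : 1 < s -> 0 <= F ->
  (forall j, 0 <= h j) -> \sum_j h j `^ s <= F `^ s -> h j <= F.
Proof.
move=> s1 F0 h0 hF; have sn0 : s != 0 by lra.
rewrite -[leLHS]powRr1// -[leRHS]powRr1// -(mulfV sn0) !powRrM.
apply: ge0_ler_powR; rewrite ?invr_ge0 ?nnegrE ?powR_ge0//; first lra.
apply: le_trans hF; rewrite (bigD1 j)//= lerDl sumr_ge0// => i _; exact: powR_ge0.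
Qed.

(* Testing against [c j `^ (s - 1)], with [c j = a j / b], recovers the [s]-norm. *)
Lemma minkowski_of_dual (J : finType) (U : Type) (h : J -> U -> R) (F : U -> R)
    (a : J -> R) b s :
  1 < s -> (forall j (x : U), 0 <= h j x) -> (forall x : U, 0 <= F x) ->
  (forall x : U, \sum_j h j x `^ s <= F x `^ s) -> (forall j, 0 <= a j) -> 0 <= b ->
  (forall (c : J -> R) d, (forall j, 0 <= c j) -> 0 <= d ->
     (forall x : U, \sum_j h j x * c j <= F x * d) -> \sum_j a j * c j <= b * d) ->
  \sum_j a j `^ s <= b `^ s.
Proof.
move=> s1 h0 F0 hF a0 b0 key.
have s0 : 0 < s by exact: lt_trans ltr01 s1.
have sn0 : s != 0 by rewrite gt_eqF.
have hleF j (x : U) : h j x <= F x := le_of_sum_powR j s1 (F0 x) (fun i => h0 i x) (hF x).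
have := b0; rewrite le_eqVlt => /orP[/eqP bz|bp].
  (* When [b] vanishes one cannot divide by it. Testing with all weights equal to 1 is allowed with
     [d = #|J|], since every [h j] is at most [F], and it forces every [a j] to vanish. *)
  have := key (fun=> 1) #|J|%:R (fun=> ler01) (ler0n _ _).
  rewrite -bz mul0r => H; rewrite powR0// big1// => j _.
  suff -> : a j = 0 by rewrite powR0.
  apply/eqP; rewrite eq_le a0 andbT; apply: le_trans (H _).
    by rewrite (bigD1 j)//= mulr1 lerDl sumr_ge0// => i _; rewrite mulr1.
  move=> x; apply: (@le_trans _ _ (\sum_(j : J) F x)).
    by apply: ler_sum => i _; rewrite mulr1.
  by rewrite sumr_const mulr_natr.
pose c j := a j / b.
have c0 j : 0 <= c j by rewrite divr_ge0.
pose L := \sum_j c j `^ s.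
have L0 : 0 <= L by apply: sumr_ge0 => j _; exact: powR_ge0.
have sinv : 0 <= 1 - s^-1 by rewrite subr_ge0 invf_le1// ltW.
have d0 : 0 <= s^-1 + (1 - s^-1) * L by rewrite addr_ge0 ?invr_ge0 ?(ltW s0)// mulr_ge0.
have := key (fun j => c j `^ (s - 1)) _ (fun j => powR_ge0 _ _) d0
  (fun x : U => sum_mul_powR_le s1 (F0 x) (fun j => h0 j x) c0 (hF x)).
have -> : \sum_j a j * c j `^ (s - 1) = b * L.
  rewrite mulr_sumr; apply: eq_bigr => j _; rewrite -[in RHS](mulr_powRB1 (c0 j))//.
  by rewrite mulrA /c; congr (_ * _); field; rewrite gt_eqF.
rewrite ler_pM2l// => H.
(* The test with these weights gave L <= 1/s + (1 - 1/s) L. *)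
have L1 : L <= 1.
  have : s^-1 * L <= s^-1 by lra.
  by rewrite ger_pMr ?invr_gt0.
have -> : \sum_j a j `^ s = b `^ s * L.
  rewrite mulr_sumr; apply: eq_bigr => j _; rewrite -powRM//.
  by congr (_ `^ _); rewrite /c; field; rewrite gt_eqF.
by rewrite ger_pMr// powR_gt0.
Qed.

(** Either [a <= x], or (a/x)^(s-1) >= 1. With [a] an [s]-norm, the root disappears in favour of a
    weighted sum of s-th powers. *)
Lemma powR_absorb s a x : 1 < s -> 0 < x -> 0 <= a -> a <= a `^ s * x `^ (1 - s) + x.
Proof.
move=> s1 x0 a0; have [ax|xa] := leP a x.
  by apply: (le_trans ax); rewrite lerDr mulr_ge0 ?powR_ge0.
have ap : 0 < a by lra.
apply: (@le_trans _ _ (a `^ s * x `^ (1 - s))); last by lra.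
rewrite -(mulr_powRB1 a0); last lra.
rewrite -mulrA ler_peMr//.
have -> : 1 - s = - (s - 1) by ring.
by rewrite powRN ler_pdivlMr ?powR_gt0// mul1r ge0_ler_powR ?nnegrE; lra.
Qed.

End powR_lemmas.

(** The 1 pays for the term [x] of [powR_absorb]. In the other summand s/(s-1) comes from
    [powR_diff_le], one factor 2 from [level_bound], the other from [sum_terms_le], and 2^(s-1)
    (2A)^s is the constant [C1] of [tail_bound]. *)
Definition vv_const (R : realType) (s A : R) : R :=
  1 + 4 * (s / (s - 1)) * (2 `^ (s - 1) * (2 * A) `^ s).

Lemma vv_const_ge0 (R : realType) (s A : R) : 1 < s -> 0 <= vv_const s A.
Proof.
move=> s1; rewrite /vv_const addr_ge0// !mulr_ge0 ?powR_ge0// ?invr_ge0; lra.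
Qed.

(* [I] is the set of leaves, of masses [w], and [e l x y] says that [x] and [y]
   lie in the same cube of level [l]. *)
Section tree.
Variables (R : realType) (I : finType) (w : I -> R) (e : nat -> rel I).
Hypothesis w_gt0 : forall x, 0 < w x.
Hypothesis e_equiv : forall l, equivalence_rel (e l).
Hypothesis e_refine : forall l x y, e l.+1 x y -> e l x y.
Implicit Types (h u F g : I -> R) (l m : nat) (x y : I).

Definition cmass l x : R := \sum_(y | e l x y) w y.
(** The conditional expectation of [h] with respect to the partition of level [l], for the weights
    [w]. *)
Definition cavg l h x : R := (\sum_(y | e l x y) w y * h y) / cmass l x.

Let exx l x : e l x x. Proof. exact: (e_equiv l x x x).1. Qed.
Let e_left l x y : e l x y -> e l x =1 e l y.
Proof. by move=> h z; exact: (e_equiv l x y z).2. Qed.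
Let esym l x y : e l x y = e l y x.
Proof. by apply/idP/idP => [/e_left <-|/e_left <-]. Qed.

Lemma e_le l m x y : (l <= m)%N -> e m x y -> e l x y.
Proof. by move=> /subnK <-; elim: (m - l)%N => // k IH /e_refine. Qed.

Lemma cmass_gt0 l x : 0 < cmass l x.
Proof.
by rewrite /cmass (bigD1 x)//= ltr_pwDl// sumr_ge0// => y _; exact: ltW.
Qed.

Lemma cmass_inv l x y : e l x y -> cmass l x = cmass l y.
Proof. by move=> h; apply: eq_bigl => z; rewrite (e_left h). Qed.

Lemma cavg_inv l h x y : e l x y -> cavg l h x = cavg l h y.
Proof.
move=> xy; rewrite /cavg (cmass_inv xy); congr (_ / _).
by apply: eq_bigl => z; rewrite (e_left xy).
Qed.

Lemma cavg_selfadj l h u :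
  \sum_x w x * (cavg l h x * u x) = \sum_x w x * (h x * cavg l u x).
Proof.
have H (a b : I -> R) : \sum_x w x * (cavg l a x * b x) =
    \sum_x \sum_y (if e l x y then w x * w y * (a y * b x) / cmass l x else 0).
  apply: eq_bigr => x _; rewrite /cavg -big_mkcond /=; set S := \sum_(y | _) _.
  have -> : w x * (S / cmass l x * b x) = S * (w x * b x / cmass l x) by ring.
  by rewrite mulr_suml; apply: eq_bigr => y _; ring.
rewrite H; under [RHS]eq_bigr => x _ do rewrite [X in _ * X]mulrC.
rewrite H exchange_big/=; apply: eq_bigr => x _; apply: eq_bigr => y _.
rewrite esym; case: ifPn => // xy; rewrite (cmass_inv xy); ring.
Qed.

Lemma cavgZ l c h x : (forall x y, e l x y -> c x = c y) ->
  cavg l (fun y => c y * h y) x = c x * cavg l h x.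
Proof.
move=> hc; rewrite /cavg mulrA mulr_sumr; congr (_ / _).
by apply: eq_bigr => y /hc ->; ring.
Qed.

Lemma cavg1 l x : cavg l (fun=> 1) x = 1.
Proof.
rewrite /cavg; under eq_bigr => y _ do rewrite mulr1.
by rewrite -/(cmass l x) divff// gt_eqF// cmass_gt0.
Qed.

Lemma cavg_id l c x : (forall x y, e l x y -> c x = c y) -> cavg l c x = c x.
Proof.
move=> hc; under (_ : c = fun y => c y * 1).
  by apply/funext => y; rewrite mulr1.
by rewrite cavgZ// cavg1 mulr1.
Qed.

(** The indicator of a class of level [l] is constant on the classes of level [m], so averaging at
    level [m], moved onto it by [cavg_selfadj], leaves it fixed. *)
Lemma cavg_tower l m h x : (l <= m)%N -> cavg l (cavg m h) x = cavg l h x.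
Proof.
move=> lm; rewrite /cavg; congr (_ / _).
have H (a : I -> R) : \sum_(y | e l x y) w y * a y =
    \sum_y w y * (a y * (e l x y)%:R).
  by rewrite big_mkcond; apply: eq_bigr => y _; case: ifP; rewrite ?mulr1 ?mulr0.
rewrite !H cavg_selfadj; apply: eq_bigr => y _; congr (_ * (_ * _)).
apply: cavg_id => a b ab; congr (nat_of_bool _)%:R.
by rewrite esym (e_left (e_le lm ab)) esym.
Qed.

Lemma cavg_mono l h u x : (forall y, h y <= u y) -> cavg l h x <= cavg l u x.
Proof.
move=> hu; rewrite /cavg ler_pM2r ?invr_gt0 ?cmass_gt0//.
by apply: ler_sum => y _; rewrite ler_pM2l.
Qed.

Lemma cavg_ge0 l h x : (forall y, 0 <= h y) -> 0 <= cavg l h x.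
Proof.
move=> h0; rewrite /cavg divr_ge0 ?(ltW (cmass_gt0 _ _))//.
by apply: sumr_ge0 => y _; rewrite mulr_ge0// ltW.
Qed.

Lemma cavgD l h u x : cavg l (fun y => h y + u y) x = cavg l h x + cavg l u x.
Proof.
rewrite /cavg -mulrDl -big_split/=; congr (_ / _).
by apply: eq_bigr => y _; rewrite mulrDr.
Qed.

Lemma cavg_sum l (J : finType) (h : J -> I -> R) x :
  cavg l (fun y => \sum_j h j y) x = \sum_j cavg l (h j) x.
Proof.
rewrite /cavg -mulr_suml exchange_big/=; congr (_ / _).
by apply: eq_bigr => y _; rewrite mulr_sumr.
Qed.

Lemma cavg_eq0 l h x : (forall y, 0 <= h y) -> cavg l h x = 0 -> h x = 0.
Proof.
move=> h0 /eqP; rewrite mulf_eq0 invr_eq0 (gt_eqF (cmass_gt0 _ _)) orbF.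
rewrite psumr_eq0; last by move=> y _; rewrite mulr_ge0// ltW.
move=> /allP /(_ x); rewrite mem_index_enum exx/= => /(_ isT).
by rewrite mulf_eq0 gt_eqF//= => /eqP.
Qed.

(** Minkowski's inequality by duality: a linear test with constant weights commutes with [cavg]. *)
Lemma cavg_minkowski (J : finType) (h : J -> I -> R) F s l x : 1 < s ->
  (forall j y, 0 <= h j y) -> (forall y, 0 <= F y) ->
  (forall y, \sum_j h j y `^ s <= F y `^ s) ->
  \sum_j cavg l (h j) x `^ s <= cavg l F x `^ s.
Proof.
move=> s1 h0 F0 hF; apply: (minkowski_of_dual s1 h0 F0 hF) => [j||c d c0 d0 H].
- exact: cavg_ge0.
- exact: cavg_ge0.
have -> : \sum_j cavg l (h j) x * c j = cavg l (fun y => \sum_j h j y * c j) x.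
  rewrite cavg_sum; apply: eq_bigr => j _.
  rewrite mulrC -(@cavgZ l (fun=> c j))//; congr cavg.
  by apply/funext => y; rewrite mulrC.
rewrite mulrC -(@cavgZ l (fun=> d))//.
by apply: cavg_mono => y; rewrite [leRHS]mulrC.
Qed.

Fixpoint rmax h l x : R :=
  if l is k.+1 then Num.max (rmax h k x) (cavg l h x) else cavg 0 h x.

(** The stopping time of principal cubes: the average at the last level where it more than doubled.
    For nonnegative [F] it is comparable with [rmax F], but it changes only at jumps. *)
Fixpoint ustop F l x : R :=
  if l is k.+1 then
    if 2 * ustop F k x < cavg l F x then cavg l F x else ustop F k x
  else cavg 0 F x.

(** Level 0 counts as a jump, so that every leaf has a last jump and [ustop] is the average at
    it. *)
Definition jump F l x : bool :=
  if l is k.+1 then 2 * ustop F k x < cavg l F x else true.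

Lemma rmax_inv h l x y : e l x y -> rmax h l x = rmax h l y.
Proof.
by elim: l => [|l IH] xy /=; rewrite ?(IH (e_refine xy)) (cavg_inv _ xy).
Qed.

Lemma ustop_inv F l x y : e l x y -> ustop F l x = ustop F l y.
Proof.
by elim: l => [|l IH] xy /=; rewrite ?(IH (e_refine xy)) (cavg_inv _ xy).
Qed.

Lemma jump_inv F l x y : e l x y -> jump F l x = jump F l y.
Proof.
by case: l => //= l xy; rewrite (ustop_inv _ (e_refine xy)) (cavg_inv _ xy).
Qed.

Lemma ustop_jump F l x : jump F l x -> ustop F l x = cavg l F x.
Proof. by case: l => //= l ->. Qed.

Lemma ustop_stay F l x : ~~ jump F l.+1 x -> ustop F l.+1 x = ustop F l x.
Proof. by move=> /= /negbTE ->. Qed.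

Lemma rmax_ge0 h l x : (forall y, 0 <= h y) -> 0 <= rmax h l x.
Proof.
by move=> h0; elim: l => [|l IH] /=; rewrite ?le_max ?IH// cavg_ge0.
Qed.

Lemma cavg_le_rmax h k l x : (k <= l)%N -> cavg k h x <= rmax h l x.
Proof.
elim: l => [|l IH]; first by rewrite leqn0 => /eqP ->.
rewrite leq_eqVlt => /orP[/eqP ->|kl] /=; first by rewrite le_max lexx orbT.
by rewrite le_max IH.
Qed.

Lemma ustop_ge0 F l x : (forall y, 0 <= F y) -> 0 <= ustop F l x.
Proof.
by move=> F0; elim: l => [|l IH] /=; [|case: ifP => _ //]; exact: cavg_ge0.
Qed.

Lemma ustop_homo F k l x : (forall y, 0 <= F y) -> (k <= l)%N ->
  ustop F k x <= ustop F l x.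
Proof.
move=> F0; elim: l => [|l IH]; first by rewrite leqn0 => /eqP ->.
rewrite leq_eqVlt => /orP[/eqP ->//|kl]; apply: (le_trans (IH kl)) => /=.
by case: ifP => // h; have := ustop_ge0 l x F0; lra.
Qed.

Lemma cavg_le_ustop F l x : (forall y, 0 <= F y) ->
  cavg l F x <= 2 * ustop F l x.
Proof.
move=> F0; case: l => [|l] /=; first by have := cavg_ge0 0 x F0; lra.
have := cavg_ge0 l.+1 x F0.
by case: ifPn => [|/negP]; [lra|rewrite ltNge => /negP; rewrite negbK].
Qed.

Lemma rmax_le_ustop F l x : (forall y, 0 <= F y) ->
  rmax F l x <= 2 * ustop F l x.
Proof.
move=> F0; elim: l => [|l IH].
  exact: (cavg_le_ustop 0 x F0).
have H : rmax F l x <= 2 * ustop F l.+1 x.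
  by apply: (le_trans IH); rewrite ler_pM2l// ustop_homo.
rewrite /rmax -/(rmax F l x) ge_max H; exact: cavg_le_ustop.
Qed.

Lemma ustop_le_rmax F l x : ustop F l x <= rmax F l x.
Proof.
by elim: l => [|l IH] //=; rewrite le_max; case: ifP; rewrite ?lexx ?orbT ?IH.
Qed.

(* The mass of the points of a class that jump after level [l] is controlled
   by testing the average of [F] at the first jump. *)
Lemma ustop_weak F l m x : (forall y, 0 <= F y) -> (l <= m)%N ->
  \sum_(y | e l x y && (ustop F m y != ustop F l y)) w y * (2 * ustop F l x) <=
  \sum_(y | e l x y && (ustop F m y != ustop F l y)) w y * F y.
Proof.
move=> F0; elim: m => [|m IH].
  rewrite leqn0 => /eqP ->; rewrite !big_pred0//= => y; by rewrite eqxx andbF.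
rewrite leq_eqVlt => /orP[/eqP <-|].
  by rewrite !big_pred0//= => y; rewrite eqxx andbF.
rewrite ltnS => lm.
(* A leaf that has left its value by level [m.+1] had left it by level [m], or leaves it by jumping
   exactly now. Values only increase, so none returns. *)
pose Q y := [&& e l x y, ustop F m y == ustop F l y & jump F m.+1 y].
have split_sum (a : I -> R) :
    \sum_(y | e l x y && (ustop F m.+1 y != ustop F l y)) a y =
    \sum_(y | e l x y && (ustop F m y != ustop F l y)) a y + \sum_(y | Q y) a y.
  rewrite (bigID (fun y => ustop F m y != ustop F l y)); cbv beta; congr (_ + _).
    apply: eq_bigl => y; rewrite -andbA; case: (e l x y); rewrite ?andTb ?andFb //.
    have [_|ne] := eqVneq (ustop F m y) (ustop F l y); first by rewrite andbF.
    rewrite andbT; apply/negP => /eqP h; move/negP: ne; apply; apply/eqP/le_anti.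
    by rewrite (ustop_homo y F0 lm) andbT -h; apply: (ustop_homo y F0).
  apply: eq_bigl => y; rewrite /Q -andbA negbK; case: (e l x y); rewrite ?andTb ?andFb //.
  have [h|ne] := eqVneq (ustop F m y) (ustop F l y); last by rewrite andbF.
  rewrite andbT -h /=; case: ifPn => hj; last by rewrite eqxx.
  have := ustop_ge0 m y F0; rewrite neq_lt => ?; apply/orP; right; lra.
rewrite !split_sum; apply: lerD; first exact: IH.
(* The set [Q] is a union of classes of level [m.+1], so [F] may be replaced there by its average,
   which at a jump exceeds twice the old value. *)
have -> : \sum_(y | Q y) w y * F y = \sum_(y | Q y) w y * cavg m.+1 F y.
  have H (a : I -> R) : \sum_(y | Q y) w y * a y = \sum_y w y * (a y * (Q y)%:R).
    by rewrite big_mkcond; apply: eq_bigr => y _; case: ifP; rewrite ?mulr1 ?mulr0.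
  rewrite !H cavg_selfadj; apply: eq_bigr => y _; congr (_ * (_ * _)).
  rewrite cavg_id// => a b ab; congr (nat_of_bool _)%:R.
  rewrite /Q (jump_inv _ ab) (ustop_inv _ (e_refine ab)).
  have lab : e l a b by apply: e_le ab; exact: leqW.
  by rewrite (ustop_inv _ lab) ![e l x _]esym (e_left lab).
apply: ler_sum => y /and3P[lxy /eqP h /= hj]; rewrite ler_pM2l//.
by rewrite (ustop_inv F lxy) -h ltW.
Qed.

(** On the leaves that jump again [F] has mean at least twice the average of the class, by
    [ustop_weak], so they fill at most half of it. The remaining half is the set E_Q of a sparse
    family. *)
Lemma ustop_sparse F l L x : (forall y, 0 <= F y) -> (l <= L)%N ->
  jump F l x -> 0 < cavg l F x ->
  2^-1 * cmass l x <= \sum_(y | e l x y && (ustop F L y == ustop F l y)) w y.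
Proof.
move=> F0 lL jx Fx; have ux := ustop_jump jx.
have tot (a : I -> R) : \sum_(y | e l x y) a y =
    \sum_(y | e l x y && (ustop F L y == ustop F l y)) a y +
    \sum_(y | e l x y && (ustop F L y != ustop F l y)) a y.
  exact: (bigID (fun y => ustop F L y == ustop F l y)).
have := ustop_weak x F0 lL; rewrite -mulr_suml ux => W.
have : \sum_(y | e l x y && (ustop F L y != ustop F l y)) w y * F y <=
    cavg l F x * cmass l x.
  rewrite /cavg divfK ?gt_eqF ?cmass_gt0// [leRHS]tot lerDr sumr_ge0// => y _.
  by rewrite mulr_ge0// ltW.
move=> W'; move: (le_trans W W'); rewrite mulrA [leRHS]mulrC ler_pM2r//.
by rewrite [cmass l x in X in X -> _]tot [cmass l x]tot; lra.
Qed.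

(** * The vector-valued inequality on one finite tree *)

Section vector_valued.
Variables (J : finType) (h : J -> I -> R) (F g : I -> R) (s A : R) (L : nat).
Hypothesis s1 : 1 < s.
Hypothesis A1 : 1 <= A.
Hypothesis regular : forall l x, (l < L)%N -> cmass l x <= A * cmass l.+1 x.
Hypothesis leafE : forall x y, e L x y -> x = y.
Hypothesis h0 : forall j x, 0 <= h j x.
Hypothesis F0 : forall x, 0 <= F x.
Hypothesis g0 : forall x, 0 <= g x.
Hypothesis hF : forall x, \sum_j h j x `^ s <= F x `^ s.
Hypothesis root_gt0 : forall x, 0 < cavg 0 F x.

Let cavgL u x : cavg L u x = u x.
Proof. by apply: cavg_id => a b /leafE ->. Qed.

Let u_gt0 l x : 0 < ustop F l x.
Proof. exact: lt_le_trans (root_gt0 x) (ustop_homo x F0 (leq0n l)). Qed.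

(** Passing to a child multiplies an average by at most [A], which limits the overshoot at a
    jump. *)
Let cavg_reg l x : (l < L)%N -> cavg l.+1 F x <= A * cavg l F x.
Proof.
move=> lL; rewrite /cavg mulrA ler_pdivrMr ?cmass_gt0// mulrAC.
rewrite ler_pdivlMr ?cmass_gt0//.
have S0 (P : pred I) : 0 <= \sum_(y | P y) w y * F y.
  by apply: sumr_ge0 => y _; rewrite mulr_ge0// ltW.
have : \sum_(y | e l.+1 x y) w y * F y <= \sum_(y | e l x y) w y * F y.
  rewrite big_mkcond [leRHS]big_mkcond; apply: ler_sum => y _.
  case: ifPn => [/e_refine ->//|_]; case: ifP => // _.
  by rewrite mulr_ge0// ltW.
have := regular x lL; have := S0 (e l.+1 x); have := cmass_gt0 l x.
have := cmass_gt0 l.+1 x.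
set a := cmass _ _; set b := cmass _ _; set c := bigop _ _ _; set d := bigop _ _ _.
by move=> *; nra.
Qed.

(* [psib k u] is the conditional expectation of [u] at the first jump after
   level [L - k] (or at the last level). *)
Fixpoint psib k (u : I -> R) x : R :=
  if k is k'.+1 then
    if jump F (L - k') x then cavg (L - k') u x else psib k' u x
  else u x.

Let psib_ge0 k u x : (forall y, 0 <= u y) -> 0 <= psib k u x.
Proof. by move=> u0; elim: k => //= k IH; case: ifP => // _; exact: cavg_ge0. Qed.

(** Whether a jump occurs at a level is constant on the classes of that level. By the tower
    property, conditioning at the first later jump does not change the average at the current
    level. *)
Let cavg_psib k u x : (k <= L)%N -> cavg (L - k) (psib k u) x = cavg (L - k) u x.
Proof.
elim: k x => [|k IH] x kL; first by [].
have Lk : (L - k = (L - k.+1).+1)%N by rewrite subnSK.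
rewrite -(@cavg_tower _ (L - k)) ?Lk// -Lk.
rewrite -[RHS](@cavg_tower _ (L - k)) ?Lk// -Lk; congr cavg; apply/funext => y.
pose J1 z : R := (jump F (L - k) z)%:R.
have -> : psib k.+1 u = fun z => J1 z * cavg (L - k) u z + (1 - J1 z) * psib k u z.
  by apply/funext => z /=; rewrite /J1; case: jump => /=; ring.
have JI a b : e (L - k) a b -> J1 a = J1 b by rewrite /J1 => /(@jump_inv F) ->.
rewrite cavgD cavgZ// (@cavgZ _ (fun z => 1 - J1 z)); last first.
  by move=> a b ab; rewrite (JI _ _ ab).
by rewrite cavg_tower// IH ?(ltnW kL)//; ring.
Qed.

(** At a jump the [s]-norm of the mean of [h] is at most the mean of [F], hence at most [A] times
    the mean over the parent class, which [cavg_le_ustop] bounds by twice the stopped value before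
    the jump. *)
Let psib_bound k x : (k <= L)%N ->
  \sum_j psib k (h j) x `^ s <= (2 * A * ustop F (L - k) x) `^ s.
Proof.
have s0 : 0 <= s by have := s1; lra.
have mono a b : 0 <= a -> a <= b -> a `^ s <= b `^ s.
  by move=> a0 ab; rewrite ge0_ler_powR// nnegrE// (le_trans a0).
elim: k => [|k IH] kL /=.
  rewrite subn0; apply: (le_trans (hF x)); apply: mono => //.
  have := cavg_le_ustop L x F0; rewrite cavgL; have := u_gt0 L x.
  move: A1; set a := ustop _ _ _; set b := F x => ? ? ?; nra.
have Lk : (L - k = (L - k.+1).+1)%N by rewrite subnSK.
have [hj|hj] := boolP (jump F (L - k) x); last first.
  by rewrite -(@ustop_stay F (L - k.+1)) -?Lk ?IH// ltnW.
apply: (le_trans (@cavg_minkowski _ h F s _ x s1 h0 F0 hF)).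
apply: mono; first exact: cavg_ge0.
rewrite [in leLHS]Lk.
have lL : (L - k.+1 < L)%N by lia.
apply: (le_trans (cavg_reg x lL)).
have := cavg_le_ustop (L - k.+1) x F0; have := A1.
set a := cavg _ _ _; set b := ustop _ _ _ => ? ?; nra.
Qed.

Let psi l j x := psib (L - l) (h j) x.

Let psi_ge0 l j x : 0 <= psi l j x. Proof. exact: psib_ge0. Qed.

Let cavg_psi l j x : (l <= L)%N -> cavg l (psi l j) x = cavg l (h j) x.
Proof. by move=> lL; rewrite /psi -{1 3}(subKn lL) cavg_psib ?leq_subr// subKn. Qed.

Let psi_bound l x : (l <= L)%N ->
  \sum_j psi l j x `^ s <= (2 * A * ustop F l x) `^ s.
Proof.
by move=> lL; have := @psib_bound (L - l) x (leq_subr _ _); rewrite subKn.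
Qed.

Let psi_stay l j x : (l < L)%N -> ~~ jump F l.+1 x -> psi l j x = psi l.+1 j x.
Proof.
move=> lL hj; rewrite /psi; have -> : (L - l = (L - l.+1).+1)%N by lia.
by rewrite [LHS]/= subKn// (negbTE hj).
Qed.

Let incr l j x :=
  rmax (h j) l x `^ (s - 1) - (if l is k.+1 then rmax (h j) k x `^ (s - 1) else 0).

Let q0 : 0 <= s - 1. Proof. have := s1; lra. Qed.

Let rmaxS j l x : rmax (h j) l x <= rmax (h j) l.+1 x.
Proof. by rewrite /= le_max lexx. Qed.

Let rmax0 j l x : 0 <= rmax (h j) l x. Proof. exact: rmax_ge0. Qed.

Let powq_mono (a b : R) : 0 <= a -> a <= b -> a `^ (s - 1) <= b `^ (s - 1).
Proof. by move=> a0 ab; rewrite ge0_ler_powR// nnegrE// (le_trans a0). Qed.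

Let incr_ge0 l j x : 0 <= incr l j x.
Proof.
rewrite /incr subr_ge0; case: l => [|l]; first exact: powR_ge0.
exact: powq_mono (rmaxS _ _ _).
Qed.

Let incr_neq0 l j x : incr l j x != 0 -> rmax (h j) l x = cavg l (h j) x.
Proof.
case: l => [|l]; first by [].
rewrite /incr /=; have [?|?] := leP (rmax (h j) l x) (cavg l.+1 (h j) x) => //.
by rewrite subrr eqxx.
Qed.

(** Inactive leaves contribute at most half of the running maximum to the average of [psi], so when
    the maximum is attained at the current level, the active leaves alone account for the other
    half. *)
Let active l j x := rmax (h j) l x < 2 * psi l j x.

Let term l j x :=
  incr l j x * ustop F l x `^ (1 - s) * (psi l j x * (active l j x)%:R).

Let C1 := 2 `^ (s - 1) * (2 * A) `^ s.

(** [psi_bound] gives a multiple of u^s, of which the weight u^(1-s) leaves one factor u. *)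
Let tail_bound l x : (l <= L)%N ->
  ustop F l x `^ (1 - s) * (\sum_j psi l j x * (2 * psi l j x) `^ (s - 1)) <=
  C1 * ustop F l x.
Proof.
move=> lL; have sp : 0 < s by have := s1; lra.
have -> : \sum_j psi l j x * (2 * psi l j x) `^ (s - 1) =
    2 `^ (s - 1) * \sum_j psi l j x `^ s.
  rewrite mulr_sumr; apply: eq_bigr => j _; rewrite powRM//.
  by rewrite -(mulr_powRB1 (psi_ge0 l j x) sp); ring.
have := psi_bound x lL; rewrite powRM; [|by have := A1; nra|exact: ltW].
have -> : ustop F l x `^ s = ustop F l x * ustop F l x `^ (s - 1).
  by rewrite mulr_powRB1// ltW.
have : ustop F l x `^ (1 - s) * ustop F l x `^ (s - 1) = 1.
  have -> : 1 - s = - (s - 1) by ring.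
  by rewrite powRN mulVf// gt_eqF// powR_gt0.
have := powR_gt0 (s - 1) (u_gt0 l x); have := powR_gt0 (1 - s) (u_gt0 l x).
have : 0 < 2 `^ (s - 1) :> R by exact: powR_gt0.
rewrite /C1; move: (2 `^ _) (_ `^ (1 - s)) (ustop F l x `^ (s - 1)) => a b c.
move: (bigop _ _ _) ((2 * A) `^ s) (ustop F l x) => S d u a0 b0 c0 bc hS.
have -> : a * d * u = b * (a * (d * (u * c))).
  transitivity ((b * c) * (a * d * u)); [by rewrite bc mul1r|ring].
by rewrite ler_pM2l// ler_pM2l.
Qed.

(** Potential function: between two jumps [psi] is constant, and psi cap^(s-1) pays for all active
    increments met so far, because an active increment happens while the running maximum is below
    [2 * psi]. *)
Let cap l j x := Num.min (rmax (h j) l x) (2 * psi l j x).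

Let cap_ge0 l j x : 0 <= cap l j x.
Proof. by rewrite le_min rmax0 mulr_ge0. Qed.

Let active_incr l j x :
  incr l j x * (psi l j x * (active l j x)%:R) <=
  psi l j x * cap l j x `^ (s - 1).
Proof.
rewrite /active /cap; case: ltP => hj; last by rewrite !mulr0 mulr_ge0 ?powR_ge0.
rewrite mulr1 mulrC ler_wpM2l// lerBlDr lerDl.
by case: l {hj} => // l; exact: powR_ge0.
Qed.

(** If the leaf is active at level [l.+1], both caps are the running maxima and the potential grows
    exactly by the increment. Otherwise it only has to be monotone. *)
Let active_step l j x : (l < L)%N -> ~~ jump F l.+1 x ->
  psi l j x * cap l j x `^ (s - 1) +
  incr l.+1 j x * (psi l.+1 j x * (active l.+1 j x)%:R) <=
  psi l.+1 j x * cap l.+1 j x `^ (s - 1).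
Proof.
move=> lL hj; rewrite (psi_stay j lL hj) /cap (psi_stay j lL hj).
rewrite [incr _ _ _ * _]mulrC -mulrA -mulrDr ler_wpM2l//.
rewrite /active; case: ltP => ha.
  rewrite mul1r min_l; last exact: le_trans (rmaxS j l x) (ltW ha).
  by rewrite /incr addrC subrK.
rewrite mul0r addr0; apply: powq_mono; first by rewrite le_min rmax0 mulr_ge0.
by rewrite ?le_min ge_min lexx orbT.
Qed.

Let cap_bound l x :
  ustop F l x `^ (1 - s) * \sum_j psi l j x * cap l j x `^ (s - 1) <=
  ustop F l x `^ (1 - s) * (\sum_j psi l j x * (2 * psi l j x) `^ (s - 1)).
Proof.
rewrite ler_wpM2l ?powR_ge0//; apply: ler_sum => j _; rewrite ler_wpM2l//.
by apply: powq_mono => //; rewrite ge_min lexx orbT.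
Qed.

(** At a jump the potential of the finished stretch costs at most C1 u by [tail_bound], and 2 C1 u
    before the jump is at most C1 u after it, because [u] more than doubles. The costs of the
    stretches thus add up like a geometric series. *)
Let sum_terms l x : (l <= L)%N ->
  \sum_(i < l.+1) \sum_j term i j x <= C1 * ustop F l x +
  ustop F l x `^ (1 - s) * \sum_j psi l j x * cap l j x `^ (s - 1).
Proof.
have termE i : \sum_j term i j x = ustop F i x `^ (1 - s) *
    \sum_j incr i j x * (psi i j x * (active i j x)%:R).
  by rewrite mulr_sumr; apply: eq_bigr => j _; rewrite /term; ring.
have C1_ge0 : 0 <= C1 by rewrite mulr_ge0 ?powR_ge0.
have one i : \sum_j term i j x <=
    ustop F i x `^ (1 - s) * \sum_j psi i j x * cap i j x `^ (s - 1).
  rewrite termE ler_wpM2l ?powR_ge0//; apply: ler_sum => j _.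
  exact: active_incr.
elim: l => [|l IH] lL.
  rewrite big_ord_recr /= big_ord0 add0r; apply: (le_trans (one _)).
  by rewrite lerDr mulr_ge0// ltW.
have -> : \sum_(i < l.+2) \sum_j term i j x = \sum_(i < l.+1) \sum_j term i j x + \sum_j term l.+1 j x.
  by rewrite big_ord_recr.
have [hj|hj] := boolP (jump F l.+1 x).
  apply: lerD; last exact: one.
  apply: (le_trans (IH (ltnW lL))).
  have h2 := le_trans (cap_bound l x) (tail_bound x (ltnW lL)).
  have h3 : 2 * ustop F l x <= ustop F l.+1 x by rewrite (ustop_jump hj) ltW.
  have := ler_wpM2l C1_ge0 h3; move: h2; rewrite [C1 * (2 * _)]mulrCA; move: (C1 * _) (C1 * _) (_ * bigop _ _ _) => a b c; lra.
rewrite (ustop_stay hj) termE (ustop_stay hj).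
apply: (le_trans (lerD (IH (ltnW lL)) (lexx _))).
rewrite -addrA lerD2l -mulrDr ler_wpM2l ?powR_ge0// -big_split/=.
by apply: ler_sum => j _; exact: active_step.
Qed.

Let sum_terms_le x : \sum_(i < L.+1) \sum_j term i j x <= 2 * C1 * ustop F L x.
Proof.
apply: (le_trans (sum_terms x (leqnn L))).
by have := le_trans (cap_bound L x) (tail_bound x (leqnn L)); lra.
Qed.

(** The weight u^(1-s) does not increase with the level, since s > 1. So in each step the part
    already summed may keep its older, larger weight. *)
Let telescope l j x :
  rmax (h j) l x `^ s * ustop F l x `^ (1 - s) <=
  \sum_(i < l.+1)
    s / (s - 1) * (incr i j x * rmax (h j) i x * ustop F i x `^ (1 - s)).
Proof.
have c0 : 0 < s / (s - 1) by apply: divr_gt0; have := s1; lra.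
pose t i := s / (s - 1) * (incr i j x * rmax (h j) i x * ustop F i x `^ (1 - s)).
elim: l => [|l IH].
  rewrite big_ord_recr /= big_ord0 add0r mulrA ler_wpM2r ?powR_ge0//.
  have := powR_diff_le s1 (lexx 0) (rmax0 j 0 x).
  by rewrite powR0 ?subr0; last (by have := s1; lra); rewrite [0 `^ _]powR0; last (by have := s1; lra).
have -> : \sum_(i < l.+2) t i = \sum_(i < l.+1) t i + t l.+1.
  by rewrite big_ord_recr.
apply: (@le_trans _ _ (rmax (h j) l x `^ s * ustop F l x `^ (1 - s) +
   (rmax (h j) l.+1 x `^ s - rmax (h j) l x `^ s) * ustop F l.+1 x `^ (1 - s))).
  rewrite mulrBl addrCA lerDl subr_ge0.
  rewrite ler_wpM2l ?powR_ge0//.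
  have E (y : R) : y `^ (1 - s) = (y `^ (s - 1))^-1 by rewrite -powRN opprB.
  rewrite !E lef_pV2 ?posrE ?powR_gt0 ?u_gt0//; apply: powq_mono; first exact: ltW.
  exact: ustop_homo.
apply: lerD => //; rewrite /t mulrA ler_wpM2r ?powR_ge0//.
exact: powR_diff_le (rmax0 j l x) (rmaxS j l x).
Qed.

(** A nonzero increment means that the running maximum is the current average of [psi], at least
    half of which sits on active leaves. The other factors are constant on the class, so
    self-adjointness moves the averaging onto [g]. *)
Let level_bound i j : (i <= L)%N ->
  \sum_x w x * (incr i j x * rmax (h j) i x * ustop F i x `^ (1 - s) * g x) <=
  2 * \sum_x w x * (term i j x * cavg i g x).
Proof.
move=> iL.
pose z x := psi i j x * (active i j x)%:R.
pose c x := incr i j x * ustop F i x `^ (1 - s).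
have c0 x : 0 <= c x by rewrite mulr_ge0 ?powR_ge0.
have cI x y : e i x y -> c x = c y.
  move=> xy; rewrite /c /incr (ustop_inv _ xy) (rmax_inv _ xy).
  by case: (i) xy => // k /e_refine xy; rewrite (rmax_inv _ xy).
have -> : \sum_x w x * (term i j x * cavg i g x) =
    \sum_x w x * (cavg i z x * (c x * g x)).
  rewrite cavg_selfadj; apply: eq_bigr => x _.
  by rewrite cavgZ// /term /c /z; ring.
rewrite mulr_sumr; apply: ler_sum => x _.
rewrite [leRHS]mulrCA ler_pM2l//.
have -> : incr i j x * rmax (h j) i x * ustop F i x `^ (1 - s) * g x =
  (c x * g x) * rmax (h j) i x by rewrite /c; ring.
have -> : 2 * (cavg i z x * (c x * g x)) = (c x * g x) * (2 * cavg i z x) by ring.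
have [cx|cx] := eqVneq (c x) 0; first by rewrite cx !mul0r.
apply: ler_wpM2l; first by apply: mulr_ge0.
have ix : incr i j x != 0 by apply: contra_neq cx => ix; rewrite /c ix mul0r.
have E := incr_neq0 ix.
have : cavg i (psi i j) x <= cavg i z x + rmax (h j) i x / 2.
  pose d (y : I) := rmax (h j) i y / 2.
  have <- : cavg i d x = rmax (h j) i x / 2.
    by apply: cavg_id => a b ab; rewrite /d (rmax_inv _ ab).
  rewrite -cavgD; apply: cavg_mono => y; rewrite /z /d /active.
  case: ltP => hh; rewrite ?mulr1 ?mulr0 ?add0r.
    by rewrite lerDl divr_ge0.
  by rewrite ler_pdivlMr// mulrC.
rewrite (cavg_psi j x iL) -E; move: (rmax _ _ _) (cavg _ _ _) => a b; lra.
Qed.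

Theorem tree_vector_valued :
  \sum_x w x * ((\sum_j rmax (h j) L x `^ s) `^ s^-1 * g x) <=
  vv_const s A * \sum_x w x * (rmax F L x * rmax g L x).
Proof.
have c0 : 0 < s / (s - 1) by apply: divr_gt0; have := s1; lra.
have g_le x : g x <= rmax g L x by rewrite -{1}(cavgL g x) cavg_le_rmax.
have C0 : 0 <= C1 by rewrite mulr_ge0 ?powR_ge0.
have step1 : \sum_x w x * ((\sum_j rmax (h j) L x `^ s) `^ s^-1 * g x) <=
    \sum_x w x * (ustop F L x * g x) +
    \sum_x w x * ((\sum_j rmax (h j) L x `^ s) * ustop F L x `^ (1 - s) * g x).
  rewrite -big_split/=; apply: ler_sum => x _; rewrite -mulrDr ler_pM2l//.
  rewrite -mulrDl ler_wpM2r//.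
  have := powR_absorb s1 (u_gt0 L x) (powR_ge0 (\sum_j rmax (h j) L x `^ s) s^-1).
  rewrite -powRrM mulVf; last (by have := s1; lra).
  by rewrite powRr1 ?sumr_ge0//; [rewrite addrC|move=> j _; exact: powR_ge0].
have step2 : \sum_x w x * ((\sum_j rmax (h j) L x `^ s) * ustop F L x `^ (1 - s) * g x)
   <= s / (s - 1) * \sum_j \sum_(i < L.+1)
   \sum_x w x * (incr i j x * rmax (h j) i x * ustop F i x `^ (1 - s) * g x).
  have -> : s / (s - 1) * (\sum_j \sum_(i < L.+1)
     \sum_x w x * (incr i j x * rmax (h j) i x * ustop F i x `^ (1 - s) * g x)) =
    \sum_x w x * ((\sum_j \sum_(i < L.+1)
     s / (s - 1) * (incr i j x * rmax (h j) i x * ustop F i x `^ (1 - s))) * g x).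
    under eq_bigr => j _ do rewrite exchange_big/=.
    rewrite exchange_big/= mulr_sumr; apply: eq_bigr => x _.
    rewrite mulr_suml !mulr_sumr; apply: eq_bigr => j _.
    rewrite mulr_suml !mulr_sumr; apply: eq_bigr => i _; ring.
  apply: ler_sum => x _; rewrite ler_pM2l// ler_wpM2r// mulr_suml.
  by apply: ler_sum => j _; exact: telescope.
have step3 : \sum_j \sum_(i < L.+1)
   \sum_x w x * (incr i j x * rmax (h j) i x * ustop F i x `^ (1 - s) * g x) <=
   2 * \sum_x w x * (2 * C1 * ustop F L x * rmax g L x).
  apply: (@le_trans _ _ (2 * \sum_x w x *
      ((\sum_(i < L.+1) \sum_j term i j x) * rmax g L x))).
    have -> : 2 * (\sum_x w x * ((\sum_(i < L.+1) \sum_j term i j x) * rmax g L x))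
      = \sum_j \sum_(i < L.+1) 2 * \sum_x w x * (term i j x * rmax g L x).
      under [RHS]eq_bigr => j _ do
        (under eq_bigr => i _ do rewrite mulr_sumr; rewrite exchange_big/=).
      rewrite [RHS]exchange_big/= mulr_sumr; apply: eq_bigr => x _.
      rewrite [\sum_(i < _) _]exchange_big/= mulr_suml !mulr_sumr.
      apply: eq_bigr => j _.
      by rewrite mulr_suml !mulr_sumr; apply: eq_bigr => i _; ring.
    apply: ler_sum => j _; apply: ler_sum => i _.
    apply: (le_trans (level_bound j (ltn_ord i))).
    rewrite ler_pM2l//; apply: ler_sum => x _; rewrite ler_pM2l// ler_wpM2l//.
      by rewrite /term !mulr_ge0 ?powR_ge0.
    by apply: cavg_le_rmax; rewrite -ltnS.
  rewrite ler_pM2l//; apply: ler_sum => x _; rewrite ler_pM2l// ler_wpM2r//.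
  exact: rmax_ge0.
apply: (le_trans step1).
have step4 : \sum_x w x * (ustop F L x * g x) <=
    \sum_x w x * (rmax F L x * rmax g L x).
  apply: ler_sum => x _; rewrite ler_pM2l// ler_pM//; first exact: ltW.
  exact: ustop_le_rmax.
have step5 : \sum_x w x * (2 * C1 * ustop F L x * rmax g L x) <=
    2 * C1 * \sum_x w x * (rmax F L x * rmax g L x).
  rewrite mulr_sumr; apply: ler_sum => x _; rewrite [leRHS]mulrCA ler_pM2l// -mulrA.
  apply: ler_wpM2l; first by rewrite mulr_ge0.
  by rewrite ler_wpM2r ?rmax_ge0// ustop_le_rmax.
rewrite /vv_const -/C1.
have : s / (s - 1) * (\sum_j \sum_(i < L.+1)
   \sum_x w x * (incr i j x * rmax (h j) i x * ustop F i x `^ (1 - s) * g x)) <=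
   s / (s - 1) * (2 * (2 * C1 * \sum_x w x * (rmax F L x * rmax g L x))).
  by rewrite ler_pM2l//; apply: (le_trans step3); rewrite ler_pM2l.
move: (\sum_x w x * (rmax F L x * rmax g L x)) step2 step4 => D.
by move=> *; lra.
Qed.

End vector_valued.

End tree.

(** * Lebesgue measure of boxes *)

Section box_volume_lower_bound.
Variable R : realType.

Let ind (a b x : R) : R := (x \in `[a, b[)%:R.

Let ind_indic a b : ind a b = \1_(`[a, b[ : set R).
Proof. by apply/funext => x; rewrite indicE /ind mem_setE. Qed.

Let integral_ind a b c : 0 <= c ->
  (\int[lebesgue_measure]_x (c * ind a b x)%:E = (c * Num.max 0 (b - a))%:E)%E.
Proof.
move=> c0; under eq_integral do rewrite EFinM.
rewrite ge0_integralZl_EFin//; last 2 first.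
- by move=> x _; rewrite lee_fin ler0n.
- by apply/measurable_EFinP; rewrite ind_indic; exact: measurable_indic.
rewrite ind_indic integral_indic// setIT EFinM; congr (_ * _)%E.
have := @lebesgue_measure_itv R `[a, b[; rewrite /= lte_fin => ->.
by case: ltP => ab; [rewrite max_r ?subr_ge0 ?ltW|rewrite max_l ?subr_le0].
Qed.

(* Integrating out the coordinates one at a time replaces each indicator of an
   interval by its length, which avoids both product measures and compactness. *)
Lemma sum_box_volume (m : nat) (c0 : R) (c : nat -> R) (a b : nat -> R)
    (A B : nat -> nat -> R) :
  0 <= c0 -> (forall k, 0 <= c k) ->
  (forall x : nat -> R, (c0 * \prod_(i < m) ind (a i) (b i) (x i))%:E <=
     \sum_(k <oo) (c k * \prod_(i < m) ind (A k i) (B k i) (x i))%:E)%E ->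
  ((c0 * \prod_(i < m) Num.max 0 (b i - a i))%:E <=
     \sum_(k <oo) (c k * \prod_(i < m) Num.max 0 (B k i - A k i))%:E)%E.
Proof.
elim: m c0 c => [|m IH] c0 c c00 ck0 H.
  have := H (fun=> 0); rewrite !big_ord0 => /le_trans; apply.
  by apply: lee_nneseries => k _; rewrite ?big_ord0// lee_fin mulr1.
have mx (u v : R) : 0 <= Num.max 0 (v - u) by rewrite le_max lexx.
have P0 (u v x : nat -> R) : 0 <= \prod_(i < m) ind (u i) (v i) (x i).
  by apply: prodr_ge0 => i _; rewrite ler0n.
have E (d u v : R) (Q : R) : d * (Q * Num.max 0 (v - u)) = d * Num.max 0 (v - u) * Q.
  by ring.
(* The last side length moves into the coefficients, which the statement carries for this induction.
   Points are sequences so that the number of coordinates may vary. *)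
rewrite big_ord_recr/= E; under eq_eseriesr => k _ do rewrite big_ord_recr/= E.
apply: IH => [|k|x]; rewrite ?mulr_ge0//.
pose y (t : R) i := if i == m then t else x i.
have yP (u v : nat -> R) t :
    \prod_(i < m) ind (u i) (v i) (y t i) = \prod_(i < m) ind (u i) (v i) (x i).
  by apply: eq_bigr => i _; rewrite /y ltn_eqF.
have key d (u v : nat -> R) t : d * \prod_(i < m.+1) ind (u i) (v i) (y t i) =
    (d * \prod_(i < m) ind (u i) (v i) (x i)) * ind (u m) (v m) t.
  by rewrite big_ord_recr/= yP mulrA /y eqxx.
have mono : (\int[lebesgue_measure]_t
    (c0 * \prod_(i < m.+1) ind (a i) (b i) (y t i))%:E <=
   \int[lebesgue_measure]_t
    \sum_(k <oo) (c k * \prod_(i < m.+1) ind (A k i) (B k i) (y t i))%:E)%E.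
  have meas d (u v : nat -> R) : measurable_fun setT
      (fun t => (d * \prod_(i < m.+1) ind (u i) (v i) (y t i))%:E).
    apply/measurable_EFinP; under eq_fun do rewrite key.
    apply: measurable_funM => //; rewrite ind_indic; exact: measurable_indic.
  have pos d (u v : nat -> R) t : 0 <= d ->
      (0 <= (d * \prod_(i < m.+1) ind (u i) (v i) (y t i))%:E)%E.
    by move=> d0; rewrite key lee_fin !mulr_ge0// ler0n.
  apply: ge0_le_integral => [//|t _|||t _].
  - exact: pos.
  - exact: meas.
  - by apply: ge0_emeasurable_sum => [k t _ _|k _]; [exact: pos|exact: meas].
  - exact: H.
move: mono; rewrite integral_nneseries//; last 2 first.
- move=> k; apply/measurable_EFinP; under eq_fun do rewrite key.
  by apply: measurable_funM => //; rewrite ind_indic; exact: measurable_indic.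
- by move=> k t _; rewrite key lee_fin !mulr_ge0// ler0n.
under eq_integral do rewrite key.
rewrite integral_ind ?mulr_ge0// mulrAC.
under eq_eseriesr => k _.
  under eq_integral do rewrite key.
  rewrite integral_ind ?mulr_ge0// mulrAC; over.
by [].
Qed.

End box_volume_lower_bound.

(** * Measurability and volume of boxes and cubes *)

Section boxes.
Variables (R : realType) (n : nat).
Local Notation V := 'rV[R]_n.+1.
Local Notation T := (Rn R n).
Local Notation mu := (@lebesgue_Rn R n).

Lemma lebesgue_Rn_box (a b : V) :
  mu (box true true a b) = (box_volume a b)%:E.
Proof.
apply/eqP; rewrite eq_le; apply/andP; split.
  (* The box covers itself; all other members of the cover are degenerate, of volume zero. *)
  apply: ereal_inf_lbound; exists (fun k : nat => if k == 0%N then (a, b) else (0, 0)).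
    by move=> x xab; exists 0%N.
  rewrite nneseries_recl//; last first.
    by move=> k _; rewrite lee_fin; apply: prodr_ge0 => i _; rewrite le_max lexx.
  rewrite /= eseries0 ?adde0// => k k0 _; rewrite gtn_eqF//.
  by rewrite /box_volume big_ord_recl subrr maxxx mul0r.
apply: le_ereal_inf_tmp => _ [c cov <-].
pose ex (v : V) (i : nat) : R := v ord0 (inord i).
have volE (u v : V) : box_volume u v = 1 * \prod_(i < n.+1) Num.max 0 (ex v i - ex u i).
  by rewrite mul1r; apply: eq_bigr => i _; rewrite /ex inord_val.
rewrite volE; under eq_eseriesr do rewrite volE.
(* Being a cover means that the indicators of its boxes sum to at least the indicator of the given
   box. *)
apply: (@sum_box_volume R n.+1 1 (fun=> 1) (ex a) (ex b) (fun k => ex (c k).1) (fun k => ex (c k).2)) => [||x] //.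
pose X : V := \row_i x i.
have PE (u v : V) : \prod_(i < n.+1) (x i \in `[ex u i, ex v i[)%:R =
    (`[< box true true u v X >])%:R :> R.
  have [/asboolP h|/asboolPn] := boolP `[< box true true u v X >].
    rewrite big1// => i _; have := h i.
    by rewrite /ex inord_val mxE => ->.
  move=> h; have /existsNP[i hi] : ~ (forall i, X ord0 i \in `[u ord0 i, v ord0 i[).
    by move=> h2; apply: h => i; exact: h2.
  rewrite (bigD1 i)//= /ex inord_val; move: hi; rewrite mxE => /negP/negbTE ->.
  by rewrite mul0r.
rewrite PE; under eq_eseriesr do rewrite PE.
have pos k : (0%:E <= (1 * (`[< box true true (c k).1 (c k).2 X >])%:R : R)%:E)%E.
  by rewrite mul1r lee_fin.
have [/asboolP h|_] := boolP `[< box true true a b X >]; last first.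
  by rewrite mulr0; apply: nneseries_ge0 => k _ _.
have [k _ hk] := cov _ h.
apply: le_trans (nneseries_lim_ge k.+1 _); last by move=> j _ _.
rewrite big_nat_recr//= (asboolT hk) leeDr// sume_ge0//.
Qed.

(** The hyperplane x_i = c cuts each covering box into two half-open boxes, [lo] and [hi], whose
    volumes add up. Hence a half-space satisfies Caratheodory's criterion. *)
Lemma measurable_coord (i : 'I_n.+1) :
  measurable_fun setT (fun x : T => (x : V) ord0 i : R).
Proof.
apply: (measurability (RGenCInfty.G (R:=R))); first exact: RGenCInfty.measurableE.
move=> _ [_ [c ->] <-]; rewrite setTI.
apply: le_caratheodory_measurable => X.
rewrite -[leRHS]/(lebesgue_outer X); apply: le_ereal_inf_tmp => _ [d Xd <-].
pose upd (u : V) (f : R -> R) : V := \row_j (if j == i then f (u ord0 j) else u ord0 j).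
pose lo k := ((d k).1, upd (d k).2 (Num.min c)).
pose hi k := (upd (d k).1 (Num.max c), (d k).2).
have vol0 (u v : V) : (0 <= (box_volume u v)%:E)%E.
  by rewrite lee_fin; apply: prodr_ge0 => j _; rewrite le_max lexx.
have -> : (\sum_(k <oo) (box_volume (d k).1 (d k).2)%:E =
   \sum_(k <oo) (box_volume (hi k).1 (hi k).2)%:E +
   \sum_(k <oo) (box_volume (lo k).1 (lo k).2)%:E)%E.
  rewrite -nneseriesD; [|by move=> k *; exact: vol0|by move=> k *; exact: vol0].
  apply: eq_eseriesr => k _; rewrite -EFinD; congr (_%:E).
  rewrite /box_volume /= (bigD1 i)//= [X in _ = X + _](bigD1 i)//=.
  rewrite [X in _ = _ + X](bigD1 i)//= !mxE !eqxx.
  have rest u : (forall j, j != i -> u j = Num.max 0 ((d k).2 ord0 j - (d k).1 ord0 j))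
     -> \prod_(j | j != i) u j =
        \prod_(j | j != i) Num.max 0 ((d k).2 ord0 j - (d k).1 ord0 j).
    by move=> h; apply: eq_bigr => j /h.
  rewrite (rest (fun j => Num.max 0 ((d k).2 ord0 j - upd (d k).1 (Num.max c) ord0 j))); last first.
    by move=> j /negbTE ji; rewrite mxE ji.
  rewrite (rest (fun j => Num.max 0 (upd (d k).2 (Num.min c) ord0 j - (d k).1 ord0 j))); last first.
    by move=> j /negbTE ji; rewrite mxE ji.
  rewrite -mulrDl; congr (_ * _).
  move: ((d k).1 ord0 i) ((d k).2 ord0 i) => u v.
  rewrite /Num.max /Num.min; repeat case: ifPn; rewrite -?leNgt => *; lra.
apply: leeD; apply: ereal_inf_lbound.
  exists hi => //= x [/= Xx cx]; have [k _ hk] := Xd _ Xx; exists k => // j.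
  have := hk j; rewrite /= !mxE; case: eqP => [->|//].
  by rewrite !in_itv/= ge_max => /andP[-> ->]; move: cx; rewrite /= in_itv/= andbT => ->.
exists lo => //= x [/= Xx cx]; have [k _ hk] := Xd _ Xx; exists k => // j.
have := hk j; rewrite /= !mxE; case: eqP => [->|//].
rewrite !in_itv/= lt_min => /andP[-> ->]; rewrite andbT /=.
by move: cx; rewrite /= in_itv/= andbT => /negP; rewrite -ltNge.
Qed.

Lemma measurable_box s t (a b : V) : measurable (box s t a b : set T).
Proof.
have -> : (box s t a b : set T) = \bigcap_(i in [set: 'I_n.+1])
    ((fun x : T => (x : V) ord0 i) @^-1`
       [set` Interval (BSide s (a ord0 i)) (BSide t (b ord0 i))]).
  by apply/seteqP; split => x h i; [move=> _|]; exact: h.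
apply: fin_bigcap_measurable => // i _.
by rewrite -[X in measurable X]setTI; apply: measurable_coord.
Qed.

Lemma box_volume_cube (a : V) l : 0 <= l -> box_volume a (a + const_mx l) = l ^+ n.+1.
Proof.
move=> l0; rewrite /box_volume (eq_bigr (fun=> l)) ?prodr_const ?card_ord//.
by move=> i _; rewrite !mxE addrAC subrr add0r max_r.
Qed.

Lemma ler_exprD_lim (v l : R) m : 0 <= l ->
  (forall e, 0 < e -> v <= (l + e) ^+ m) -> v <= l ^+ m.
Proof.
move=> l0 H; have c : (fun k => (l + harmonic k) ^+ m) @ \oo --> (l : R) ^+ m.
  have c0 : (fun k => l + harmonic k) @ \oo --> l.
    by rewrite -[X in _ --> X]addr0; apply: cvgD; [exact: cvg_cst|exact: cvg_harmonic].
  exact: (cvg_comp _ _ c0 (@exprn_continuous R m l)).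
rewrite -(cvg_lim (@Rhausdorff R) c); apply: limr_ge; first by apply/cvg_ex; exists (l ^+ m).
by apply: nearW => k; apply: H; rewrite /harmonic /= invr_gt0.
Qed.

(** Whatever the endpoints, the cube is squeezed between half-open cubes of sides [l * (1 - e)] and
    [l + e]. *)
Lemma lebesgue_Rn_cube s t (a : V) l : 0 < l ->
  mu (box s t a (a + const_mx l)) = (l ^+ n.+1)%:E.
Proof.
move=> l0; set Q := box s t _ _.
have upper e : 0 < e -> (mu Q <= ((l + e) ^+ n.+1)%:E)%E.
  move=> e0; have le0 : 0 <= l + e by lra.
  rewrite -(@box_volume_cube a _ le0) -lebesgue_Rn_box.
  apply: (le_outer_measure (@lebesgue_outer R n)) => x h i; have := h i.
  by rewrite !mxE; case: (s); case: (t); rewrite /= !in_itv/= => /andP[h1 h2];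
    apply/andP; split; lra.
have lower e : 0 < e -> e <= 1 -> (((l * (1 - e)) ^+ n.+1)%:E <= mu Q)%E.
  move=> e0 e1; pose d := e * l / 2.
  have d0 : 0 < d by rewrite divr_gt0 ?mulr_gt0.
  have -> : l * (1 - e) = l - e * l by ring.
  have el : e * l <= l by rewrite ger_pMl.
  rewrite -(@box_volume_cube (a + const_mx d)) ?subr_ge0// -lebesgue_Rn_box.
  apply: (le_outer_measure (@lebesgue_outer R n)) => x h i; have := h i.
  rewrite !mxE; case: (s); case: (t); rewrite /= !in_itv/= => /andP[h1 h2];
    apply/andP; split; move: d0 h1 h2; rewrite /d; lra.
have fin : mu Q \is a fin_num.
  rewrite ge0_fin_numE ?measure_ge0//; apply: le_lt_trans (upper 1 ltr01) (ltry _).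
rewrite -(fineK fin); congr (_%:E); apply/eqP; rewrite eq_le; apply/andP; split.
  by apply: ler_exprD_lim => [|e e0]; [exact: ltW|rewrite -lee_fin fineK// upper].
have [//|hlt] := leP (l ^+ n.+1) (fine (mu Q)).
have v0 : 0 <= fine (mu Q) by rewrite fine_ge0// measure_ge0.
suff : l ^+ n.+1 <= fine (mu Q) by rewrite leNgt hlt.
have H e : 0 < e -> e < 1 -> l ^+ n.+1 * (1 - e) ^+ n.+1 <= fine (mu Q).
  by move=> e0 e1; rewrite -exprMn -lee_fin fineK// lower// ltW.
have c : (fun k => l ^+ n.+1 * (1 - harmonic k.+1) ^+ n.+1) @ \oo --> l ^+ n.+1 * (1 : R) ^+ n.+1.
  have c0 : (fun k => 1 - harmonic k.+1) @ \oo --> (1 : R).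
    rewrite -[X in _ --> X]subr0; apply: cvgB; first exact: cvg_cst.
    by rewrite (cvg_shiftS (@harmonic R)); exact: cvg_harmonic.
  by apply: cvgMr; exact: (cvg_comp _ _ c0 (@exprn_continuous R n.+1 1)).
rewrite -[leLHS]mulr1 -(expr1n _ n.+1) -(cvg_lim (@Rhausdorff R) c).
apply: limr_le; first by apply/cvg_ex; eexists; exact: c.
apply: nearW => k; apply: H; rewrite /harmonic /= ?invr_gt0//.
by rewrite invf_lt1// ltr1n.
Qed.

End boxes.

(** * Function lattices *)

Section general_facts.
Variable R : realType.

Lemma measurable_ereal_sup d (T : measurableType d) (f : nat -> T -> \bar R) :
  (forall k, measurable_fun setT (f k)) ->
  measurable_fun setT (fun x => ereal_sup (range (f ^~ x))).
Proof.
move=> mf; rewrite (_ : (fun x => _) = (fun x => esups (f ^~ x) 0%N)).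
  exact: measurable_fun_esups.
apply/funext => x; rewrite /esups /sdrop /=; congr ereal_sup.
by apply/seteqP; split => _ [k _ <-]; exists k.
Qed.

Lemma le_powR (s a b : R) : 0 < s -> 0 <= a -> a <= b -> a `^ s <= b `^ s.
Proof.
by move=> s0 a0 ab; rewrite ge0_ler_powR ?(ltW s0)// nnegrE// (le_trans a0).
Qed.

Lemma le_poweR (s : R) (a b : \bar R) : 0 < s -> (0 <= a)%E -> (a <= b)%E ->
  (a `^ s <= b `^ s)%E.
Proof.
move=> s0 a0 ab; apply: gt0_ler_poweR => //; rewrite ?(ltW s0)// in_itv/= leey andbT//.
exact: le_trans ab.
Qed.

Lemma powRK (s a : R) : 0 < s -> 0 <= a -> (a `^ s) `^ s^-1 = a.
Proof. by move=> s0 a0; rewrite -powRrM mulfV ?gt_eqF// powRr1. Qed.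

Lemma powRVK (s a : R) : 0 < s -> 0 <= a -> (a `^ s^-1) `^ s = a.
Proof. by move=> s0 a0; rewrite -powRrM mulVf ?gt_eqF// powRr1. Qed.

(** Monotonicity does the work: the limit of the powers, raised to 1/p, bounds every term of [u],
    hence its limit. *)
Lemma cvg_powR_nondecreasing (u : nat -> R) (l p : R) : 0 < p ->
  (forall k, 0 <= u k) -> (forall k, u k <= u k.+1) ->
  u @ \oo --> l -> (fun k => u k `^ p) @ \oo --> l `^ p.
Proof.
move=> p0 u0 uS ul.
have nd : nondecreasing_seq u by apply/nondecreasing_seqP.
have ule k : u k <= l.
  by rewrite -(cvg_lim (@Rhausdorff R) ul); apply: nondecreasing_cvgn_le => //; apply/cvg_ex; exists l.
have l0 : 0 <= l by apply: le_trans (ule 0%N).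
have ndp : nondecreasing_seq (fun k => u k `^ p).
  by apply/nondecreasing_seqP => k; exact: le_powR.
have cp : cvgn (fun k => u k `^ p).
  apply: nondecreasing_is_cvgn => //; exists (l `^ p) => _ [k _ <-].
  exact: le_powR.
have [L cL] := (cvg_ex _).1 cp.
have pL k : u k `^ p <= L.
  by rewrite -(cvg_lim (@Rhausdorff R) cL); apply: nondecreasing_cvgn_le.
have L0 : 0 <= L by apply: le_trans (pL 0%N); exact: powR_ge0.
suff -> : l `^ p = L by [].
apply/eqP; rewrite eq_le; apply/andP; split; last first.
  rewrite -(cvg_lim (@Rhausdorff R) cL); apply: limr_le => //.
  by apply: nearW => k; exact: le_powR.
suff : l <= L `^ p^-1.
  by move=> /(le_powR p0 l0); rewrite -powRrM mulVf ?gt_eqF// powRr1.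
rewrite -(cvg_lim (@Rhausdorff R) ul); apply: limr_le; first by apply/cvg_ex; exists l.
apply: nearW => k; have -> : u k = (u k `^ p) `^ p^-1.
  by rewrite -powRrM mulfV ?gt_eqF// powRr1.
by apply: le_powR; rewrite ?invr_gt0 ?powR_ge0.
Qed.

End general_facts.

Section lattices.
Variables (R : realType) (n : nat).
Local Notation V := 'rV[R]_n.+1.
Local Notation T := (Rn R n).
Local Notation mu := (@lebesgue_Rn R n).
Implicit Types (Z Y : fspace R n).

(** The cubes [-k-1, k+1)^(n+1), nondegenerate already for k = 0. This countable exhaustion is used
    for every localisation. *)
Definition centered_cube (k : nat) : set T :=
  box true true (const_mx (- k.+1%:R) : V) (const_mx (- k.+1%:R) + const_mx (2 * k.+1%:R)).

Lemma measurable_centered_cube k : measurable (centered_cube k).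
Proof. exact: measurable_box. Qed.

Lemma centered_cubeP k (x : T) :
  centered_cube k x <-> forall i, - k.+1%:R <= (x : V) ord0 i < k.+1%:R.
Proof.
split => h i; have := h i; rewrite !mxE in_itv/=.
  by have -> : - k.+1%:R + 2 * k.+1%:R = k.+1%:R :> R by ring.
by have -> : - k.+1%:R + 2 * k.+1%:R = k.+1%:R :> R by ring.
Qed.

Lemma centered_cube_homo k m : (k <= m)%N -> centered_cube k `<=` centered_cube m.
Proof.
move=> km x /centered_cubeP h; apply/centered_cubeP => i.
have /andP[h1 h2] := h i; have : k.+1%:R <= m.+1%:R :> R by rewrite ler_nat.
by move=> hkm; apply/andP; split; lra.
Qed.

Lemma centered_cube_cover (x : T) : exists k, centered_cube k x.
Proof.
exists (\max_i Num.truncn `|(x : V) ord0 i|)%N; apply/centered_cubeP => i.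
have : `|(x : V) ord0 i| < (\max_i Num.truncn `|(x : V) ord0 i|).+1%:R.
  apply: (lt_le_trans (truncnS_gt _)); rewrite ler_nat ltnS.
  exact: (leq_bigmax i).
by rewrite ltr_norml => /andP[/ltW -> ->].
Qed.

(* The properties of a ball quasi-Banach function space that survive in its
   powers, where neither the quasi-triangle inequality nor completeness is
   available a priori. *)
Record function_lattice Z : Prop := {
  fl_measurable : forall f, Z f -> measurable_fun setT f;
  fl_scale : forall c f, Z f -> Z (fun x => c * f x);
  fl_ge0 : forall f, Z f -> 0 <= fnorm Z f;
  fl_eq0 : forall f, Z f -> fnorm Z f = 0 -> {ae mu, forall x, f x = 0};
  fl_normZ : forall c f, Z f -> fnorm Z (fun x => c * f x) = `|c| * fnorm Z f;
  fl_ideal : forall f g : T -> R, Z f -> measurable_fun setT g ->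
    {ae mu, forall x, `|g x| <= `|f x|} -> Z g /\ fnorm Z g <= fnorm Z f;
  fl_fatou : forall (F : nat -> T -> R) (f : T -> R) S, (forall k, Z (F k)) ->
    measurable_fun setT f ->
    {ae mu, forall x, [/\ forall k, 0 <= F k x,
                          forall k, F k x <= F k.+1 x
                        & F k x @[k --> \oo] --> f x]} ->
    (forall k, fnorm Z (F k) <= S) -> Z f /\ fnorm Z f <= S;
  fl_cube : forall k, Z (\1_(centered_cube k) : T -> R) }.

Lemma ball_quasi_banach_lattice Y : ball_quasi_banach Y -> function_lattice Y.
Proof.
move=> hY; split.
- exact: bqb_measurable.
- exact: bqb_scale.
- exact: bqb_norm_ge0.
- exact: bqb_norm_eq0.
- exact: bqb_normZ.
- exact: bqb_ideal.
- move=> F f S YF mf hF FS; have [|Yf ->] := bqb_fatou hY YF mf hF; first by exists S.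
  split => //; apply: ge_sup; first by exists (fnorm Y (F 0%N)); exists 0%N.
  by move=> _ [k _ <-]; exact: FS.
(* Points of the cube have norm at most (k+1) sqrt(n+1), so a ball of radius (k+1)(n+2) contains
   it. *)
- move=> k; pose K : R := k.+1%:R * n.+2%:R.
  have K0 : 0 < K by rewrite mulr_gt0.
  have YB := bqb_ball hY (0 : V) K0.
  have [] // := bqb_ideal hY YB (g := \1_(centered_cube k)).
    exact/measurable_indic/measurable_centered_cube.
  apply: aeW => x; rewrite !indicE.
  case: (boolP (x \in centered_cube k)) => [|_]; last by rewrite normr0.
  rewrite inE => /centered_cubeP h; rewrite mem_set// /euclidean_ball/=.
  apply: (@le_lt_trans _ _ (\sum_(i < n.+1) k.+1%:R ^+ 2)).
    apply: ler_sum => i _; rewrite mxE subr0 -real_normK ?num_real// lerXn2r ?nnegrE//.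
    by have /andP[h1 h2] := h i; rewrite ler_norml h1 ltW.
  rewrite sumr_const card_ord -[ltLHS]mulr_natr /K exprMn ltr_pM2l ?exprn_gt0//.
  by rewrite -natrX ltr_nat; nia.
Qed.

Lemma power_space_lattice r Y : 0 < r -> function_lattice Y ->
  function_lattice (power_space Y r).
Proof.
move=> r0 fY; have ri0 : 0 < r^-1 by rewrite invr_gt0.
have normE (c : R) (f : T -> R) : (fun x => `|c * f x| `^ r^-1) =
    fun x => `|c| `^ r^-1 * `|f x| `^ r^-1.
  by apply/funext => x; rewrite normrM powRM.
have mpow (f : T -> R) : measurable_fun setT f ->
    measurable_fun setT (fun x => `|f x| `^ r^-1).
  move=> mf; apply: (measurableT_comp (measurable_powR r^-1)).
  exact: (measurableT_comp (@normr_measurable R setT)).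
split.
- by move=> f [].
- move=> c f [mf Yf]; split; first exact: measurable_funM.
  by rewrite normE; exact: fl_scale.
- by move=> f _; exact: powR_ge0.
- move=> f [mf Yf] /powR_eq0_eq0 /(fl_eq0 fY Yf); apply: filterS => x.
  by move=> /powR_eq0_eq0/eqP; rewrite normr_eq0 => /eqP.
- move=> c f [mf Yf]; rewrite /fnorm/= normE fl_normZ// powRM ?fl_ge0//.
  by rewrite ger0_norm ?powR_ge0// (powRVK r0).
- move=> f g [mf Yf] mg gf.
  have [] := fl_ideal fY Yf (g := fun x => `|g x| `^ r^-1).
    exact: mpow.
  - apply: filterS gf => x gf; rewrite !(ger0_norm (powR_ge0 _ _)); exact: le_powR.
  move=> Yg le; split; first by split.
  by apply: (le_powR r0 _ le); exact: (fl_ge0 fY).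
- move=> F f S XF mf hF FS.
  have S0 : 0 <= S by apply: le_trans (FS 0%N); exact: powR_ge0.
  have [] := fl_fatou fY (F := fun k x => `|F k x| `^ r^-1)
      (f := fun x => `|f x| `^ r^-1) (S := S `^ r^-1).
  + by move=> k; have [] := XF k.
  + exact: mpow.
  + apply: filterS hF => x [F0 FSx Fc].
    have f0 : 0 <= f x.
      rewrite -(cvg_lim (@Rhausdorff R) Fc); apply: limr_ge; last exact: nearW.
      by apply/cvg_ex; exists (f x).
    split; first by move=> k; exact: powR_ge0.
      by move=> k; apply: le_powR => //; rewrite !ger0_norm.
    rewrite ger0_norm//; under eq_fun do rewrite ger0_norm//.
    exact: cvg_powR_nondecreasing.
  + move=> k; have := FS k; rewrite /fnorm/= => /(@le_powR _ _ _ _ ri0).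
    by rewrite powR_ge0 => /(_ isT); rewrite (powRK r0)// fl_ge0//; have [] := XF k.
  move=> Yf le; split => //=; rewrite -[leRHS](powRVK r0 S0); apply: le_powR => //.
  exact: fl_ge0.
- move=> k; split; first exact/measurable_indic/measurable_centered_cube.
  rewrite (_ : (fun x => _) = \1_(centered_cube k)); first exact: fl_cube.
  apply/funext => x; rewrite indicE; case: (x \in _); rewrite ?normr1 ?powR1//.
  by rewrite normr0 powR0// gt_eqF.
Qed.

Section xnorm_theory.
Variable Z : fspace R n.
Hypothesis fZ : function_lattice Z.
Implicit Types f g : T -> \bar R.

Lemma xnorm_ge0 f : (0 <= xnorm Z f)%E.
Proof. by rewrite /xnorm; case: ifPn => // /asboolP [_ /(fl_ge0 fZ)]; rewrite lee_fin. Qed.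

Lemma xnorm_ltyP f : (xnorm Z f < +oo)%E <-> xmem Z f.
Proof.
rewrite /xnorm; case: ifPn => [/asboolP|/asboolPn] h; split => //.
by move=> _; exact: ltry.
Qed.

Lemma xnorm_mem f : xmem Z f -> xnorm Z f = (fnorm Z (fine \o f))%:E.
Proof. by move=> h; rewrite /xnorm asboolT. Qed.

Lemma xmem_EFin (f : T -> R) : Z f -> xmem Z (EFin \o f).
Proof. by move=> Zf; split; [exact: aeW|]. Qed.

Lemma xnorm_EFin (f : T -> R) : Z f -> xnorm Z (fun x => (f x)%:E) = (fnorm Z f)%:E.
Proof. by move=> Zf; rewrite xnorm_mem//; exact: xmem_EFin. Qed.

Lemma xnorm_EFin_lty (f : T -> R) : (xnorm Z (fun x => (f x)%:E) < +oo)%E <-> Z f.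
Proof. by rewrite xnorm_ltyP; split => [[]//|/xmem_EFin]. Qed.

Lemma xnorm_fin_ae f : (xnorm Z f < +oo)%E -> {ae mu, forall x, f x \is a fin_num}.
Proof. by move=> /xnorm_ltyP[]. Qed.

Let mfine f : measurable_fun setT f -> measurable_fun setT (fine \o f).
Proof. by move=> mf; apply: measurableT_comp => //; exact: fine_measurable. Qed.

Lemma ae_le_xnorm f g : measurable_fun setT f ->
  {ae mu, forall x, (0 <= f x <= g x)%E} -> (xnorm Z f <= xnorm Z g)%E.
Proof.
move=> mf fg; have [/xnorm_ltyP[gfin Zg]|] := boolP (xnorm Z g < +oo)%E; last first.
  by rewrite ltey negbK => /eqP ->; rewrite leey.
have ffin : {ae mu, forall x, f x \is a fin_num}.
  apply: filterS2 fg gfin => x /andP[f0 fg] gf; rewrite ge0_fin_numE//.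
  by rewrite (le_lt_trans fg)// ltey_eq gf.
have [|Zf le] := fl_ideal fZ Zg (mfine mf).
  apply: filterS2 fg gfin => x /andP[f0 fg] gf /=.
  rewrite !ger0_norm ?fine_ge0// ?(le_trans f0)// fine_le// ge0_fin_numE//.
  by rewrite (le_lt_trans fg)// ltey_eq gf.
by rewrite !xnorm_mem// lee_fin.
Qed.

Lemma le_xnorm f g : measurable_fun setT f -> (forall x, (0 <= f x)%E) ->
  (forall x, (f x <= g x)%E) -> (xnorm Z f <= xnorm Z g)%E.
Proof. by move=> mf f0 fg; apply: ae_le_xnorm => //; apply: aeW => x; rewrite f0 fg. Qed.

Lemma xnormZ_le (c : R) f : 0 < c -> measurable_fun setT f ->
  (xnorm Z (fun x => c%:E * f x) <= c%:E * xnorm Z f)%E.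
Proof.
move=> c0 mf; have [/xnorm_ltyP[ffin Zf]|] := boolP (xnorm Z f < +oo)%E; last first.
  by rewrite ltey negbK => /eqP ->; rewrite gt0_muley ?leey// lte_fin.
have E : {ae mu, forall x, (c%:E * f x \is a fin_num)%E}.
  by apply: filterS ffin => x fx; rewrite fin_numM.
have F : fine \o (fun x => c%:E * f x)%E = (fun x => c * fine (f x)).
  apply/funext => x /=; case: (f x) => [a //||].
    by rewrite gt0_muley ?lte_fin//= mulr0.
  by rewrite gt0_muleNy ?lte_fin//= mulr0.
have Zc := fl_scale fZ c Zf.
rewrite !xnorm_mem//; last by split => //; rewrite F.
by rewrite F fl_normZ// gtr0_norm// EFinM.
Qed.

Lemma fnorm_indic_eq0 (E : set T) : measurable E ->
  Z (\1_E : T -> R) -> fnorm Z (\1_E : T -> R) = 0 -> mu E = 0%E.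
Proof.
move=> mE ZE /(fl_eq0 fZ ZE) [N [mN N0 EN]].
apply/eqP; rewrite eq_le measure_ge0 andbT -N0.
apply: (@le_measure _ _ _ mu); rewrite ?inE// => x Ex; apply: EN => /=.
by rewrite indicE mem_set// => /eqP; rewrite oner_eq0.
Qed.

Lemma fl_indic_sub (E : set T) k : measurable E -> E `<=` centered_cube k ->
  Z (\1_E : T -> R).
Proof.
move=> mE Ek; have [] // := fl_ideal fZ (fl_cube fZ k) (g := \1_E).
apply: aeW => x; rewrite !indicE; case: (boolP (x \in E)) => [|_]; last by rewrite normr0.
by rewrite !inE => /Ek /mem_set ->.
Qed.

Lemma fnorm_abs (f : T -> R) : Z f ->
  fnorm Z (fun x => `|f x|) = fnorm Z f /\ Z (fun x => `|f x|).
Proof.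
move=> Zf; have mf := fl_measurable fZ Zf.
have ma : measurable_fun setT (fun x => `|f x|).
  exact: (measurableT_comp (@normr_measurable R setT)).
have [|Z1 h1] := fl_ideal fZ Zf ma; first by apply: aeW => x; rewrite normr_id.
have [|_ h2] := fl_ideal fZ Z1 mf; first by apply: aeW => x; rewrite normr_id.
by split; [apply/eqP; rewrite eq_le h1 h2|exact: Z1].
Qed.

(** [fl_fatou] asks for a real-valued limit, whereas this supremum may be infinite. The work is to
    show that bounded norms make it finite almost everywhere. *)
Lemma xnorm_fatou (F : nat -> T -> \bar R) (c : \bar R) :
  (forall k, measurable_fun setT (F k)) -> (forall k x, (0 <= F k x)%E) ->
  (forall k x, (F k x <= F k.+1 x)%E) -> (forall k, (xnorm Z (F k) <= c)%E) ->
  (xnorm Z (fun x => ereal_sup (range (F ^~ x))) <= c)%E.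
Proof.
move=> mF F0 FS Fc.
have [->|cy] := eqVneq c +oo%E; first exact: leey.
have c0 : (0 <= c)%E := le_trans (xnorm_ge0 _) (Fc 0%N).
have cfin : c \is a fin_num by rewrite ge0_fin_numE// ltey.
have FZ k : xmem Z (F k) by apply/xnorm_ltyP; rewrite (le_lt_trans (Fc k))// ltey.
have FcR k : fnorm Z (fine \o F k) <= fine c.
  by rewrite -lee_fin fineK// -xnorm_mem.
set G := fun x => ereal_sup _.
have nd x : nondecreasing_seq (F ^~ x) by apply/nondecreasing_seqP => k; exact: FS.
have mG : measurable_fun setT G by exact: measurable_ereal_sup.
have G0 x : (0 <= G x)%E by apply: le_trans (F0 0%N x) _; apply: ereal_sup_ubound; exists 0%N.
have cvgG x : F ^~ x @ \oo --> G x by exact: ereal_nondecreasing_cvgn.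
have Ffin : {ae mu, forall x, forall k, F k x \is a fin_num}.
  by apply/ae_foralln => k; have [] := FZ k.
(* The exceptional set E carries the functions M 1_E, of norm at most c, for all M. *)
pose E := G @^-1` [set +oo%E].
have mE : measurable E by rewrite -[E]setTI; apply: mG => //; exact: emeasurable_set1.
have Enull : mu E = 0%E.
  have Ek k : mu (E `&` centered_cube k) = 0%E.
    set E' := E `&` _; have mE' : measurable E' by apply: measurableI => //; exact: measurable_centered_cube.
    have ZE : Z (\1_E' : T -> R) by apply: (@fl_indic_sub _ k) => // x [].
    apply: fnorm_indic_eq0 => //; apply/eqP; rewrite eq_le fl_ge0// andbT.
    have HM (M : R) : 0 < M -> M * fnorm Z (\1_E' : T -> R) <= fine c.
      move=> M0; rewrite -[X in X * _]gtr0_norm// -fl_normZ//.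
      pose H j x := fine (mine (F j x) M%:E) * \1_E' x.
      have Hfin j x : mine (F j x) M%:E \is a fin_num.
        by rewrite ge0_fin_numE ?le_min ?F0 ?lee_fin ?(ltW M0)// gt_min ltry orbT.
      have mH j : measurable_fun setT (H j).
        apply: measurable_funM; last exact: measurable_indic.
        by apply: mfine; apply: measurable_mine.
      have ZH j : Z (H j) /\ fnorm Z (H j) <= fnorm Z (fine \o F j).
        apply: (fl_ideal fZ) => //; first by have [] := FZ j.
        apply: filterS Ffin => x Fx; rewrite /H normrM indicE.
        have le1 : `|(x \in E')%:R : R| <= 1 by case: (x \in E'); rewrite ?normr1 ?normr0.
        apply: (@le_trans _ _ `|fine (mine (F j x) M%:E)|); first by rewrite ler_piMr.
        rewrite /= !ger0_norm ?fine_ge0//; last by rewrite le_min F0 lee_fin ltW.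
        by rewrite fine_le// ge_min lexx.
      have [||||_ //] := fl_fatou fZ (F := H) (f := fun x => M * \1_E' x) (S := fine c).
      - by move=> j; have [] := ZH j.
      - by apply: measurable_funM => //; exact: measurable_indic.
      - apply: aeW => x; split => [j|j|].
        + by rewrite /H mulr_ge0 ?indicE// fine_ge0// le_min F0 lee_fin ltW.
        + rewrite /H ler_wpM2r ?indicE// fine_le// le_min ge_min FS/= ge_min lexx orbT//.
        + rewrite /H indicE; case: (boolP (x \in E')) => [|_]; last first.
            by rewrite !mulr0; under eq_fun do rewrite mulr0; exact: cvg_cst.
          rewrite inE => -[Ex _]; rewrite !mulr1; under eq_fun do rewrite mulr1.
          apply: cvg_near_cst.
          have : \forall j \near \oo, (M%:E <= F j x)%E.
            have := cvgG x; rewrite (Ex : G x = +oo%E) => /cvgeyPge; exact.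
          by apply: filterS => j h; rewrite min_r.
      - by move=> j; have [_ /le_trans] := ZH j; apply.
    rewrite leNgt; apply/negP => pos.
    have := HM ((fine c + 1) / fnorm Z (\1_E' : T -> R)).
    rewrite divfK ?gt_eqF// divr_gt0// ?ltr_wpDl ?fine_ge0//.
    by move=> /(_ isT); rewrite gerDl ler10.
  apply/eqP; rewrite eq_le measure_ge0 andbT.
  have -> : E = \bigcup_k (E `&` centered_cube k).
    rewrite -setI_bigcupr; apply/seteqP; split => [x Ex|x []//].
    by split => //; have [k xk] := centered_cube_cover x; exists k.
  apply: le_trans (outer_measure_sigma_subadditive (@lebesgue_outer R n) _) _.
  by rewrite eseries0// => k _ _; exact: Ek.
have Gfin : {ae mu, forall x, G x \is a fin_num}.
  exists E; split => // x /=; rewrite ge0_fin_numE// ltey => /negP; rewrite negbK.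
  by move=> /eqP.
have [||||ZG le] := fl_fatou fZ (F := fun k => fine \o F k) (f := fine \o G) (S := fine c).
- by move=> k; have [] := FZ k.
- exact: mfine.
- apply: filterS2 Ffin Gfin => x Fx Gx; split => [k|k|].
  + exact: fine_ge0.
  + by rewrite /= fine_le.
  + by apply: fine_cvg; rewrite fineK.
- exact: FcR.
by rewrite xnorm_mem// -(fineK cfin) lee_fin.
Qed.

End xnorm_theory.

End lattices.

(** * The power space as a normed lattice *)

Section normed_lattices.
Variables (R : realType) (n : nat).
Local Notation V := 'rV[R]_n.+1.
Local Notation T := (Rn R n).
Local Notation mu := (@lebesgue_Rn R n).

Record normed_lattice (X : fspace R n) : Prop := {
  nl_lattice :> function_lattice X;
  nl_add : forall f g : T -> R, X f -> X g ->
    X (fun x => f x + g x) /\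
    fnorm X (fun x => f x + g x) <= fnorm X f + fnorm X g }.

(** The convexity hypothesis for the (1/r)-th powers of |f| and |g| is the triangle inequality of
    the power space. *)
Lemma power_space_normed r (Y : fspace R n) : 0 < r -> function_lattice Y ->
  convex_const_one r Y -> normed_lattice (power_space Y r).
Proof.
move=> r0 fY cY; have fX := power_space_lattice r0 fY.
split; [exact: fX|move=> f g [mf Yf] [mg Yg]].
have ri0 : 0 < r^-1 by rewrite invr_gt0.
set S := fnorm _ (fun x => `|f x| `^ r^-1) `^ r +
         fnorm _ (fun x => `|g x| `^ r^-1) `^ r.
have S0 : 0 <= S by rewrite addr_ge0 ?powR_ge0.
have := cY _ _ Yf Yg; rewrite (_ : (fun x => _) = (fun x => ((`|f x| + `|g x|) `^ r^-1)%:E)); last first.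
  by apply/funext => x; rewrite !(ger0_norm (powR_ge0 _ _)) !(powRVK r0).
rewrite -/S => le.
have Yfg : Y (fun x => (`|f x| + `|g x|) `^ r^-1).
  by apply/(@xnorm_EFin_lty R n Y); exact: le_lt_trans le (ltry _).
move: le; rewrite (xnorm_EFin Yfg) lee_fin => le.
have [] := fl_ideal fY Yfg (g := fun x => `|f x + g x| `^ r^-1).
  apply: (measurableT_comp (measurable_powR r^-1)).
  by apply: (measurableT_comp (@normr_measurable R setT)); exact: measurable_funD.
- apply: aeW => x; rewrite !(ger0_norm (powR_ge0 _ _)); apply: le_powR => //.
  exact: ler_normD.
move=> Yfg' le'; split; first by split; [exact: measurable_funD|exact: Yfg'].
rewrite -[leRHS](powRVK r0 S0); apply: (le_powR r0 _ (le_trans le' le)).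
exact: (fl_ge0 fY).
Qed.

Lemma xnorm_power r (Y : fspace R n) (f : T -> \bar R) : 0 < r ->
  measurable_fun setT f -> (forall x, (0 <= f x)%E) ->
  (xnorm (power_space Y r) f = xnorm Y (fun x => f x `^ r^-1) `^ r)%E.
Proof.
move=> r0 mf f0; have rn0 : r != 0 by rewrite gt_eqF.
have E : fine \o (fun x => f x `^ r^-1)%E = (fun x => `|(fine \o f) x| `^ r^-1).
  by apply/funext => x /=; rewrite fine_poweR ger0_norm// fine_ge0.
have H : xmem (power_space Y r) f <-> xmem Y (fun x => f x `^ r^-1)%E.
  split=> -[ff Zf]; split.
  - apply: filterS ff => x; exact: fin_num_poweR.
  - by rewrite E; case: Zf.
  - apply: filterS ff => x; rewrite ge0_fin_numE ?poweR_ge0// => h.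
    by rewrite ge0_fin_numE//; apply: (lty_poweRy _ h); rewrite invr_neq0.
  - split; last by rewrite -E.
    by apply: measurableT_comp => //; exact: fine_measurable.
rewrite /xnorm; case: ifPn => [/asboolP h|/asboolPn h].
  by rewrite asboolT; [rewrite poweR_EFin E|exact: H.1].
by rewrite asboolF ?poweRyr// => h'; apply: h; exact: H.2.
Qed.

Section normed.
Variable X : fspace R n.
Hypothesis nX : normed_lattice X.
Implicit Types f g : T -> \bar R.
Let fX : function_lattice X := nX.

Lemma xnorm0 : xnorm X (fun=> 0%E) = 0%E.
Proof.
have := fl_scale fX 0 (fl_cube fX 0); have := fl_normZ fX 0 (fl_cube fX 0).
rewrite normr0 mul0r (_ : (fun x => _) = fun=> 0); last first.
  by apply/funext => x; rewrite mul0r.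
by move=> n0 X0; rewrite xnorm_EFin// n0.
Qed.

Lemma xnormD f g : measurable_fun setT f -> measurable_fun setT g ->
  (forall x, (0 <= f x)%E) -> (forall x, (0 <= g x)%E) ->
  (xnorm X (fun x => f x + g x) <= xnorm X f + xnorm X g)%E.
Proof.
move=> mf mg f0 g0.
have [/xnorm_ltyP[ff Xf]|] := boolP (xnorm X f < +oo)%E; last first.
  rewrite ltey negbK => /eqP ->; rewrite addye ?leey//.
  by rewrite gt_eqF// (lt_le_trans _ (xnorm_ge0 fX _))// ltNyr.
have [/xnorm_ltyP[gf Xg]|] := boolP (xnorm X g < +oo)%E; last first.
  rewrite ltey negbK => /eqP ->; rewrite addey ?leey//.
  by rewrite gt_eqF// (lt_le_trans _ (xnorm_ge0 fX _))// ltNyr.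
have [Xfg le] := nl_add nX Xf Xg.
rewrite [in leRHS]xnorm_mem; last by split.
rewrite [in leRHS]xnorm_mem; last by split.
rewrite -EFinD; apply: (@le_trans _ _ (xnorm X (fun x => ((fine \o f) x + (fine \o g) x)%:E))).
  apply: (ae_le_xnorm fX); first exact: emeasurable_funD.
  by apply: filterS2 ff gf => x ff gf; rewrite adde_ge0//= EFinD !fineK.
by rewrite xnorm_EFin// lee_fin.
Qed.

Lemma xnorm_sum (I : Type) (s : seq I) (F : I -> T -> \bar R) :
  (forall i, measurable_fun setT (F i)) -> (forall i x, (0 <= F i x)%E) ->
  (xnorm X (fun x => \sum_(i <- s) F i x) <= \sum_(i <- s) xnorm X (F i))%E.
Proof.
move=> mF F0; elim: s => [|i s IH].
  by rewrite big_nil; under eq_fun do rewrite big_nil; rewrite xnorm0.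
rewrite big_cons; under eq_fun do rewrite big_cons.
have mS : measurable_fun setT (fun x => \sum_(j <- s) F j x)%E.
  by apply: emeasurable_sum => j; exact: mF.
have S0 x : (0 <= \sum_(j <- s) F j x)%E by apply: sume_ge0 => j _.
apply: (le_trans (xnormD (mF i) mS (F0 i) S0)).
by rewrite leeD2l.
Qed.

Lemma kothe_norm_ge0 (g : T -> R) : (0 <= kothe_norm X g)%E.
Proof.
have X0 : X (fun x => 0 * \1_(centered_cube 0) x) by apply/(fl_scale fX)/fl_cube.
have n0 := fl_normZ fX 0 (fl_cube fX 0); rewrite normr0 mul0r in n0.
apply: le_trans (ereal_sup_ubound _); last first.
  by exists (fun x => 0 * \1_(centered_cube 0) x) => //=; rewrite n0.
by apply: integral_ge0.
Qed.

End normed.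

End normed_lattices.

(** * Duality and the maximal function *)

Section integrals.
Context d (T : measurableType d) (R : realType) (mu : {measure set T -> \bar R}).
Implicit Types (D : set T).

Lemma le_integral_sup D (F : nat -> T -> \bar R) (c : \bar R) : measurable D ->
  (forall k, measurable_fun D (F k)) -> (forall k x, (0 <= F k x)%E) ->
  (forall k x, (F k x <= F k.+1 x)%E) ->
  (forall k, (\int[mu]_(x in D) F k x <= c)%E) ->
  (\int[mu]_(x in D) ereal_sup (range (F ^~ x)) <= c)%E.
Proof.
move=> mD mF F0 FS Fc.
have nd x : nondecreasing_seq (F ^~ x) by apply/nondecreasing_seqP => k; exact: FS.
under eq_integral => x _ do
  rewrite -(cvg_lim (@ereal_hausdorff R) (ereal_nondecreasing_cvgn (nd x))).
rewrite (monotone_convergence mu mD mF) => [|k x _|x _]; [|exact: F0|exact: nd].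
apply: lime_le; last exact: nearW.
apply: ereal_nondecreasing_is_cvgn => i j ij.
by apply: ge0_le_integral => // x _; exact: nd.
Qed.

(* No measurability is required: the integral of a nonnegative function is a
   supremum over the simple functions below it. *)
Lemma ge0_subset_integral_nomeas (A B : set T) (f : T -> \bar R) :
  (forall x, (0 <= f x)%E) -> A `<=` B ->
  (\int[mu]_(x in A) f x <= \int[mu]_(x in B) f x)%E.
Proof.
move=> f0 AB; rewrite !ge0_integralE//; apply: ge_ereal_sup => _ [h hf <-].
apply: ereal_sup_ubound; exists h => // x; apply: le_trans (hf x) _.
rewrite /patch; case: ifPn => [|_]; first by rewrite inE => /AB /mem_set ->.
by case: ifP.
Qed.

End integrals.

Section kothe.
Variables (R : realType) (n : nat).
Local Notation T := (Rn R n).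
Local Notation mu := (@lebesgue_Rn R n).
Variable X : fspace R n.
Hypothesis fX : function_lattice X.

(** Scaling [u] to norm one reduces to the definition of [kothe_norm]. If the norm of [u] is zero,
    [u] vanishes almost everywhere and both sides are zero, even when [g] has infinite norm. *)
Lemma kothe_hoelder (u : T -> \bar R) (g : T -> R) :
  measurable_fun setT u -> (forall x, (0 <= u x)%E) -> (xnorm X u < +oo)%E ->
  measurable_fun setT g ->
  (\int[mu]_x (u x * `|g x|%:E) <= kothe_norm X g * xnorm X u)%E.
Proof.
move=> mu_ u0 ufin mg; have /xnorm_ltyP[uae Xu] := ufin.
set v := fine \o u in Xu; have v0 x : 0 <= v x by rewrite fine_ge0.
have mv : measurable_fun setT v := fl_measurable fX Xu.
have mag : measurable_fun setT (fun x => `|g x|) by exact: (measurableT_comp (@normr_measurable R setT)).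
have -> : (\int[mu]_x (u x * `|g x|%:E) = \int[mu]_x (v x * `|g x|)%:E)%E.
  apply: ge0_ae_eq_integral; first exact: measurableT.
  - by apply: emeasurable_funM; [exact: mu_|exact/measurable_EFinP].
  - by apply/measurable_EFinP; exact: measurable_funM.
  - by move=> x _; rewrite mule_ge0// lee_fin.
  - by move=> x _; rewrite lee_fin mulr_ge0.
  - by apply: filterS uae => x ux _; rewrite EFinM fineK.
have a0 := fl_ge0 fX Xu; rewrite xnorm_mem; last by split.
rewrite -/v; set a := fnorm X v in a0 *.
have := a0; rewrite le_eqVlt => /orP[/eqP ae|ap].
  have v_ae := fl_eq0 fX Xu (esym ae).
  rewrite (@ge0_ae_eq_integral _ _ _ _ _ _ (cst 0%E)); last 6 first.
  - exact: measurableT.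
  - by apply/measurable_EFinP; exact: measurable_funM.
  - exact: measurable_cst.
  - by move=> x _; rewrite lee_fin mulr_ge0.
  - by [].
  - by apply: filterS v_ae => x vx _; rewrite vx mul0r.
  by rewrite integral0 -ae mule0.
have Xw := fl_scale fX a^-1 Xu.
have : (\int[mu]_x (`|a^-1 * v x * g x|)%:E <= kothe_norm X g)%E.
  apply: ereal_sup_ubound; exists (fun x => a^-1 * v x) => //; split => //.
  by rewrite fl_normZ// gtr0_norm ?invr_gt0// mulVf ?gt_eqF.
under eq_integral => x _ do
  rewrite -mulrA normrM normrM (ger0_norm (v0 x)) gtr0_norm ?invr_gt0// EFinM.
rewrite ge0_integralZl_EFin; last 4 first.
- exact: measurableT.
- by move=> x _; rewrite lee_fin mulr_ge0.
- by apply/measurable_EFinP; exact: measurable_funM.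
- by rewrite invr_ge0.
by rewrite lee_pdivrMl// muleC.
Qed.

End kothe.

(** * The maximal function: measurability and local integrability *)

Section maximal_function.
Variables (R : realType) (n : nat).
Local Notation V := 'rV[R]_n.+1.
Local Notation T := (Rn R n).
Local Notation mu := (@lebesgue_Rn R n).
Implicit Types (f g h : T -> R) (Q : set T).

Lemma cube_measurable Q : cube Q -> measurable Q.
Proof. by move=> [s [t [a [l [l0 ->]]]]]; exact: measurable_box. Qed.

Lemma cube_mu Q : cube Q -> exists2 v : R, 0 < v & mu Q = v%:E.
Proof.
move=> [s [t [a [l [l0 ->]]]]]; exists (l ^+ n.+1); first exact: exprn_gt0.
exact: lebesgue_Rn_cube.
Qed.

Lemma average_ge0 Q f : cube Q -> (0 <= average Q (fun y => `|f y|%R))%E.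
Proof.
move=> /cube_mu[v v0 E]; rewrite /average E; apply: mule_ge0.
  by rewrite lee_fin invr_ge0 ltW.
by apply: integral_ge0 => y _; rewrite lee_fin.
Qed.

Lemma maximal_term_ge0 Q f x : cube Q ->
  (0 <= (\1_Q x)%:E * average Q (fun y => `|f y|%R))%E.
Proof. by move=> cQ; rewrite mule_ge0 ?average_ge0// lee_fin indicE. Qed.

Lemma average_le_maximal Q f x : cube Q -> Q x ->
  (average Q (fun y => `|f y|%R) <= maximal f x)%E.
Proof.
move=> cQ Qx; apply: ereal_sup_ubound; exists Q => //.
by rewrite indicE mem_set// mul1e.
Qed.

Lemma half_cube (a : V) l : 0 < l -> cube (box true true a (a + const_mx l) : set T).
Proof. by move=> l0; exists true, true, a, l. Qed.

Lemma centered_cube_cube k : cube (centered_cube k : set T).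
Proof. by apply: half_cube; rewrite mulr_gt0. Qed.

Lemma maximal_ge0 f x : (0 <= maximal f x)%E.
Proof.
have cQ := centered_cube_cube 0.
apply: le_trans (maximal_term_ge0 f x cQ) _.
by apply: ereal_sup_ubound; exists (centered_cube 0).
Qed.

Lemma maximal_leP f x c : (0 <= c)%E ->
  (forall Q, cube Q -> Q x -> (average Q (fun y => `|f y|%R) <= c)%E) ->
  (maximal f x <= c)%E.
Proof.
move=> c0 H; apply: ge_ereal_sup => _ [Q cQ <-]; rewrite indicE.
case: (boolP (x \in Q)) => [|_]; last by rewrite mul0e.
by rewrite inE mul1e => Qx; exact: H.
Qed.

Lemma measurable_absE f : measurable_fun setT f ->
  measurable_fun setT (fun x => `|f x|%:E).
Proof.
move=> mf; apply/measurable_EFinP.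
exact: (measurableT_comp (@normr_measurable R setT)).
Qed.

Lemma average_mono Q f g : cube Q -> measurable_fun setT f -> measurable_fun setT g ->
  (forall x, `|f x| <= `|g x|) ->
  (average Q (fun y => `|f y|%R) <= average Q (fun y => `|g y|%R))%E.
Proof.
move=> cQ mf mg fg; have [v v0 E] := cube_mu cQ.
rewrite /average E /= lee_pmul2l ?lte_fin ?invr_gt0//.
apply: ge0_le_integral => [|x _|||x _]; first exact: cube_measurable.
- by rewrite lee_fin.
- exact/measurable_funTS/measurable_absE.
- exact/measurable_funTS/measurable_absE.
- by rewrite lee_fin.
Qed.

Lemma maximal_mono f g x : measurable_fun setT f -> measurable_fun setT g ->
  (forall x, `|f x| <= `|g x|) -> (maximal f x <= maximal g x)%E.
Proof.
move=> mf mg fg; apply: maximal_leP => [|Q cQ Qx]; first exact: maximal_ge0.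
exact: le_trans (average_mono cQ mf mg fg) (average_le_maximal g cQ Qx).
Qed.

Lemma average_sup Q (F : nat -> T -> R) f (c : \bar R) : cube Q ->
  (forall k, measurable_fun setT (F k)) -> (forall k x, 0 <= F k x) ->
  (forall k x, F k x <= F k.+1 x) ->
  (forall x, `|f x|%:E = ereal_sup (range (fun k => (F k x)%:E))) ->
  (forall k, average Q (F k) <= c)%E ->
  (average Q (fun y => `|f y|%R) <= c)%E.
Proof.
move=> cQ mF F0 FS fF Fc; have [v v0 E] := cube_mu cQ.
rewrite /average E /= lee_pdivrMl//.
under eq_integral => x _ do rewrite fF.
apply: (@le_integral_sup _ _ _ _ _ (fun k x => (F k x)%:E)).
- exact: cube_measurable.
- by move=> k; apply/measurable_EFinP/measurable_funTS.
- by move=> k x; rewrite lee_fin.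
- by move=> k x; rewrite lee_fin.
- by move=> k; have := Fc k; rewrite /average E /= lee_pdivrMl.
Qed.

Let idx := ({ffun 'I_n.+1 -> rat} * rat)%type.

Definition rat_cube (p : idx) : set T :=
  box true true (\row_i ratr (p.1 i) : V) (\row_i ratr (p.1 i) + const_mx (ratr p.2)).

(** Codes that denote no cube of positive side contribute 0, which is harmless because all averages
    are nonnegative. *)
Definition rat_cube_term (k : nat) f (x : T) : \bar R :=
  if (unpickle k : option idx) is Some p then
    if 0 < p.2 then ((\1_(rat_cube p) x)%:E * average (rat_cube p) (fun y => `|f y|%R))%E
    else 0%E
  else 0%E.

(** This gives measurability, as the supremum becomes countable. A cube of side [l] lies in a
    rational half-open cube of side below [l + e], and the ratio of the two volumes tends to one
    with [e]. *)
Lemma maximal_rat f x : measurable_fun setT f ->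
  maximal f x = ereal_sup (range (fun k => rat_cube_term k f x)).
Proof.
move=> mf; set S := ereal_sup _.
have rc (p : idx) : 0 < p.2 -> cube (rat_cube p).
  by move=> p0; apply: half_cube; rewrite ltr0q.
apply/eqP; rewrite eq_le; apply/andP; split; last first.
  apply: ge_ereal_sup => _ [k _ <-]; rewrite /rat_cube_term.
  case: (unpickle k : option idx) => [p|]; last exact: maximal_ge0.
  case: ifPn => p0; last exact: maximal_ge0.
  by apply: ereal_sup_ubound; exists (rat_cube p) => //; exact: rc.
have Sp (p : idx) : 0 < p.2 -> rat_cube p x ->
    (average (rat_cube p) (fun y => `|f y|%R) <= S)%E.
  move=> p0 px; apply: ereal_sup_ubound; exists (pickle p) => //.
  by rewrite /rat_cube_term pickleK p0 indicE mem_set// mul1e.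
have S0 : (0 <= S)%E.
  have [k xk] := centered_cube_cover x.
  pose p : idx := ([ffun=> - k.+1%:R], 2 * k.+1%:R).
  have p0 : 0 < p.2 by rewrite mulr_gt0.
  apply: le_trans (average_ge0 f (rc p p0)) (Sp _ p0 _) => i.
  have /centered_cubeP/(_ i) := xk.
  rewrite in_itv/= !mxE ffunE /= rmorphM/= rmorphN/= !ratr_nat.
  by have -> : - k.+1%:R + 2 * k.+1%:R = k.+1%:R :> R by ring.
have [->|Sy] := eqVneq S +oo%E; first exact: leey.
have Sfin : S \is a fin_num by rewrite ge0_fin_numE// ltey.
apply: maximal_leP => // Q cQ Qx; have [s [t [a [l [l0 QE]]]]] := cQ.
have key e : 0 < e ->
    (\int[mu]_(x in Q) `|f x|%:E <= S * ((l + e) ^+ n.+1)%:E)%E.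
  move=> e0.
  have [q] := @rat_in_itvoo R l (l + e) ltac:(lra); rewrite in_itv/= => /andP[lq qe].
  have /choice[b hb] : forall i : 'I_n.+1, exists b : rat,
      a ord0 i + l - ratr q < ratr b < a ord0 i.
    move=> i; have [b] := @rat_in_itvoo R (a ord0 i + l - ratr q) (a ord0 i) ltac:(lra).
    by rewrite in_itv/=; exists b.
  pose p : idx := ([ffun i => b i], q).
  have p0 : 0 < p.2 by rewrite -(@ltr0q R) (lt_trans l0).
  have sub : Q `<=` rat_cube p.
    rewrite QE => y yQ i; have := yQ i; have /andP[b1 b2] := hb i.
    by rewrite !mxE ffunE /=; case: (s); case: (t); rewrite /= !in_itv/= => /andP[? ?];
      apply/andP; split; lra.
  have q0 : 0 < ratr q :> R by rewrite ltr0q.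
  have := Sp p p0 (sub _ Qx); rewrite /average lebesgue_Rn_cube// lee_pdivrMl ?exprn_gt0//.
  move=> h; apply: (@le_trans _ _ (\int[mu]_(x in rat_cube p) `|f x|%:E)%E).
    by apply: ge0_subset_integral_nomeas.
  apply: (le_trans h); rewrite muleC; apply: lee_wpmul2l => //=.
  by rewrite lee_fin lerXn2r ?nnegrE//=; lra.
have Ifin : (\int[mu]_(x in Q) `|f x|%:E)%E \is a fin_num.
  rewrite ge0_fin_numE ?integral_ge0//; apply: le_lt_trans (key 1 ltr01) _.
  by rewrite ltey_eq fin_numM.
rewrite /average QE lebesgue_Rn_cube//= -QE lee_pdivrMl ?exprn_gt0//.
rewrite -(fineK Ifin) -(fineK Sfin) -EFinM lee_fin.
have := fine_ge0 S0; rewrite le_eqVlt => /orP[/eqP S00|Sp0].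
  have := key 1 ltr01; rewrite -(fineK Ifin) -(fineK Sfin) -S00 mul0e lee_fin.
  by rewrite mulr0.
rewrite mulrC -ler_pdivrMl// mulrC; apply: ler_exprD_lim => [|e e0]; first exact: ltW.
by rewrite ler_pdivrMr// mulrC -lee_fin EFinM fineK// fineK// key.
Qed.

Lemma measurable_maximal f : measurable_fun setT f -> measurable_fun setT (maximal f).
Proof.
move=> mf; rewrite (_ : maximal f = fun x => ereal_sup (range (fun k => rat_cube_term k f x))); last first.
  by apply/funext => x; exact: maximal_rat.
apply: measurable_ereal_sup => k; rewrite /rat_cube_term.
case: (unpickle k : option idx) => [p|]; last exact: measurable_cst.
case: (0 < p.2); last exact: measurable_cst.
apply: emeasurable_funM; last exact: measurable_cst.
apply/measurable_EFinP; apply: measurable_indic; exact: measurable_box.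
Qed.

Lemma compact_sub_centered_cube (K : set V) : compact K ->
  exists k, forall j, (k <= j)%N -> (K : set T) `<=` centered_cube j.
Proof.
move=> /compact_bounded [M [Mr HM]].
exists (Num.truncn `|M + 1|) => j hj x Kx; apply/centered_cubeP => i.
have : `|(x : V) ord0 i| <= M + 1.
  apply: le_trans (HM (M + 1) _ x Kx); last by rewrite ltrDl.
  have /mapP[i0 Hi0 ->] : `|(x : V) ord0 i| \in [seq `|(x : V) a.1 a.2| | a : 'I_1 * 'I_n.+1].
    by apply/mapP; exists (ord0, i) => //=; rewrite mem_enum.
  by rewrite [leRHS]/Num.norm /= mx_normrE; apply/bigmax_geP; right => /=; exists i0.
move=> xi; have : `|(x : V) ord0 i| < j.+1%:R.
  apply: le_lt_trans xi _; apply: le_lt_trans (ler_norm _) _.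
  by apply: lt_le_trans (truncnS_gt _) _; rewrite ler_nat ltnS.
by rewrite ltr_norml => /andP[/ltW -> ->].
Qed.

Lemma Lr_loc_of_cubes f r : measurable_fun setT f ->
  (forall k, exists2 j, (k <= j)%N &
     (\int[mu]_(x in centered_cube j) (`|f x| `^ r)%:E < +oo)%E) ->
  Lr_loc r f.
Proof.
move=> mf H; split => // K /compact_sub_centered_cube[k Kk].
have [j kj Hj] := H k; apply: le_lt_trans Hj.
apply: ge0_subset_integral_nomeas; last exact: Kk.
by move=> x; rewrite lee_fin powR_ge0.
Qed.

Lemma Lr_loc_bounded f r M : measurable_fun setT f -> 0 < r ->
  (forall x, `|f x| <= M) -> Lr_loc r f.
Proof.
move=> mf r0 fM; apply: Lr_loc_of_cubes => // k; exists k => //.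
have mk := @measurable_centered_cube R n k.
have [v v0 E] := cube_mu (centered_cube_cube k).
apply: (@le_lt_trans _ _ (\int[mu]_(x in centered_cube k) (M `^ r)%:E)%E).
  apply: ge0_le_integral => [//|x _|||x _].
  - by rewrite lee_fin powR_ge0.
  - apply/measurable_EFinP/measurable_funTS; apply: (measurableT_comp (measurable_powR r)).
    exact: (measurableT_comp (@normr_measurable R setT)).
  - exact: measurable_cst.
  - by rewrite lee_fin ge0_ler_powR ?(ltW r0)// nnegrE// (le_trans _ (fM x)).
by rewrite integral_cst//= E -EFinM ltry.
Qed.

(** Every centred cube lies in one that also contains the given point, and the average over that one
    is finite. *)
Lemma Lr_loc_of_maximal f r x : measurable_fun setT f ->
  (maximal (fun y => `|f y| `^ r)%R x < +oo)%E -> Lr_loc r f.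
Proof.
move=> mf Mx; apply: Lr_loc_of_cubes => // k.
have [m xm] := centered_cube_cover x; exists (maxn k m); first exact: leq_maxl.
set Q := centered_cube _; have cQ : cube Q := centered_cube_cube _.
have Qx : Q x by apply: centered_cube_homo xm; exact: leq_maxr.
have := le_lt_trans (average_le_maximal (fun y => `|f y| `^ r) cQ Qx) Mx.
have [v v0 E] := cube_mu cQ; rewrite /average E /=.
under eq_integral => y _ do rewrite ger0_norm ?powR_ge0//.
by rewrite lte_pdivrMl// gt0_muley ?lte_fin.
Qed.

End maximal_function.

(** * Shifted dyadic grids *)

Lemma card_range_ffun (B : finType) (U : Type) (g : B -> U) (N : nat) :
  injective g -> #|B| = N -> (range g #= `I_N)%card.
Proof.
move=> gI <-; have gE : (range g #= [set: B])%card by apply: inj_card_eq => b b' _ _; exact: gI.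
apply: (card_eq_trans gE).
rewrite card_eq_sym; suff <- : (fun b : B => nat_of_ord (enum_rank b)) @` [set: B] = `I_#|B|.
  by apply: inj_card_eq => b b' _ _ /val_inj/enum_rank_inj.
apply/seteqP; split => [_ [b _ <-]|j /= jB]; first exact: ltn_ord.
by exists (enum_val (Ordinal jB)) => //; rewrite enum_valK.
Qed.

Section grids.
Variables (R : realType) (n : nat).
Local Notation V := 'rV[R]_n.+1.
Local Notation T := (Rn R n).
Local Notation mu := (@lebesgue_Rn R n).

Section one_grid.
(* Two shifts by a third of the side length, of opposite signs; both of them
   make the cubes around the origin exhaust the whole space. *)
Variable eps : 'I_n.+1 -> bool.

(** The sign alternates with the level because doubling a shift of 1/3 gives 2/3, that is -1/3
    modulo 1. This makes consecutive levels nested. *)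
Definition shift (k : int) (i : 'I_n.+1) : int :=
  (if eps i then 1 else -1) * (-1) ^ k.

Definition key (k : int) (x : T) (i : 'I_n.+1) : int :=
  Num.floor (2 ^ k * (x : V) ord0 i - (shift k i)%:~R / 3).

(** A cube is represented by any of its points, as a fibre of [key]; nestedness and disjointness
    become statements about equality of keys. *)
Definition gcube (k : int) (x : T) : set T :=
  [set y | forall i, key k y i = key k x i].

Lemma shift1 k i : (shift k i = 1) \/ (shift k i = -1).
Proof.
rewrite /shift; have : ((-1) ^ k = 1 :> int) \/ ((-1) ^ k = -1 :> int).
  case: k => m; rewrite ?NegzE -?exprnN -?exprnP; last first.
    by rewrite -exprVn invrN1 -signr_odd; case: odd; [right|left].
  by rewrite -signr_odd; case: odd; [right|left].
by move=> [] ->; case: (eps i); rewrite ?mul1r ?mulN1r ?opprK; auto.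
Qed.

Lemma shiftS k i : shift (k + 1) i = - shift k i.
Proof. by rewrite /shift exprzDr ?unitrN1// expr1z mulrN1 mulrN. Qed.

Lemma coordS k (t : R) i : 2 ^ (k + 1) * t - (shift (k + 1) i)%:~R / 3 =
  2 * (2 ^ k * t - (shift k i)%:~R / 3) + (shift k i)%:~R.
Proof.
by rewrite shiftS expfzDr// expr1z mulrNz; field.
Qed.

Lemma le_floor_int (a : R) (m : int) : (m <= Num.floor a) = (m%:~R <= a).
Proof. by rewrite !leNgt floor_lt_int. Qed.

Let intr2 : 2%:~R = 2 :> R. Proof. by []. Qed.

Lemma floor_lt_sep (a b : R) : Num.floor a < Num.floor b ->
  a < (Num.floor b)%:~R <= b.
Proof.
by move=> ab; rewrite -le_floor_int lexx andbT -floor_lt_int.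
Qed.

(** If an integer m separates two points at level [k], then 2 m + shift separates them at level
    [k + 1], by [coordS]. *)
Lemma key_parent k x y i : key (k + 1) x i = key (k + 1) y i ->
  key k x i = key k y i.
Proof.
have H u v : key (k + 1) u i = key (k + 1) v i -> ~ (key k u i < key k v i).
  rewrite /key !coordS => E /floor_lt_sep; set m := Num.floor _ => /andP[h1 h2].
  move: E; set a := _ - _ / 3; set b := _ - _ / 3; set e := shift k i => E.
  have : (2 * m + e <= Num.floor (2 * a + e%:~R) :> int)%R.
    rewrite E le_floor_int rmorphD rmorphM /= intr2; rewrite /m in h2 *.
    by move: h2; rewrite -/b -/m; lra.
  by rewrite le_floor_int rmorphD rmorphM /= intr2 leNgt => /negP; apply; move: h1; rewrite -/a; lra.
by move=> E; apply/eqP; rewrite eq_le !leNgt; apply/andP; split; apply/negP; apply: H.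
Qed.

Lemma gcube_refl k x : gcube k x x. Proof. by []. Qed.

Lemma gcube_eq k x y : gcube k x y -> gcube k y = gcube k x.
Proof.
by move=> xy; apply/seteqP; split => z h i; rewrite h xy.
Qed.

Lemma gcube_parent k x : gcube (k + 1) x `<=` gcube k x.
Proof. by move=> y h i; apply: key_parent. Qed.

Lemma gcube_sub (k l : int) x : k <= l -> gcube l x `<=` gcube k x.
Proof.
move=> kl; have -> : l = k + `|l - k|%N%:Z by lia.
elim: (`|l - k|%N) => [|m IH]; first by rewrite addr0.
rewrite -addn1 PoszD addrA; exact: subset_trans (@gcube_parent _ _) IH.
Qed.

Definition corner (k : int) (m : 'I_n.+1 -> int) : V :=
  \row_i (2 ^ (- k) * ((m i)%:~R + (shift k i)%:~R / 3)).

Lemma pow2_gt0 (k : int) : 0 < (2 : R) ^ k. Proof. exact: exprz_gt0. Qed.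

Lemma pow2K (k : int) : (2 : R) ^ k * 2 ^ (- k) = 1.
Proof. by rewrite -expfzDr// subrr expr0z. Qed.

Lemma key_box k m (x : T) :
  (forall i, key k x i = m i) <->
  box true true (corner k m) (corner k m + const_mx (2 ^ (- k))) x.
Proof.
have p := pow2_gt0 k; have q := pow2_gt0 (- k); have pq := pow2K k.
have E i : key k x i = m i <-> (x : V) ord0 i \in
   `[corner k m ord0 i, (corner k m + const_mx (2 ^ (- k))) ord0 i[.
  rewrite !mxE in_itv /= /key; set t := (x : V) ord0 i; set s := _ / 3.
  set u := (m i)%:~R + s.
  have e1 : 2 ^ k * (2 ^ (- k) * u) = u by rewrite mulrA pq mul1r.
  have e2 : 2 ^ k * (2 ^ (- k) * u + 2 ^ (- k)) = u + 1 by rewrite mulrDr e1 pq.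
  rewrite -(ler_pM2l p) -(ltr_pM2l p) e1 e2 /u; split => [/eqP|/andP[h1 h2]].
    by rewrite floor_eq rmorphD/= => /andP[h1 h2]; apply/andP; split; lra.
  by apply/eqP; rewrite floor_eq rmorphD/=; apply/andP; split; lra.
by split => h i; apply/E.
Qed.

Lemma gcube_box k x : gcube k x =
  box true true (corner k (key k x)) (corner k (key k x) + const_mx (2 ^ (- k))).
Proof. by apply/seteqP; split => y /key_box. Qed.

Lemma gcube_half_open k x : half_open_cube ((2 : R) ^ (- k)) (gcube k x).
Proof. by exists (corner k (key k x)); split; [exact: pow2_gt0|exact: gcube_box]. Qed.

Lemma gcube_cube k x : cube (gcube k x).
Proof. by rewrite gcube_box; apply: half_cube; exact: pow2_gt0. Qed.

Lemma gcube_measurable k x : measurable (gcube k x).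
Proof. exact/cube_measurable/gcube_cube. Qed.

Lemma gcube_mu k x : mu (gcube k x) = ((2 ^ (- k)) ^+ n.+1)%:E.
Proof. by rewrite gcube_box lebesgue_Rn_cube// pow2_gt0. Qed.

Lemma key_corner k m i : key k (corner k m : T) i = m i.
Proof.
move: i; apply/key_box => i; have q := pow2_gt0 (- k).
by rewrite !mxE in_itv/= lexx ltrDl.
Qed.

Definition grid_level (k : int) : set (set T) := range (gcube k).
Definition grid : set (set T) := \bigcup_k grid_level k.

Lemma grid_dyadic : dyadic_grid grid.
Proof.
have same k x y z : gcube k x z -> gcube k y z -> gcube k x = gcube k y.
  by move=> /gcube_eq <- /gcube_eq <-.
exists grid_level; split => //.
- by move=> k _ [x _ <-]; exact: gcube_half_open.
- move=> k; split.
  + by apply/seteqP; split => // x _; exists (gcube k x) => //; exists x.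
  + by move=> _ _ [x _ <-] [y _ <-] [z [hx hy]]; exact: same hx hy.
  + by move=> _ [x _ <-]; exists x.
- move=> k _ [x _ <-]; split.
    have sub : gcube k x `<=` gcube (k - 1) x.
      by have := @gcube_parent (k - 1) x; rewrite subrK.
    exists (gcube (k - 1) x); split; first by split => //; exists x.
    move=> _ [[y _ <-] hy]; apply: (@same _ _ _ x) => //; exact: hy.
  (* In each coordinate the children of a cube with key m have keys 2 m + shift and 2 m + shift + 1;
     [b] chooses between them. *)
  pose c (b : {ffun 'I_n.+1 -> bool}) : T :=
    corner (k + 1) (fun i => 2 * key k x i + shift k i + (b i)%:Z).
  have ck b i : key (k + 1) (c b) i = 2 * key k x i + shift k i + (b i)%:Z.
    exact: key_corner.
  have keyS (y : T) i : key k y i = key k x i ->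
      key (k + 1) y i = 2 * key k x i + shift k i + (key (k + 1) y i - (2 * key k x i + shift k i)) /\
      0 <= key (k + 1) y i - (2 * key k x i + shift k i) <= 1.
    move=> E; split; first by rewrite [RHS]addrC subrK.
    have := floor_itv (2 ^ k * (y : V) ord0 i - (shift k i)%:~R / 3); rewrite -/(key k y i) E.
    rewrite [key (k + 1) y i]/key coordS; set z := 2 ^ k * (y : V) ord0 i - _.
    move: (key k x i) z => m z; move: (shift k i) => s.
    rewrite rmorphD/= => /andP[h1 h2].
    have l1 : 2 * m + s <= Num.floor (2 * z + s%:~R).
      by rewrite le_floor_int rmorphD rmorphM/= ?intr2; lra.
    have l2 : Num.floor (2 * z + s%:~R) < 2 * m + s + 2.
      by rewrite floor_lt_int !rmorphD rmorphM/= ?intr2; lra.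
    by lia.
  have cx b : gcube k x (c b).
    suff h i : key k (c b) i = key k x i by [].
    have q := pow2_gt0 k.
    have := floor_itv (2 ^ (k + 1) * (c b : V) ord0 i - (shift (k + 1) i)%:~R / 3).
    rewrite -/(key (k + 1) (c b) i) ck coordS [key k (c b) i]/key.
    set z := 2 ^ k * (c b : V) ord0 i - _; move: (key k x i) z => m z.
    move: (shift k i) => s.
    rewrite !rmorphD rmorphM/= ?intr2 => /andP[h1 h2]; apply/eqP; rewrite floor_eq.
    rewrite rmorphD/=.
    have bE : ((b i)%:Z)%:~R = (if b i then 1 else 0) :> R by case: (b i).
    move: h1 h2; rewrite !bE; case: (b i) => h1 h2; apply/andP; split; lra.
  have cinj b b' : gcube (k + 1) (c b) = gcube (k + 1) (c b') -> b = b'.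
    move=> E; have : gcube (k + 1) (c b') (c b) by rewrite -E.
    by move=> h; apply/ffunP => i; have := h i; rewrite !ck => /addrI; case: (b i); case: (b' i).
  exists (range (fun b => gcube (k + 1) (c b))); split.
  + by move=> _ [b _ <-]; exists (c b).
  + by apply: card_range_ffun; [exact: cinj|rewrite card_ffun card_bool card_ord].
  + by move=> _ _ [b _ <-] [b' _ <-] [z [h1 h2]]; exact: same h1 h2.
  + apply/seteqP; split => [y yx|y [_ [b _ <-]] yb]; last first.
      by rewrite -(gcube_eq (cx b)); apply: gcube_parent.
    pose b := [ffun i => 0 < key (k + 1) y i - (2 * key k x i + shift k i)].
    exists (gcube (k + 1) (c b)); first by exists b.
    move=> i; rewrite ck ffunE; have [E] := keyS y i (yx i).
    by move: E; set d := _ - _ => -> ?; congr (_ + _); case: ltP; lia.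
- move=> _ _ [k _ [x _ <-]] [l _ [y _ <-]].
  have [h|/eqP/set0P[z [zx zy]]] := pselect (gcube k x `&` gcube l y = set0).
    exact: Or31.
  rewrite -(gcube_eq zx) -(gcube_eq zy).
  by have [kl|/ltW lk] := leP k l; [apply: Or33|apply: Or32]; exact: gcube_sub.
Qed.

(** The shift keeps the origin at least a third of the side away from the boundary of its cube, so
    these cubes reach every point. In an unshifted grid they would stay in one orthant. *)
Lemma gcube_origin_exhaust (x : T) : exists K0 : nat, forall K : nat,
  (K0 <= K)%N -> gcube (- K%:Z) (0 : V) x.
Proof.
pose B := \max_i Num.truncn (3 * `|(x : V) ord0 i|).
exists B.+1 => K BK i; rewrite /key mxE mulr0.
have hx : `|2 ^ (- K%:Z) * (x : V) ord0 i| < 3^-1.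
  rewrite normrM gtr0_norm ?pow2_gt0// -exprnN mulrC ltr_pdivrMr ?exprn_gt0//.
  rewrite ltr_pdivlMl//; apply: (lt_le_trans (truncnS_gt _)).
  rewrite -natrX ler_nat; apply: (@leq_trans B.+1); last first.
    by apply: (leq_trans BK); apply: ltnW; exact: ltn_expl.
  by rewrite ltnS; exact: (leq_bigmax i).
move: hx; rewrite ltr_norml; set t := 2 ^ _ * _ => /andP[h1 h2].
case: (shift1 (- K%:Z) i) => ->.
  by transitivity (-1 : int); [|symmetry]; apply/eqP; rewrite floor_eq; lra.
by transitivity (0 : int); [|symmetry]; apply/eqP; rewrite floor_eq; lra.
Qed.

End one_grid.

End grids.

(** * Enclosing an arbitrary cube in a cube of one of the grids *)

Section covering.
Variables (R : realType) (n : nat).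
Local Notation V := 'rV[R]_n.+1.
Local Notation T := (Rn R n).
Local Notation mu := (@lebesgue_Rn R n).

(** The scale at which a cube of side [l] has less than a third, but at least a sixth, of the side
    of a grid cube. *)
Lemma exists_scale (l : R) : 0 < l -> exists k : int,
  2 ^ k * l < 3^-1 /\ 3^-1 <= 2 ^ (k + 1) * l.
Proof.
move=> l0.
have [N hN] : exists N : nat, 2 ^ (- N%:Z) * l < 3^-1.
  exists (Num.truncn (3 * l)).+1; rewrite -exprnN mulrC ltr_pdivrMr ?exprn_gt0//.
  rewrite ltr_pdivlMl//; apply: (lt_trans (truncnS_gt _)).
  by rewrite -natrX ltr_nat ltn_expl.
have pow (j : nat) : 2 ^ (- N%:Z + j%:Z) * l = 2 ^+ j * (2 ^ (- N%:Z) * l).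
  by rewrite expfzDr// -exprnP; ring.
have ex : exists j : nat, 3^-1 <= 2 ^ (- N%:Z + j%:Z) * l.
  set u := 2 ^ (- N%:Z) * l in hN pow; have u0 : 0 < u by rewrite mulr_gt0 ?pow2_gt0.
  exists (Num.truncn (3^-1 / u)).+1; rewrite pow -ler_pdivrMr//.
  by apply/ltW; apply: (lt_trans (truncnS_gt _)); rewrite -natrX ltr_nat ltn_expl.
case: (ex_minnP ex) => -[|j] hj jmin; first by move: hj; rewrite addr0 leNgt hN.
exists (- N%:Z + j%:Z); split; last first.
  by have -> : - N%:Z + j%:Z + 1 = - N%:Z + j.+1%:Z by lia.
by rewrite ltNge; apply/negP => /jmin; rewrite ltnn.
Qed.

(** Cell boundaries of the two shifts lie in Z + 1/3 and Z - 1/3, which are a third apart, so a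
    shorter interval cannot meet both: [a - b] would be an integer strictly between 0 and 1. *)
Lemma third_shift (u v : R) : u <= v -> v - u < 3^-1 ->
  Num.floor (u - 3^-1) = Num.floor (v - 3^-1) \/
  Num.floor (u + 3^-1) = Num.floor (v + 3^-1).
Proof.
move=> uv h.
have [E|/eqP E] := eqVneq (Num.floor (u - 3^-1)) (Num.floor (v - 3^-1)); first by left.
have [E'|/eqP E'] := eqVneq (Num.floor (u + 3^-1)) (Num.floor (v + 3^-1)); first by right.
have l1 : Num.floor (u - 3^-1) < Num.floor (v - 3^-1).
  by rewrite lt_neqAle; apply/andP; split; [exact/eqP|apply: le_floor; lra].
have l2 : Num.floor (u + 3^-1) < Num.floor (v + 3^-1).
  by rewrite lt_neqAle; apply/andP; split; [exact/eqP|apply: le_floor; lra].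
have /andP[] := floor_lt_sep l1; have /andP[] := floor_lt_sep l2.
set a := Num.floor _; set b := Num.floor (v - _) => h1 h2 h3 h4.
have b1 : (0 : int) < a - b by rewrite -(ltr_int R) rmorphB/= mulr0z; lra.
have b2 : a - b < (1 : int) by rewrite -(ltr_int R) rmorphB/= mulr1z; lra.
by lia.
Qed.

(** Each coordinate chooses its own shift, which is why there are 2^(n+1) grids. The grid cube
    contains [Q] and its side is at most six times as long. *)
Lemma cube_in_grid (Q : set T) (f : T -> R) : cube Q ->
  exists (eps : {ffun 'I_n.+1 -> bool}) (k : int), forall x, Q x ->
  (average Q (fun y => `|f y|%R) <=
   (6 ^+ n.+1)%:E * average (gcube eps k x) (fun y => `|f y|%R))%E.
Proof.
move=> [s [t [a [l [l0 QE]]]]]; have [k [k1 k2]] := exists_scale l0.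
have p := @pow2_gt0 R k.
have ch i : exists b : bool,
    Num.floor (2 ^ k * a ord0 i - ((if b then 1 else -1) * (-1) ^ k : int)%:~R / 3) =
    Num.floor (2 ^ k * (a ord0 i + l) - ((if b then 1 else -1) * (-1) ^ k : int)%:~R / 3).
  have : ((-1) ^ k = 1 :> int) \/ ((-1) ^ k = -1 :> int).
    by have := @shift1 0 (fun=> true) k ord0; rewrite /shift mul1r.
  have [||h|h] := @third_shift (2 ^ k * a ord0 i) (2 ^ k * (a ord0 i + l)).
  - by rewrite ler_pM2l// lerDl ltW.
  - by rewrite mulrDr addrAC subrr add0r.
  - by case=> ->; [exists true|exists false]; rewrite ?mulr1 ?mulrNN ?mulr1 mulr1z mul1r.
  - have e1 : (-1 : int)%:~R / 3 = - 3^-1 :> R by rewrite mulrNz mulr1z mulN1r.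
    by case=> ->; [exists false|exists true]; rewrite ?mulr1 ?mul1r e1 opprK.
have /choice[eps0 heps] := ch; pose eps : {ffun 'I_n.+1 -> bool} := [ffun i => eps0 i].
exists eps, k => x Qx.
have keyE y : Q y -> forall i, key eps k y i =
    Num.floor (2 ^ k * a ord0 i - (shift eps k i)%:~R / 3).
  rewrite QE => Qy i; have := heps i; rewrite /shift /eps ffunE => h.
  have /andP[y1 y2] : a ord0 i <= (y : V) ord0 i <= a ord0 i + l.
    have := Qy i; rewrite !mxE; case: (s); case: (t); rewrite /= in_itv/=;
      by move=> /andP[? ?]; apply/andP; split; lra.
  apply/eqP; rewrite eq_le /key /shift ffunE; apply/andP; split.
    by rewrite h; apply: le_floor; rewrite lerD2r ler_pM2l.
  by apply: le_floor; rewrite lerD2r ler_pM2l.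
have sub : Q `<=` gcube eps k x by move=> y Qy i; rewrite !keyE.
have lQ : mu Q = (l ^+ n.+1)%:E by rewrite QE lebesgue_Rn_cube.
have q := @pow2_gt0 R (- k).
rewrite /average lQ gcube_mu /= lee_pdivrMl ?exprn_gt0// !muleA -!EFinM.
set A := (\int[mu]_(x in Q) _)%E; set B := (\int[mu]_(x in gcube _ _ _) _)%E.
have AB : (A <= B)%E by apply: ge0_subset_integral_nomeas.
have B0 : (0 <= B)%E by apply: integral_ge0.
apply: (le_trans AB); rewrite -[leLHS]mul1e; apply: lee_wpmul2r => //.
rewrite lee_fin -!exprVn -!exprMn -[leLHS](expr1n _ n.+1) lerXn2r ?nnegrE//.
  by rewrite !mulr_ge0 ?invr_ge0 ?ltW.
rewrite ler_pdivlMr// mul1r -(ler_pM2l p) pow2K.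
by move: k2; rewrite expfzDr// expr1z; set u := 2 ^ k; lra.
Qed.

End covering.

(** * The finite tree of grid cubes between the levels -K and K *)

Section grid_tree.
Variables (R : realType) (n : nat).
Local Notation V := 'rV[R]_n.+1.
Local Notation T := (Rn R n).
Local Notation mu := (@lebesgue_Rn R n).
Variables (eps : {ffun 'I_n.+1 -> bool}) (K : nat).

Definition top : set T := gcube eps (- K%:Z) (0 : V).

Lemma top_cube : cube top. Proof. exact: gcube_cube. Qed.

Let lo (i : 'I_n.+1) : int :=
  Num.floor (2 ^ K%:Z * corner R eps (- K%:Z) (key eps (- K%:Z) (0 : V)) ord0 i
             - (shift eps K%:Z i)%:~R / 3).

(** Per coordinate, the top cube of side 2^K holds 2^(2K) leaves of side 2^(-K). The key range below
    has one more value because of the rounding in [lo]. *)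
Let N := (2 ^ K * 2 ^ K)%N.

Let key_range x i : top x -> 0 <= key eps K%:Z x i - lo i < N.+1%:Z.
Proof.
rewrite /top gcube_box => /(_ i); rewrite in_itv/= /lo /key.
set c := corner _ _ _ _; rewrite [(c + _) _ _]mxE [const_mx _ _ _]mxE opprK; set t := (x : V) ord0 i.
set s := _ / 3; set u := c ord0 i => /andP[h1 h2].
have p := @pow2_gt0 R K%:Z; apply/andP; split.
  by rewrite subr_ge0; apply: le_floor; rewrite lerD2r ler_pM2l.
have h3 : 2 ^ K%:Z * t - s < 2 ^ K%:Z * u - s + N%:Z%:~R.
  have -> : N%:Z%:~R = 2 ^ K%:Z * 2 ^ K%:Z :> R by rewrite /N -exprnP -pmulrn natrM natrX.
  by move: h2; rewrite -(ltr_pM2l p) mulrDr; lra.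
have := floor_itv (2 ^ K%:Z * u - s); set m := Num.floor (_ * u - s) => /andP[m1 m2].
have : Num.floor (2 ^ K%:Z * t - s) < m + 1 + N%:Z.
  rewrite floor_lt_int rmorphD/=; apply: (lt_le_trans h3); rewrite lerD2r ltW//.
rewrite -[N.+1]addn1 PoszD; move: (Num.floor (2 ^ K%:Z * t - s)) m {m1 m2} (Posz N) => a m M; lia.
Qed.

(** Keeping only the keys of actual points of the top cube makes the index type exact, although the
    range [N.+1] is merely an upper bound. *)
Let is_leaf (b : {ffun 'I_n.+1 -> 'I_N.+1}) : Prop :=
  exists2 x : T, top x & forall i, key eps K%:Z x i = lo i + (b i)%:Z.

Definition leaf_index : finType :=
  {b : {ffun 'I_n.+1 -> 'I_N.+1} | `[< is_leaf b >]}.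

Let leaf_ex (b : leaf_index) : exists x : T, top x /\
  forall i, key eps K%:Z x i = lo i + ((val b) i)%:Z.
Proof. by case: b => b /= /asboolP[x tx hx]; exists x. Qed.

Definition pt (b : leaf_index) : T := sval (cid (leaf_ex b)).

Definition leaf (b : leaf_index) : set T := gcube eps K%:Z (pt b).

Lemma pt_top b : top (pt b). Proof. by have [] := svalP (cid (leaf_ex b)). Qed.

Let pt_key b i : key eps K%:Z (pt b) i = lo i + ((val b) i)%:Z.
Proof. by have [_] := svalP (cid (leaf_ex b)); apply. Qed.

Lemma leaf_pt b : leaf b (pt b). Proof. exact: gcube_refl. Qed.

Lemma leaf_cube b : cube (leaf b). Proof. exact: gcube_cube. Qed.

Lemma leaf_measurable b : measurable (leaf b). Proof. exact: gcube_measurable. Qed.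

Lemma leaf_exists x : top x -> exists b, leaf b x.
Proof.
move=> tx.
have h i : (`|key eps K%:Z x i - lo i| < N.+1)%N.
  by have := key_range i tx; lia.
pose c : {ffun 'I_n.+1 -> 'I_N.+1} := [ffun i => Ordinal (h i)].
have lc : `[< is_leaf c >].
  apply/asboolP; exists x => // i; rewrite ffunE /=.
  by have := key_range i tx; lia.
exists (exist _ c lc) => i; rewrite pt_key /= ffunE /=.
by have := key_range i tx; lia.
Qed.

Lemma leaf_inj b b' x : leaf b x -> leaf b' x -> b = b'.
Proof.
move=> h h'; apply/val_inj/ffunP => i; apply/val_inj.
have := h i; rewrite (h' i) !pt_key => /addrI; by case.
Qed.

Lemma leaf_top b : leaf b `<=` top.
Proof.
have <- : gcube eps (- K%:Z) (pt b) = top by apply: gcube_eq; exact: pt_top.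
by apply: gcube_sub; lia.
Qed.

(** Tree levels count from the top cube: level 0 is the grid level -K, and level 2K, that of the
    leaves, is the grid level K. *)
Definition lvl (l : nat) : int := l%:Z - K%:Z.

Definition same (l : nat) (b b' : leaf_index) : bool :=
  [forall i, key eps (lvl l) (pt b) i == key eps (lvl l) (pt b') i].

Lemma sameP l b b' : reflect (gcube eps (lvl l) (pt b) (pt b')) (same l b b').
Proof.
apply: (iffP forallP) => h i; first by rewrite (eqP (h i)).
by rewrite h.
Qed.

Lemma same_equiv l : equivalence_rel (same l).
Proof.
move=> x y z; split; first by apply/sameP.
move=> /sameP xy; apply/sameP/sameP => h i; first by rewrite h xy.
by rewrite h -xy.
Qed.

Lemma lvlS l : lvl l.+1 = lvl l + 1. Proof. rewrite /lvl; lia. Qed.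

Lemma same_refine l x y : same l.+1 x y -> same l x y.
Proof. by move=> /sameP; rewrite lvlS => h; apply/sameP; exact: gcube_parent. Qed.

Lemma same_root x y : same 0 x y.
Proof.
apply/sameP; rewrite /lvl sub0r => i.
by rewrite (pt_top x i) (pt_top y i).
Qed.

Lemma lvl_leaf : lvl (2 * K) = K%:Z. Proof. rewrite /lvl; lia. Qed.

Lemma same_leaf x y : same (2 * K) x y -> x = y.
Proof. by move=> /sameP; rewrite lvl_leaf => h; apply: (leaf_inj h); exact: leaf_pt. Qed.

Lemma gcube_leaves l b : (l <= 2 * K)%N ->
  gcube eps (lvl l) (pt b) = \big[setU/set0]_(b' <- index_enum leaf_index | same l b b') leaf b'.
Proof.
move=> lK; rewrite -bigcup_seq_cond; apply/seteqP; split => [x hx|x [b' /= /andP[_ /sameP h] hx]].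
  have [b' hb'] : exists b', leaf b' x.
    apply: leaf_exists; have <- : gcube eps (- K%:Z) (pt b) = top by apply: gcube_eq; exact: pt_top.
    by apply: gcube_sub hx; rewrite /lvl; lia.
  exists b' => //=; rewrite mem_index_enum/=; apply/sameP => i.
  have hl : lvl l <= K%:Z by rewrite /lvl; lia.
  by rewrite -(gcube_sub hl hb' i) hx.
rewrite -(gcube_eq h); have hl : lvl l <= K%:Z by rewrite /lvl; lia.
exact: gcube_sub hl _ hx.
Qed.

Definition leaf_mass (b : leaf_index) : R := (2 ^ (- K%:Z)) ^+ n.+1.

Lemma leaf_mass_gt0 b : 0 < leaf_mass b. Proof. by rewrite exprn_gt0// pow2_gt0. Qed.

Lemma leaf_mu b : mu (leaf b) = (leaf_mass b)%:E. Proof. exact: gcube_mu. Qed.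

Lemma integral_gcube_leaves l b (h : T -> \bar R) : (l <= 2 * K)%N ->
  measurable_fun setT h -> (forall x, (0 <= h x)%E) ->
  (\int[mu]_(x in gcube eps (lvl l) (pt b)) h x =
   \sum_(b' | same l b b') \int[mu]_(x in leaf b') h x)%E.
Proof.
move=> lK mh h0; rewrite gcube_leaves// -big_filter.
rewrite (ge0_integral_bigsetU mu leaf_measurable); last 4 first.
- by rewrite filter_uniq// index_enum_uniq.
- by move=> b1 b2 _ _ [x [h1 h2]]; exact: leaf_inj h1 h2.
- exact: measurable_funTS.
- by [].
by rewrite big_filter.
Qed.

Lemma cmass_grid l b : (l <= 2 * K)%N ->
  cmass leaf_mass same l b = (2 ^ (- lvl l)) ^+ n.+1.
Proof.
move=> lK; have := @integral_gcube_leaves l b (cst 1%E) lK (@measurable_cst _ _ _ _ _ _) (fun=> lee01).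
have area Q : measurable Q -> (\int[mu]_(x in Q) cst 1%E x = mu Q)%E.
  by move=> mQ; rewrite integral_cst// mul1e.
rewrite (area _ (gcube_measurable _ _ _)).
under eq_bigr => b' _ do rewrite (area _ (leaf_measurable b')) leaf_mu.
by rewrite sumEFin gcube_mu => -[].
Qed.

Lemma cmass_regular l b : (l < 2 * K)%N ->
  cmass leaf_mass same l b <= 2 ^+ n.+1 * cmass leaf_mass same l.+1 b.
Proof.
move=> lK; rewrite !cmass_grid// ?(ltnW lK)// -exprMn.
suff -> : 2 * 2 ^ (- lvl l.+1) = 2 ^ (- lvl l) :> R by [].
by rewrite -[in LHS](expr1z 2) -expfzDr// lvlS opprD addrCA subrr addr0.
Qed.

Lemma gcube_sub_top l b : gcube eps (lvl l) (pt b) `<=` top.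
Proof.
have <- : gcube eps (- K%:Z) (pt b) = top by apply: gcube_eq; exact: pt_top.
by apply: gcube_sub; rewrite /lvl; lia.
Qed.

Section averages.
Variable h : T -> R.
Hypothesis mh : measurable_fun setT h.
Hypothesis hfin : (\int[mu]_(x in top) `|h x|%:E < +oo)%E.

Definition leaf_avg (b : leaf_index) : R := fine (average (leaf b) (fun y => `|h y|)).

Lemma leaf_avg_ge0 b : 0 <= leaf_avg b.
Proof. by rewrite fine_ge0// average_ge0//; exact: leaf_cube. Qed.

Lemma average_fin Q : cube Q -> Q `<=` top ->
  average Q (fun y => `|h y|) \is a fin_num.
Proof.
move=> cQ Qt; have [v v0 E] := cube_mu cQ; rewrite /average E fin_numM//.
rewrite ge0_fin_numE; last by apply: integral_ge0 => x _; rewrite lee_fin.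
by apply: le_lt_trans hfin; apply: ge0_subset_integral_nomeas => // x; rewrite lee_fin.
Qed.

Lemma integral_average Q : cube Q -> Q `<=` top ->
  (\int[mu]_(x in Q) `|h x|%:E = (fine (mu Q) * fine (average Q (fun y => `|h y|)))%:E)%E.
Proof.
move=> cQ Qt; have [v v0 E] := cube_mu cQ.
rewrite EFinM (fineK (average_fin cQ Qt)) /average E /= muleA -EFinM divff ?mul1e//.
by rewrite gt_eqF.
Qed.

Lemma cavg_average l b : (l <= 2 * K)%N ->
  cavg leaf_mass same l leaf_avg b =
  fine (average (gcube eps (lvl l) (pt b)) (fun y => `|h y|)).
Proof.
have habs0 x : (0 <= `|h x|%:E)%E by rewrite lee_fin.
move=> lK; have := @integral_gcube_leaves l b (fun x => `|h x|%:E) lK (measurable_absE mh) habs0.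
rewrite integral_average; [|exact: gcube_cube|exact: gcube_sub_top].
under eq_bigr => b' _ do rewrite (integral_average (leaf_cube b') (@leaf_top b')) leaf_mu.
rewrite sumEFin gcube_mu /= => -[E].
rewrite /cavg cmass_grid// -E mulrC mulKf// gt_eqF// exprn_gt0// pow2_gt0//.
Qed.

Definition tree_max (x : T) : R :=
  \sum_(b : leaf_index) \1_(leaf b) x * rmax leaf_mass same leaf_avg (2 * K) b.

Lemma tree_max_leaf b x : leaf b x ->
  tree_max x = rmax leaf_mass same leaf_avg (2 * K) b.
Proof.
move=> bx; rewrite /tree_max (bigD1 b)//= indicE mem_set// mul1r big1 ?addr0//.
move=> b' b'b; rewrite indicE memNset ?mul0r// => b'x.
by move/eqP: b'b; apply; exact: leaf_inj b'x bx.
Qed.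

Lemma tree_max_top x : ~ top x -> tree_max x = 0.
Proof.
move=> tx; rewrite /tree_max big1// => b _; rewrite indicE memNset ?mul0r//.
by move=> /leaf_top.
Qed.

Lemma tree_max_ge0 x : 0 <= tree_max x.
Proof.
apply: sumr_ge0 => b _; rewrite mulr_ge0 ?indicE ?ler0n//.
by apply: rmax_ge0; [exact: leaf_mass_gt0|exact: same_equiv|exact: leaf_avg_ge0].
Qed.

Lemma measurable_tree_max : measurable_fun setT tree_max.
Proof.
apply: measurable_sum => b; apply: measurable_funM; last exact: measurable_cst.
by apply: measurable_indic; exact: leaf_measurable.
Qed.

Lemma tree_max_attained b x : leaf b x -> exists2 l, (l <= 2 * K)%N &
  (tree_max x)%:E = average (gcube eps (lvl l) x) (fun y => `|h y|).
Proof.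
move=> bx; rewrite (tree_max_leaf bx).
have [l lK ->] : exists2 l, (l <= 2 * K)%N & rmax leaf_mass same leaf_avg (2 * K) b =
    cavg leaf_mass same l leaf_avg b.
  elim: (2 * K)%N => [|L [l lL IH]]; first by exists 0%N.
  rewrite /=; case: leP => _; first by exists L.+1.
  by exists l => //; exact: leqW.
exists l => //; rewrite cavg_average// fineK; last first.
  by apply: average_fin; [exact: gcube_cube|exact: gcube_sub_top].
congr average; apply/esym/gcube_eq; have hl : lvl l <= K%:Z by rewrite /lvl; lia.
exact: gcube_sub hl _ bx.
Qed.

Lemma average_le_tree_max l x : (l <= 2 * K)%N -> top x ->
  (average (gcube eps (lvl l) x) (fun y => `|h y|%R) <= (tree_max x)%:E)%E.
Proof.
move=> lK /leaf_exists[b bx].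
have hl : lvl l <= K%:Z by rewrite /lvl; lia.
rewrite (gcube_eq (gcube_sub hl bx)) (tree_max_leaf bx).
rewrite -(fineK (average_fin (gcube_cube _ _ _) (@gcube_sub_top l b))) lee_fin.
by rewrite -cavg_average//; exact: cavg_le_rmax.
Qed.

Lemma tree_max_le_maximal x : ((tree_max x)%:E <= maximal h x)%E.
Proof.
have [/leaf_exists[b bx]|tx] := pselect (top x); last first.
  by rewrite tree_max_top//; exact: maximal_ge0.
have [l lK ->] := tree_max_attained bx.
by apply: average_le_maximal; [exact: gcube_cube|exact: gcube_refl].
Qed.

End averages.

End grid_tree.

(** * Local integrability, and the maximal function as a limit of trees *)

Section local_integrability.
Variables (R : realType) (n : nat).
Local Notation V := 'rV[R]_n.+1.
Local Notation T := (Rn R n).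
Local Notation mu := (@lebesgue_Rn R n).
Implicit Types (h f g : T -> R).

Definition locally_integrable h := measurable_fun setT h /\
  forall Q : set T, cube Q -> (\int[mu]_(x in Q) `|h x|%:E < +oo)%E.

Lemma ae_point (P : T -> Prop) : {ae mu, forall x, P x} -> exists x, P x.
Proof.
move=> [N [mN N0 PN]]; apply: contrapT => /forallNP nP.
have : (mu (centered_cube 0) <= mu N)%E.
  apply: (@le_outer_measure _ _ (@lebesgue_outer R n)) => x _; apply: PN; exact: nP.
have [v v0 E] := cube_mu (@centered_cube_cube R n 0).
by rewrite N0 E lee_fin leNgt v0.
Qed.

Lemma cube_sub_centered (Q : set T) : cube Q -> exists k, forall j, (k <= j)%N ->
  Q `<=` centered_cube j.
Proof.
move=> [s [t [a [l [l0 ->]]]]].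
have [k ak] := @centered_cube_cover R n a.
have [m bm] := @centered_cube_cover R n (a + const_mx l : V).
exists (maxn k m) => j; rewrite geq_max => /andP[kj mj] x xQ; apply/centered_cubeP => i.
have := centered_cube_homo kj ak; have := centered_cube_homo mj bm.
move=> /centered_cubeP/(_ i); rewrite !mxE => /andP[b1 b2].
move=> /centered_cubeP/(_ i) /andP[a1 a2].
have := xQ i; rewrite !mxE; case: (s); case: (t); rewrite /= in_itv/=;
  by move=> /andP[? ?]; apply/andP; split; lra.
Qed.

Lemma locally_integrable_maximal h x : measurable_fun setT h ->
  (maximal h x < +oo)%E -> locally_integrable h.
Proof.
move=> mh Mx; split=> // Q /cube_sub_centered[k Qk].
have [m xm] := centered_cube_cover x.
have cC := @centered_cube_cube R n (maxn k m).
have Cx : centered_cube (maxn k m) x by apply: centered_cube_homo xm; exact: leq_maxr.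
have := le_lt_trans (average_le_maximal h cC Cx) Mx.
have [v v0 E] := cube_mu cC; rewrite /average E /= lte_pdivrMl// gt0_muley ?lte_fin//.
apply: le_lt_trans; apply: ge0_subset_integral_nomeas; last exact/Qk/leq_maxl.
by move=> y; rewrite lee_fin.
Qed.

Lemma locally_integrable_le f h : measurable_fun setT f -> locally_integrable h ->
  (forall x, `|f x| <= `|h x|) -> locally_integrable f.
Proof.
move=> mf [mh hh] fh; split=> // Q cQ; apply: le_lt_trans (hh Q cQ).
apply: ge0_le_integral.
- exact: cube_measurable.
- by move=> x _; rewrite lee_fin.
- exact/measurable_funTS/measurable_absE.
- exact/measurable_funTS/measurable_absE.
- by move=> x _; rewrite lee_fin.
Qed.

Lemma locally_integrable_bounded f (M : R) : measurable_fun setT f ->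
  (forall x, `|f x| <= M) -> locally_integrable f.
Proof.
move=> mf fM; split=> // Q cQ; have [v v0 E] := cube_mu cQ.
have mQ := cube_measurable cQ.
apply: (@le_lt_trans _ _ (\int[mu]_(x in Q) (cst M%:E) x)%E).
  apply: ge0_le_integral.
  - exact: mQ.
  - by move=> x _; rewrite lee_fin.
  - exact/measurable_funTS/measurable_absE.
  - exact: measurable_cst.
  - by move=> x _; rewrite lee_fin.
by rewrite integral_cst//= E -EFinM ltry.
Qed.

Lemma tree_max_homo eps K h x : locally_integrable h ->
  tree_max eps K h x <= tree_max eps K.+1 h x.
Proof.
move=> [mh hh].
have f1 := hh _ (@top_cube R n eps K); have f2 := hh _ (@top_cube R n eps K.+1).
have [tx|tx] := pselect (top eps K x); last first.
  by rewrite (tree_max_top h tx); exact: tree_max_ge0.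
have [b bx] := leaf_exists tx; rewrite -lee_fin.
have [l lK ->] := tree_max_attained mh f1 bx.
(* Enlarging [K] adds a level at the top as well as at the bottom, so the tree index of a given grid
   level goes up by one. *)
have -> : lvl K l = lvl K.+1 l.+1 by rewrite /lvl; lia.
apply: average_le_tree_max => //; first by lia.
by apply: gcube_sub tx; lia.
Qed.

Lemma tree_max_homo_le eps K L h x : locally_integrable h -> (K <= L)%N ->
  tree_max eps K h x <= tree_max eps L h x.
Proof.
move=> lh; elim: L => [|L IH]; first by rewrite leqn0 => /eqP ->.
rewrite leq_eqVlt => /orP[/eqP ->//|/IH h1]; apply: (le_trans h1).
exact: tree_max_homo.
Qed.

Definition grid_max K h x := \sum_(eps : {ffun 'I_n.+1 -> bool}) tree_max eps K h x.

Lemma grid_max_ge0 K h x : 0 <= grid_max K h x.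
Proof. by apply: sumr_ge0 => eps _; exact: tree_max_ge0. Qed.

Lemma measurable_grid_max K h : measurable_fun setT (grid_max K h).
Proof. by apply: measurable_sum => eps; exact: measurable_tree_max. Qed.

Lemma grid_max_homo K L h x : locally_integrable h -> (K <= L)%N ->
  grid_max K h x <= grid_max L h x.
Proof. by move=> lh KL; apply: ler_sum => eps _; exact: tree_max_homo_le. Qed.

Lemma maximal_le_grid h x : locally_integrable h ->
  (maximal h x <= ereal_sup (range (fun K => (6 ^+ n.+1 * grid_max K h x)%:E)))%E.
Proof.
move=> lh; have [mh hh] := lh; apply: maximal_leP => [|Q cQ Qx].
  apply: le_trans (ereal_sup_ubound _); last by exists 0%N.
  by rewrite lee_fin mulr_ge0 ?exprn_ge0// grid_max_ge0.
have [eps [k avg]] := cube_in_grid h cQ.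
have [K0 hK] := gcube_origin_exhaust eps x.
(* This depth brings [x] into the top cube and the grid level [k] into the range from -K to K. *)
pose K := maxn K0 `|k|%N.
apply: (@le_trans _ _ (6 ^+ n.+1 * grid_max K h x)%:E); last first.
  by apply: ereal_sup_ubound; exists K.
apply: (le_trans (avg x Qx)); rewrite EFinM lee_pmul2l ?lte_fin ?exprn_gt0//.
have tx : top eps K x by apply: hK; exact: leq_maxl.
have kE : k = lvl K (absz (k + K%:Z)) by rewrite /lvl /K; lia.
have kK : (absz (k + K%:Z)%R <= 2 * K)%N by rewrite /K; lia.
have := average_le_tree_max mh (hh _ (@top_cube R n eps K)) kK tx.
rewrite -kE => /le_trans; apply; rewrite lee_fin /grid_max (bigD1 eps)//= lerDl.
by apply: sumr_ge0 => eps' _; exact: tree_max_ge0.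
Qed.

Lemma card_eps : #|{ffun 'I_n.+1 -> bool}| = (2 ^ n.+1)%N.
Proof. by rewrite card_ffun card_bool card_ord. Qed.

End local_integrability.

Section transfer.
Variables (R : realType) (n : nat).
Local Notation T := (Rn R n).
Local Notation mu := (@lebesgue_Rn R n).
Variable X : fspace R n.
Hypothesis nX : normed_lattice X.
Let fX : function_lattice X := nX.

(** 6^(n+1) is the cost of [cube_in_grid], and 2^(n+1) is the number of grids. *)
Definition grid_const : R := 6 ^+ n.+1 * (2 ^+ n.+1).

Lemma grid_const_gt0 : 0 < grid_const.
Proof. by rewrite mulr_gt0 ?exprn_gt0. Qed.

Lemma xnorm_maximal_grid (h : T -> R) (c : R) : locally_integrable h -> 0 <= c ->
  (forall eps K, (xnorm X (fun x => (tree_max eps K h x)%:E) <= c%:E)%E) ->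
  (xnorm X (maximal h) <= (grid_const * c)%:E)%E.
Proof.
move=> lh c0 H; have [mh hh] := lh.
pose F K x := (6 ^+ n.+1 * grid_max K h x)%:E.
have mF K : measurable_fun setT (F K).
  apply/measurable_EFinP; apply: measurable_funM; first exact: measurable_cst.
  exact: measurable_grid_max.
have F0 K x : (0 <= F K x)%E by rewrite lee_fin mulr_ge0 ?exprn_ge0 ?grid_max_ge0.
apply: (@le_trans _ _ (xnorm X (fun x => ereal_sup (range (F ^~ x))))).
  apply: (le_xnorm fX); first exact: measurable_maximal.
    by move=> x; exact: maximal_ge0.
  by move=> x; exact: maximal_le_grid.
apply: (xnorm_fatou fX mF F0) => [K x|K].
  by rewrite lee_fin ler_pM2l ?exprn_gt0//; exact: grid_max_homo.
have mt eps : measurable_fun setT (fun x => (tree_max eps K h x)%:E).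
  by apply/measurable_EFinP; exact: measurable_tree_max.
have t0 eps x : (0 <= (tree_max eps K h x)%:E)%E by rewrite lee_fin tree_max_ge0.
rewrite /F; under eq_fun => x do rewrite EFinM.
apply: (le_trans (xnormZ_le fX _ _)); first by rewrite exprn_gt0.
  by apply/measurable_EFinP; exact: measurable_grid_max.
rewrite /grid_const -mulrA EFinM lee_pmul2l ?lte_fin ?exprn_gt0//.
rewrite /grid_max; under eq_fun => x do rewrite -sumEFin.
apply: (le_trans (xnorm_sum nX _ mt t0)).
apply: (@le_trans _ _ (\sum_(eps : {ffun 'I_n.+1 -> bool}) c%:E)%E).
  by apply: lee_sum => eps _; exact: H.
rewrite sumEFin lee_fin big_const iter_addr addr0 card_eps.
by rewrite -[leLHS]mulr_natl natrX.
Qed.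

Lemma integral_maximal_grid (h : T -> R) (u : T -> R) (c : \bar R) :
  locally_integrable h -> measurable_fun setT u -> (forall x, 0 <= u x) -> (0 <= c)%E ->
  (forall eps K, (\int[mu]_x ((u x)%:E * (tree_max eps K h x)%:E) <= c)%E) ->
  (\int[mu]_x ((u x)%:E * maximal h x) <= grid_const%:E * c)%E.
Proof.
move=> lh mu_ u0 c0 H; have [mh hh] := lh.
have muE : measurable_fun setT (fun x => (u x)%:E) by exact/measurable_EFinP.
pose F K x := ((u x)%:E * (6 ^+ n.+1 * grid_max K h x)%:E)%E.
have mG K : measurable_fun setT (fun x => (6 ^+ n.+1 * grid_max K h x)%:E).
  apply/measurable_EFinP; apply: measurable_funM; first exact: measurable_cst.
  exact: measurable_grid_max.
have mF K : measurable_fun setT (F K) by exact: (emeasurable_funM muE (mG K)).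
have F0 K x : (0 <= F K x)%E.
  by rewrite mule_ge0 ?lee_fin// mulr_ge0 ?exprn_ge0 ?grid_max_ge0.
apply: (@le_trans _ _ (\int[mu]_x ereal_sup (range (F ^~ x)))%E).
  apply: ge0_le_integral.
  - exact: measurableT.
  - by move=> x _; rewrite mule_ge0 ?lee_fin// maximal_ge0.
  - by apply: (emeasurable_funM muE); exact: measurable_maximal.
  - exact: measurable_ereal_sup.
  (* Where [u] vanishes the product is 0, even if [maximal h] is infinite. Elsewhere one may divide
     by [u]. *)
  - move=> x _; have [->|un0] := eqVneq (u x) 0.
      rewrite mul0e; apply: le_trans (F0 0%N x) _.
      by apply: ereal_sup_ubound; exists 0%N.
    have up : 0 < u x by rewrite lt_def un0 u0.
    rewrite -lee_pdivlMl//; apply: (le_trans (maximal_le_grid x lh)).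
    apply: ge_ereal_sup => _ [K _ <-]; rewrite lee_pdivlMl//.
    by apply: ereal_sup_ubound; exists K.
apply: le_integral_sup => [|//|//|K x|K]; first exact: measurableT.
  rewrite lee_wpmul2l ?lee_fin// ler_pM2l ?exprn_gt0//; exact: grid_max_homo.
have mt eps : measurable_fun setT (fun x => ((u x)%:E * (tree_max eps K h x)%:E)%E).
  apply: (emeasurable_funM muE); apply/measurable_EFinP; exact: measurable_tree_max.
have t0 eps x : (0 <= (u x)%:E * (tree_max eps K h x)%:E)%E.
  by rewrite mule_ge0 ?lee_fin// tree_max_ge0.
have FE x : F K x = ((6 ^+ n.+1)%:E *
    \sum_(eps : {ffun 'I_n.+1 -> bool}) ((u x)%:E * (tree_max eps K h x)%:E))%E.
  rewrite /F /grid_max; under [in RHS]eq_bigr do rewrite -EFinM.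
  by rewrite sumEFin -!EFinM -mulr_sumr; congr (_%:E); ring.
under eq_integral => x _ do rewrite FE.
rewrite ge0_integralZl_EFin; [|exact: measurableT| | |by rewrite exprn_ge0]; last 2 first.
- by move=> x _; apply: sume_ge0 => eps _.
- by apply: emeasurable_sum => eps; exact: mt.
rewrite /grid_const EFinM -muleA lee_pmul2l ?lte_fin ?exprn_gt0//.
rewrite ge0_integral_sum; [|exact: measurableT|exact: mt|by move=> eps x _; exact: t0].
apply: (@le_trans _ _ (\sum_(eps : {ffun 'I_n.+1 -> bool}) c)%E).
  by apply: lee_sum => eps _; exact: H.
case: c c0 {H} => [r r0||//].
  rewrite sumEFin lee_fin big_const iter_addr addr0 card_eps.
  by rewrite -[leLHS]mulr_natl natrX.
by move=> _; rewrite gt0_muley ?leey// lte_fin exprn_gt0.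
Qed.

End transfer.

(** * The Lorentz-Luxemburg theorem *)

Section lorentz_luxemburg.
Variables (R : realType) (n : nat).
Local Notation T := (Rn R n).
Local Notation mu := (@lebesgue_Rn R n).
Variable X : fspace R n.
Hypothesis nX : normed_lattice X.
Let fX : function_lattice X := nX.

Section fixed_cube.
Variable k0 : nat.
Let Q : set T := centered_cube k0.
Let mQ : measurable Q. Proof. exact: measurable_centered_cube. Qed.
Let Qfin : (mu Q < +oo)%E.
Proof. by have [v _ E] := cube_mu (@centered_cube_cube R n k0); rewrite /Q E ltry. Qed.

Let bnd (u : T -> R) := measurable_fun setT u /\ exists M, forall x, `|u x| <= M.

Let bndD u v : bnd u -> bnd v -> bnd (fun x => u x + v x).
Proof.
move=> [mu_ [M uM]] [mv [N vN]]; split; first exact: measurable_funD.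
by exists (M + N) => x; rewrite (le_trans (ler_normD _ _))// lerD.
Qed.

Let bndM u v : bnd u -> bnd v -> bnd (fun x => u x * v x).
Proof.
move=> [mu_ [M uM]] [mv [N vN]]; split; first exact: measurable_funM.
by exists (M * N) => x; rewrite normrM ler_pM.
Qed.

Let bnd_cst c : bnd (fun=> c).
Proof. by split => //; exists `|c|. Qed.

Let bndZ c u : bnd u -> bnd (fun x => c * u x).
Proof. by move=> bu; apply: bndM => //; exact: bnd_cst. Qed.

Let bndB u v : bnd u -> bnd v -> bnd (fun x => u x - v x).
Proof.
move=> bu bv; rewrite (_ : (fun _ => _) = fun x => u x + (-1) * v x).
  exact: (bndD bu (bndZ (-1) bv)).
by apply/funext => x; rewrite mulN1r.
Qed.

Let bndX u : bnd u -> bnd (fun x => u x ^+ 2).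
Proof. by move=> bu; under eq_fun do rewrite expr2; exact: bndM. Qed.

Let J (u : T -> R) : R := \int[mu]_(x in Q) u x.

Let Jint u : bnd u -> mu.-integrable Q (EFin \o u).
Proof.
move=> [mu_ [M uM]]; apply: measurable_bounded_integrable => //; first exact: measurable_funTS.
exists `|M|; split; first exact: num_real.
move=> N MN x Qx; apply: (le_trans (uM x)); apply: le_trans (ler_norm _) (ltW MN).
Qed.

Let JE u : bnd u -> (\int[mu]_(x in Q) (u x)%:E = (J u)%:E)%E.
Proof. by move=> bu; rewrite /J /Rintegral fineK//; exact: integrable_fin_num (Jint bu). Qed.

Let JD u v : bnd u -> bnd v -> J (fun x => u x + v x) = J u + J v.
Proof. by move=> bu bv; apply: RintegralD => //; exact: Jint. Qed.

Let JZ c u : bnd u -> J (fun x => c * u x) = c * J u.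
Proof. by move=> bu; apply: RintegralZl => //; exact: Jint. Qed.

Let leJ u v : bnd u -> bnd v -> (forall x, Q x -> u x <= v x) -> J u <= J v.
Proof. by move=> bu bv uv; apply: le_Rintegral => //; exact: Jint. Qed.

Let J0 u : (forall x, 0 <= u x) -> 0 <= J u.
Proof. by move=> u0; apply: Rintegral_ge0. Qed.

Section projection.
Variables (f : T -> R) (M c : R).
Hypothesis mf : measurable_fun setT f.
Hypothesis f0M : forall x, 0 <= f x <= M.
Hypothesis c0 : 0 <= c.

Let adm (h : T -> R) :=
  [/\ measurable_fun setT h, forall x, 0 <= h x <= f x, X h & fnorm X h <= c].

Let bf : bnd f.
Proof.
by split => //; exists M => x; have /andP[h1 h2] := f0M x; rewrite ger0_norm.
Qed.

Let badm h : adm h -> bnd h.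
Proof.
case=> mh h0f _ _; split => //; exists M => x; have /andP[h1 h2] := h0f x.
by have /andP[h3 h4] := f0M x; rewrite ger0_norm// (le_trans h2).
Qed.

Let dist h := J (fun x => (f x - h x) ^+ 2).

Let bdist h : adm h -> bnd (fun x => (f x - h x) ^+ 2).
Proof. by move=> /badm bh; apply: bndX; exact: bndB. Qed.

Let adm0 : adm (fun=> 0).
Proof.
have X0 := fl_scale fX 0 (fl_cube fX 0).
have n0 := fl_normZ fX 0 (fl_cube fX 0); rewrite normr0 mul0r in n0.
have E : (fun x : T => 0 * \1_(centered_cube 0) x) = fun=> 0 :> R.
  by apply/funext => x; rewrite mul0r.
rewrite E in X0 n0; split => //; last by rewrite n0.
by move=> x; rewrite lexx; have /andP[->] := f0M x.
Qed.

Let adm_mid a b t : 0 <= t <= 1 -> adm a -> adm b ->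
  adm (fun x => t * a x + (1 - t) * b x).
Proof.
move=> /andP[t0 t1] [ma a0 Xa na] [mb b0 Xb nb].
have [Xab nab] := nl_add nX (fl_scale fX t Xa) (fl_scale fX (1 - t) Xb).
split.
- by apply: measurable_funD; exact: measurable_funM.
- move=> x; have /andP[h1 h2] := a0 x; have /andP[h3 h4] := b0 x.
  by apply/andP; split; nra.
- exact: Xab.
- apply: (le_trans nab); rewrite (fl_normZ fX t Xa) (fl_normZ fX (1 - t) Xb).
  rewrite (ger0_norm t0) ger0_norm; last by lra.
  by nra.
Qed.

Let D := [set dist h | h in adm].

Let D_inf : has_inf D.
Proof.
split; first by exists (dist (fun=> 0)), (fun=> 0).
by exists 0 => _ [h _ <-]; apply: J0 => x; exact: sqr_ge0.
Qed.

(** The admissible functions form a convex set that is closed only in the sense of the Fatou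
    property. A minimising sequence is Cauchy in L^2 by the parallelogram law, and a pointwise limit
    is extracted to which that property applies. *)
Lemma exists_projection : exists h : T -> R, [/\ measurable_fun setT h,
  (forall x, 0 <= h x <= f x), X h, fnorm X h <= c &
  forall u : T -> R, measurable_fun setT u -> (forall x, 0 <= u x <= f x) -> X u ->
    fnorm X u <= c -> J (fun x => (f x - h x) ^+ 2) <= J (fun x => (f x - u x) ^+ 2)].
Proof.
(* With errors 4^(-k) the L^2 distances of successive terms are O(2^(-k)), hence summable, so the
   sequence itself converges almost everywhere on [Q]. *)
pose d := inf D; pose eps (k : nat) : R := 4^-1 ^+ k.
have eps0 k : 0 < eps k by rewrite exprn_gt0.
have dle h : adm h -> d <= dist h.
  by move=> ah; apply: ge_inf; [exact: D_inf.2|exists h].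
have /choice[h hP] : forall k, exists h, adm h /\ dist h < d + eps k.
  by move=> k; have [_ [h ah <-] hlt] := inf_adherent (eps0 k) D_inf; exists h.
have ah k : adm (h k) by have [] := hP k.
have bh k : bnd (h k) := badm (ah k).
have bsq k : bnd (fun x => (h k x - h k.+1 x) ^+ 2) by apply: bndX; exact: bndB.
have cauchy k : J (fun x => (h k x - h k.+1 x) ^+ 2) <= 4 * eps k.
  pose m x := 2^-1 * h k x + (1 - 2^-1) * h k.+1 x.
  have am : adm m by apply: adm_mid => //; lra.
  have E : (fun x => (f x - h k x) ^+ 2 + (f x - h k.+1 x) ^+ 2) =
     (fun x => 2 * (f x - m x) ^+ 2 + 2^-1 * (h k x - h k.+1 x) ^+ 2).
    by apply/funext => x; rewrite /m; field.
  have := JD (bdist (ah k)) (bdist (ah k.+1)).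
  rewrite E (JD (bndZ 2 (bdist am)) (bndZ 2^-1 (bsq k))).
  rewrite (JZ 2 (bdist am)) (JZ 2^-1 (bsq k)) -/(dist _) -/(dist _) -/(dist _).
  have [_ lt1] := hP k; have [_ lt2] := hP k.+1; have := dle _ am.
  have : eps k.+1 <= eps k.
    by rewrite /eps exprS ler_piMl ?exprn_ge0//; lra.
  by move=> *; lra.
pose w : R := fine (mu Q).
have w0 : 0 <= w by rewrite fine_ge0// measure_ge0.
pose a k x := `|h k x - h k.+1 x|.
have aE0 k x : (0 <= (a k x)%:E)%E by rewrite lee_fin normr_ge0.
have ba k : bnd (a k).
  have [m [N hN]] := bndB (bh k) (bh k.+1); split; last by exists N => x; rewrite normr_id.
  exact: (measurableT_comp (@normr_measurable R setT)).
have Ja k : J (a k) <= 2^-1 ^+ k * (w + 4).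
  (* The pointwise inequality b <= 2^(-k) + 2^k b^2, for b >= 0, turns the L^2 bound into an L^1
     bound. *)
  apply: (@le_trans _ _ (J (fun x => 2^-1 ^+ k + 2 ^+ k * (h k x - h k.+1 x) ^+ 2))).
    apply: (leJ (ba k) (bndD (bnd_cst _) (bndZ _ (bsq k)))) => x _; rewrite /a -(real_normK (num_real (h k x - _))).
    set b := `|_|; rewrite exprVn; have p0 : 0 < 2 ^+ k :> R by rewrite exprn_gt0.
    have [hb|hb] := leP b (2 ^+ k)^-1.
      by apply: (le_trans hb); rewrite lerDl mulr_ge0 ?sqr_ge0 ?exprn_ge0.
    rewrite -[leLHS]add0r lerD ?invr_ge0 ?exprn_ge0// expr2 mulrA ler_peMl /b ?normr_ge0//.
    by rewrite -ler_pdivrMl// mulr1 ltW.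
  rewrite (JD (bnd_cst _) (bndZ _ (bsq k))) (JZ _ (bsq k)).
  rewrite /J Rintegral_cst// -/w mulrDr lerD2l -/(J _).
  apply: (@le_trans _ _ (2 ^+ k * (4 * eps k))); first by rewrite ler_pM2l ?exprn_gt0.
  rewrite /eps mulrCA mulrC ler_pM2r// -exprMn.
  by have -> : 2 * 4^-1 = 2^-1 :> R by field.
have ma k : measurable_fun setT (fun x => (a k x)%:E).
  by apply/measurable_EFinP; have [] := ba k.
have Sfin : (\int[mu]_(x in Q) \sum_(k <oo) (a k x)%:E < +oo)%E.
  rewrite integral_nneseries; [|exact: mQ|by move=> k; exact/measurable_funTS/ma|].
  2: by move=> k x _; rewrite lee_fin; exact: normr_ge0.
  under eq_eseriesr => k _ do rewrite (JE (ba k)).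
  apply: (@le_lt_trans _ _ (\sum_(k <oo) ((w + 4) * 2^-1 ^+ k)%:E)%E).
    have Ja0 k : 0 <= J (a k) by apply: J0 => x; exact: normr_ge0.
    apply: lee_nneseries => [k _ _|k _]; rewrite lee_fin; first exact: Ja0.
    by rewrite mulrC; exact: Ja.
  have c2 : series (fun k => (w + 4) * 2^-1 ^+ k) @ \oo --> ((w + 4) / (1 - 2^-1) : R).
    by apply: cvg_geometric_series; rewrite gtr0_norm; lra.
  rewrite (_ : (\sum_(k <oo) _)%E = ((w + 4) / (1 - 2^-1))%:E) ?ltry//.
  apply/cvg_lim => //; rewrite (_ : (fun _ => _) = EFin \o series (fun k => (w + 4) * 2^-1 ^+ k)).
    by apply: cvg_EFin => //; exact: nearW.
  by apply/funext => N /=; rewrite sumEFin.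
have Scv : {ae mu, forall x, Q x -> exists l : R, (fun k => h k x) @ \oo --> l}.
  have intS : mu.-integrable Q (fun x => \sum_(k <oo) (a k x)%:E)%E.
    apply/integrableP; split.
      apply: ge0_emeasurable_sum => [k x _ _|k _]; first exact: aE0.
      exact/measurable_funTS/ma.
    rewrite (eq_integral (fun x => \sum_(k <oo) (a k x)%:E)%E); first exact: Sfin.
    by move=> x _; rewrite gee0_abs// nneseries_ge0.
  apply: filterS (integrable_ae mQ intS) => x hx Qx.
  have {}hx := hx Qx.
  have cs : cvgn (series (fun k => a k x)).
    apply: nondecreasing_is_cvgn.
      by apply/nondecreasing_seqP => k; rewrite seriesSr lerDl normr_ge0.
    exists (fine (\sum_(k <oo) (a k x)%:E)%E) => _ [N _ <-].
    rewrite -lee_fin fineK// (_ : series _ N = \sum_(0 <= k < N) a k x)// -sumEFin.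
    by apply: nneseries_lim_ge => k _ _; exact: aE0.
  have E : [normed series (telescope (fun k => h k x))] = series (fun k => a k x).
    apply/funext => N; rewrite /series /=; apply: eq_bigr => k _.
    by rewrite /telescope /a distrC.
  have /cvg_ex[l hl] : cvgn (series (telescope (fun k => h k x))).
    by apply: normed_cvg; rewrite E.
  exists (l + h 0%N x).
  rewrite (_ : (fun k => h k x) = (fun k => series (telescope (fun k => h k x)) k + h 0%N x)).
    by apply: cvgD => //; exact: cvg_cst.
  by apply/funext => k; rewrite telescopeK /= subrK.
pose hE k x := (h k x)%:E.
have mhE k : measurable_fun setT (hE k) by apply/measurable_EFinP; have [] := ah k.
(* The lower limit is defined everywhere and is the supremum of the increasing functions [G k], each
   below [hE k]; so [xnorm_fatou] bounds its norm. *)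
pose G k x := einfs (hE ^~ x) k.
have hE0 k x : (0 <= hE k x)%E by have [_ /(_ x)/andP[]] := ah k.
have hEf k x : (hE k x <= (f x)%:E)%E by have [_ /(_ x)/andP[]] := ah k.
have G0 k x : (0 <= G k x)%E by apply: le_ereal_inf_tmp => _ [m _ <-].
have Gh k x : (G k x <= hE k x)%E by apply: ereal_inf_lbound; exists k => //=.
have mG k : measurable_fun setT (G k) by exact: measurable_fun_einfs.
have GS k x : (G k x <= G k.+1 x)%E by apply: nondecreasing_einfs.
pose H x := ereal_sup (range (G ^~ x)).
have mH : measurable_fun setT H by exact: measurable_ereal_sup.
have H0 x : (0 <= H x)%E by apply: le_trans (G0 0%N x) _; apply: ereal_sup_ubound; exists 0%N.
have Hf x : (H x <= (f x)%:E)%E.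
  by apply: ge_ereal_sup => _ [k _ <-]; apply: le_trans (Gh _ _) (hEf _ _).
have Hfin x : H x \is a fin_num by rewrite ge0_fin_numE// (le_lt_trans (Hf x))// ltry.
have Hlim x : H x = limn_einf (hE ^~ x).
  rewrite limn_einf_lim; apply/esym/cvg_lim => //.
  by apply: ereal_nondecreasing_cvgn; exact: nondecreasing_einfs.
have Hc : (xnorm X H <= c%:E)%E.
  apply: (xnorm_fatou fX) => // k; apply: (@le_trans _ _ (xnorm X (hE k))).
    exact: le_xnorm.
  by rewrite xnorm_EFin; have [] := ah k.
have XH : xmem X H by apply/xnorm_ltyP; exact: le_lt_trans Hc (ltry _).
have aH : adm (fine \o H).
  split.
  - by apply: measurableT_comp => //; exact: fine_measurable.
  - by move=> x /=; rewrite fine_ge0//= -lee_fin fineK.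
  - by have [] := XH.
  - by rewrite -lee_fin -xnorm_mem.
exists (fine \o H); case: (aH) => ? ? ? ?; split; [by []..|move=> u mu_ u0 Xu nu].
apply: (@le_trans _ _ d); last by apply: dle; split.
rewrite -lee_fin -(JE (bdist aH)).
rewrite (_ : (\int[mu]_(x in Q) _)%E =
  (\int[mu]_(x in Q) limn_einf (fun k => ((f x - h k x) ^+ 2)%:E))%E); last first.
  apply: ge0_ae_eq_integral.
  - exact: mQ.
  - by apply/measurable_EFinP/measurable_funTS; have [] := bdist aH.
  - apply: measurable_funTS; under eq_fun do rewrite limn_einf_lim.
    apply: (emeasurable_fun_cvg (fun m x => einfs (fun k => ((f x - h k x) ^+ 2)%:E) m)).
      move=> m; apply: measurable_fun_einfs => k; apply/measurable_EFinP.
      by have [] := bdist (ah k).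
    by move=> x _; apply: is_cvg_einfs.
  - by move=> x _; rewrite lee_fin sqr_ge0.
  - move=> x _; rewrite limn_einf_lim; apply: lime_ge; first exact: is_cvg_einfs.
    by apply: nearW => k; apply: le_ereal_inf_tmp => _ [m _ <-]; rewrite lee_fin sqr_ge0.
  - apply: filterS Scv => x Scv Qx; have [l hl] := Scv Qx.
    have El : H x = l%:E.
      by rewrite Hlim (cvg_limn_einf_sup (_ : hE ^~ x @ \oo --> l%:E)).1//; apply: cvg_EFin => //; exact: nearW.
    rewrite /= El /=; apply/esym; apply: (cvg_limn_einf_sup _).1.
    apply: cvg_EFin; first exact: nearW.
    by under eq_fun do rewrite expr2; rewrite expr2; apply: cvgM; apply: cvgB => //; exact: cvg_cst.
apply: (le_trans (@fatou _ _ _ mu Q mQ (fun k x => ((f x - h k x) ^+ 2)%:E) _ _)).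
- by move=> k; apply/measurable_EFinP/measurable_funTS; have [] := bdist (ah k).
- by move=> k x _; rewrite lee_fin sqr_ge0.
have -> : d%:E = limn_einf (fun k => (d + eps k)%:E).
  apply/esym; apply: (cvg_limn_einf_sup _).1; apply: cvg_EFin; first exact: nearW.
  rewrite -[X in _ --> X]addr0; apply: cvgD; first exact: cvg_cst.
  by apply: cvg_expr; rewrite gtr0_norm; lra.
rewrite !limn_einf_lim; apply: lee_lim; [exact: is_cvg_einfs|exact: is_cvg_einfs|].
apply: nearW => m; apply: le_ereal_inf_tmp => _ [k mk <-].
apply: (@le_trans _ _ (\int[mu]_(x in Q) ((f x - h k x) ^+ 2)%:E)%E).
  by apply: ereal_inf_lbound; exists k.
by rewrite (JE (bdist (ah k))) lee_fin ltW//; have [] := hP k.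
Qed.

End projection.

Let J_supp u : bnd u -> (forall x, ~ Q x -> u x = 0) ->
  (\int[mu]_x (u x)%:E = (J u)%:E)%E.
Proof.
move=> bu u0; rewrite -(JE bu) [RHS]integral_mkcond; apply: eq_integral => x _.
by rewrite /patch; case: ifPn => // /negP; rewrite inE => /u0 ->.
Qed.

(* With [h] the nearest point to [f] in L^2 among the functions of norm at most
   [c] between 0 and [f], the difference [f - h] is a functional that separates
   [f] from that convex set. *)
Lemma duality_bounded (f : T -> R) (M c : R) : measurable_fun setT f ->
  (forall x, 0 <= f x <= M) -> (forall x, ~ Q x -> f x = 0) -> 0 < c ->
  (forall g : T -> R, measurable_fun setT g -> (forall x, 0 <= g x) ->
     (kothe_norm X g < +oo)%E ->
     (\int[mu]_x (f x * g x)%:E <= c%:E * kothe_norm X g)%E) ->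
  X f /\ fnorm X f <= c.
Proof.
move=> mf f0M fQ c0 Hg.
have [h [mh h0f Xh nh hmin]] := exists_projection mf f0M (ltW c0).
have bf : bnd f by split => //; exists M => x; have /andP[? ?] := f0M x; rewrite ger0_norm.
have bh : bnd h.
  split => //; exists M => x; have /andP[h1 h2] := h0f x; have /andP[_ h3] := f0M x.
  by rewrite ger0_norm// (le_trans h2).
pose g x := f x - h x.
have bg : bnd g := bndB bf bh.
have g0 x : 0 <= g x by rewrite subr_ge0; have /andP[] := h0f x.
have gQ x : ~ Q x -> g x = 0.
  move=> nQ; rewrite /g fQ//; have := h0f x; rewrite fQ// => /andP[h1 h2].
  have -> : h x = 0 by apply/le_anti; rewrite h1 h2.
  by rewrite subr0.
pose b := J (fun x => g x * h x).
have b0 : 0 <= b by apply: J0 => x; rewrite mulr_ge0//; have /andP[] := h0f x.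
have var (u : T -> R) N : measurable_fun setT u -> (forall x, 0 <= u x <= N) -> X u ->
    fnorm X u <= c -> J (fun x => g x * u x) <= b.
  move=> mu_ u0N Xu nu.
  have bu : bnd u by split => //; exists N => x; have /andP[? ?] := u0N x; rewrite ger0_norm.
  pose E := J (fun x => (u x - h x) ^+ 2).
  have E0 : 0 <= E by apply: J0 => x; exact: sqr_ge0.
  have step t : 0 < t -> t <= 1 -> J (fun x => g x * u x) <= b + t * E / 2.
    (* A step from [h] towards [u], cut off at [f] to stay admissible. Where the cut acts, [f - v]
       is zero, and the quadratic expansion remains an upper bound because it is a perfect
       square. *)
    move=> t0 t1; pose v x := Num.min (t * u x + (1 - t) * h x) (f x).
    have mm : measurable_fun setT (fun x => t * u x + (1 - t) * h x).
      by apply: measurable_funD; exact: measurable_funM.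
    have m0 x : 0 <= t * u x + (1 - t) * h x.
      by have /andP[? ?] := u0N x; have /andP[? ?] := h0f x; nra.
    have mv : measurable_fun setT v by apply: measurable_minr.
    have v0f x : 0 <= v x <= f x.
      by rewrite le_min m0 ge_min lexx orbT andbT; have /andP[->] := f0M x.
    have [Xm nm] := nl_add nX (fl_scale fX t Xu) (fl_scale fX (1 - t) Xh).
    have [Xv nv] : X v /\ fnorm X v <= fnorm X (fun x => t * u x + (1 - t) * h x).
      apply: (fl_ideal fX Xm mv); apply: aeW => x; rewrite !ger0_norm ?m0//.
        by rewrite ge_min lexx.
      by have /andP[] := v0f x.
    have nvc : fnorm X v <= c.
      apply: (le_trans nv); apply: (le_trans nm).
      rewrite (fl_normZ fX t Xu) (fl_normZ fX (1 - t) Xh) (gtr0_norm t0) ger0_norm ?subr_ge0//.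
      by nra.
    have bv : bnd v.
      split => //; exists M => x; have /andP[h1 h2] := v0f x; have /andP[_ h3] := f0M x.
      by rewrite ger0_norm// (le_trans h2).
    have := hmin v mv v0f Xv nvc => hv.
    have b1 := bndX (bndB bf bv); have b2 := bndZ (2 * t) (bndM bg bu).
    have b3 := bndX bg; have b4 := bndZ (2 * t) (bndM bg bh).
    have b5 := bndZ (t ^+ 2) (bndX (bndB bu bh)).
    have : J (fun x => (f x - v x) ^+ 2 + 2 * t * (g x * u x)) <=
        J (fun x => g x ^+ 2 + 2 * t * (g x * h x) + t ^+ 2 * (u x - h x) ^+ 2).
      apply: (leJ (bndD b1 b2) (bndD (bndD b3 b4) b5)) => x _; rewrite /g /v.
      rewrite /Num.min; case: ifPn => [_|]; last first.
        rewrite -leNgt subrr expr0n/= add0r => _.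
        have : 0 <= (f x - (t * u x + (1 - t) * h x)) ^+ 2 by exact: sqr_ge0.
        by nra.
      rewrite le_eqVlt; apply/orP; left; apply/eqP; ring.
    rewrite (JD b1 b2) (JD (bndD b3 b4) b5) (JD b3 b4).
    rewrite (JZ _ (bndM bg bu)) (JZ _ (bndM bg bh)) (JZ _ (bndX (bndB bu bh))).
    rewrite -/b -/E => ineq.
    have h2 : 2 * t * J (fun x => g x * u x) <= 2 * t * (b + t * E / 2).
      by move: ineq hv; rewrite /g; set A := J _; set B := J _; set D := J _; nra.
    by rewrite -(ler_pM2l (_ : 0 < 2 * t))// mulr_gt0.
  rewrite leNgt; apply/negP => hlt; pose d := J (fun x => g x * u x) - b.
  have d0 : 0 < d by rewrite subr_gt0.
  (* For this [t] the quadratic error t E / 2 is smaller than the supposed gap [d]. *)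
  pose t := Num.min 1 (d / (E + 1)).
  have E1 : 0 < E + 1 by lra.
  have t0 : 0 < t by rewrite lt_min ltr01 divr_gt0.
  have t1 : t <= 1 by rewrite ge_min lexx.
  have tE : t * (E + 1) <= d by rewrite -ler_pdivlMr// ge_min lexx orbT.
  have tE0 : 0 <= t * E by rewrite mulr_ge0// ltW.
  have := step t t0 t1; move: tE; rewrite /d mulrDr mulr1 => tE le3.
  by lra.
have mg : measurable_fun setT g by case: bg.
(* The variational inequality, applied to [c] times truncations of functions in the unit ball,
   bounds the dual norm of the residual [g] by [b / c]. *)
have kg : (kothe_norm X g <= (b / c)%:E)%E.
  apply: ge_ereal_sup => _ [u [Xu nu] <-].
  have mu_ := fl_measurable fX Xu.
  have mau : measurable_fun setT (fun x => `|u x|) by exact: (measurableT_comp (@normr_measurable R setT)).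
  pose F N x := (Num.min `|u x| N%:R * g x)%:E.
  have min0 N x : 0 <= Num.min `|u x| N%:R by rewrite le_min normr_ge0 ler0n.
  rewrite (eq_integral (fun x => ereal_sup (range (F ^~ x)))); last first.
    move=> x _; rewrite normrM (ger0_norm (g0 x)); apply/eqP; rewrite eq_le; apply/andP; split.
      apply: ereal_sup_ubound; exists (Num.truncn `|u x|).+1 => //.
      by rewrite /F min_l// ltW// truncnS_gt.
    apply: ge_ereal_sup => _ [N _ <-]; rewrite lee_fin ler_wpM2r//.
    by rewrite ge_min lexx.
  have mmin N : measurable_fun setT (fun x => Num.min `|u x| N%:R).
    by apply: measurable_minr.
  apply: le_integral_sup.
  - exact: measurableT.
  - by move=> N; apply/measurable_EFinP; apply: measurable_funM.
  - by move=> N x; rewrite lee_fin mulr_ge0.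
  - move=> N x; rewrite lee_fin ler_wpM2r// le_min !ge_min lexx/= ler_nat leqnSn.
    by rewrite orbT.
  move=> N; have bm : bnd (fun x => Num.min `|u x| N%:R).
    by split => //; exists N%:R => x; rewrite ger0_norm// ge_min lexx orbT.
  rewrite /F (J_supp (bndM bm bg)); last by move=> x /gQ ->; rewrite mulr0.
  rewrite lee_fin ler_pdivlMr// mulrC -(JZ _ (bndM bm bg)).
  have [Xm nm] : X (fun x => Num.min `|u x| N%:R) /\ fnorm X (fun x => Num.min `|u x| N%:R) <= fnorm X u.
    apply: (fl_ideal fX Xu) => //; apply: aeW => x.
    by rewrite ger0_norm// ge_min lexx.
  rewrite (_ : (fun x => c * _) = (fun x => g x * (c * Num.min `|u x| N%:R))); last first.
    by apply/funext => x; ring.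
  apply: (var _ (c * N%:R)).
  - by apply: measurable_funM.
  - by move=> x; rewrite mulr_ge0 ?(ltW c0)//= ler_pM2l// ge_min lexx orbT.
  - exact: fl_scale.
  - rewrite fl_normZ// gtr0_norm// -[leRHS]mulr1 ler_pM2l//.
    exact: le_trans nm nu.
have kfin : (kothe_norm X g < +oo)%E by exact: le_lt_trans kg (ltry _).
have bfg := bndM bf bg.
(* Tested with the residual, the hypothesis bounds the integral of g h + g^2 by [b], which is the
   integral of g h. Hence [g] vanishes almost everywhere. *)
have := Hg g mg g0 kfin; rewrite (J_supp bfg); last by move=> x /gQ ->; rewrite mulr0.
have -> : (fun x => f x * g x) = (fun x => g x * h x + g x ^+ 2).
  by apply/funext => x; rewrite /g; ring.
rewrite (JD (bndM bg bh) (bndX bg)) -/b => le1.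
have le2 : (c%:E * kothe_norm X g <= b%:E)%E by rewrite -lee_pdivlMl// mulrC in kg *.
have := le_trans le1 le2; rewrite lee_fin gerDl => Jg.
have Jg0 : J (fun x => g x ^+ 2) = 0.
  by apply/eqP; rewrite eq_le Jg J0// => x; exact: sqr_ge0.
have gae : {ae mu, forall x, g x = 0}.
  have : (\int[mu]_(x in Q) `|(g x ^+ 2)%:E| = 0)%E.
    under eq_integral => x _ do rewrite gee0_abs ?lee_fin ?sqr_ge0//.
    by rewrite (JE (bndX bg)) Jg0.
  move=> /(ae_eq_integral_abs mu mQ) H.
  have {}H := H _; apply: filterS (H _); last first.
    by apply/measurable_EFinP/measurable_funTS; case: (bndX bg).
  move=> x hx; have [Qx|/gQ//] := pselect (Q x).
  by have := hx Qx => -[] /eqP; rewrite sqrf_eq0 => /eqP.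
have [Xf nf] : X f /\ fnorm X f <= fnorm X h.
  apply: (fl_ideal fX Xh mf); apply: filterS gae => x /eqP; rewrite subr_eq0.
  by move=> /eqP ->.
by split => //; exact: le_trans nf nh.
Qed.

End fixed_cube.

(** [F k] cuts [H] off at height [k] and outside a centred cube. It falls under [duality_bounded],
    and the Fatou property passes to the limit. *)
Theorem lorentz_luxemburg (H : T -> \bar R) (c : R) : measurable_fun setT H ->
  (forall x, (0 <= H x)%E) -> 0 < c ->
  (forall g : T -> R, measurable_fun setT g -> (forall x, 0 <= g x) ->
     (kothe_norm X g < +oo)%E ->
     (\int[mu]_x (H x * (g x)%:E) <= c%:E * kothe_norm X g)%E) ->
  (xnorm X H <= c%:E)%E.
Proof.
move=> mH H0 c0 Hg.
pose F k x := fine (mine (H x) k%:R%:E) * \1_(centered_cube k) x.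
have Ffin k x : mine (H x) k%:R%:E \is a fin_num.
  rewrite ge0_fin_numE; first by rewrite gt_min ltry orbT.
  by rewrite le_min H0 lee_fin ler0n.
have m0 k x : (0 <= mine (H x) k%:R%:E)%E by rewrite le_min H0 lee_fin ler0n.
have F0 k x : 0 <= F k x.
  by rewrite mulr_ge0 ?indicE ?ler0n// fine_ge0.
have FH k x : ((F k x)%:E <= H x)%E.
  rewrite /F indicE; case: (x \in _); last by rewrite mulr0.
  by rewrite mulr1 fineK// ge_min lexx.
have mF k : measurable_fun setT (F k).
  apply: measurable_funM; last exact/measurable_indic/measurable_centered_cube.
  apply: measurableT_comp; first exact: fine_measurable.
  by apply: measurable_mine.
have FS k x : F k x <= F k.+1 x.
  apply: ler_pM; rewrite ?indicE ?ler0n ?fine_ge0//.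
    rewrite fine_le// le_min !ge_min lexx/= lee_fin ler_nat leqnSn.
    by rewrite orbT.
  rewrite ler_nat; case: (boolP (x \in centered_cube k)) => // /[!inE] xk.
  by rewrite mem_set//; apply: centered_cube_homo xk.
have FX k : X (F k) /\ fnorm X (F k) <= c.
  apply: (@duality_bounded k _ k%:R) => //.
  - move=> x; rewrite F0/= -lee_fin /F indicE; case: (x \in _); last by rewrite mulr0 lee_fin.
    by rewrite mulr1 fineK// ge_min lexx orbT.
  - by move=> x nQ; rewrite /F indicE memNset ?mulr0.
  - move=> g mg g0 kg; apply: le_trans (Hg g mg g0 kg); apply: ge0_le_integral.
    + exact: measurableT.
    + by move=> x _; rewrite lee_fin mulr_ge0.
    + by apply/measurable_EFinP; apply: measurable_funM.
    + exact: (emeasurable_funM mH (proj2 (measurable_EFinP _ _) mg)).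
    + by move=> x _; rewrite EFinM lee_wpmul2r// lee_fin.
rewrite (_ : H = fun x => ereal_sup (range (fun k => (F k x)%:E))); last first.
  apply/funext => x; apply/eqP; rewrite eq_le; apply/andP; split; last first.
    by apply: ge_ereal_sup => _ [k _ <-].
  have [m xm] := centered_cube_cover x.
  have Fk k : (m <= k)%N -> ((F k x)%:E = mine (H x) k%:R%:E)%E.
    move=> mk; rewrite /F indicE mem_set ?mulr1 ?fineK//.
    exact: centered_cube_homo xm.
  have S k : (mine (H x) k%:R%:E <= ereal_sup (range (fun k => (F k x)%:E)))%E.
    apply: (@le_trans _ _ (mine (H x) (maxn m k)%:R%:E)).
      by rewrite le_min !ge_min lexx/= lee_fin ler_nat leq_maxr orbT.
    by rewrite -Fk ?leq_maxl//; apply: ereal_sup_ubound; exists (maxn m k).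
  case E : (H x) => [a||]; last by have := H0 x; rewrite E.
    by have := S (Num.truncn a).+1; rewrite E min_l// lee_fin ltW// truncnS_gt.
  rewrite leye_eq; apply/eqP/eqyP => A A0; apply: le_trans (S (Num.truncn A).+1).
  by rewrite E min_r ?leey// lee_fin ltW// truncnS_gt.
apply: (xnorm_fatou fX).
- by move=> k; exact/measurable_EFinP.
- by move=> k x; rewrite lee_fin.
- by move=> k x; rewrite lee_fin.
- by move=> k; have [XF nF] := FX k; rewrite xnorm_EFin.
Qed.


End lorentz_luxemburg.

(** * Vector-valued maximal inequality *)

(** [tree_vector_valued] takes negative powers of stopped averages of [F]. All leaves share one
    root, so if the root average is not positive, [F] vanishes and with it every [h j]. *)
Lemma tree_vector_valued_root (R : realType) (I : finType) (w : I -> R)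
    (e : nat -> rel I) (J : finType) (h : J -> I -> R) (F g : I -> R) (s A : R) (L : nat) :
  (forall x, 0 < w x) -> (forall l, equivalence_rel (e l)) ->
  (forall l x y, e l.+1 x y -> e l x y) -> (forall x y, e 0%N x y) ->
  1 < s -> 1 <= A ->
  (forall l x, (l < L)%N -> cmass w e l x <= A * cmass w e l.+1 x) ->
  (forall x y, e L x y -> x = y) ->
  (forall j x, 0 <= h j x) -> (forall x, 0 <= F x) -> (forall x, 0 <= g x) ->
  (forall x, \sum_j h j x `^ s <= F x `^ s) ->
  \sum_x w x * ((\sum_j rmax w e (h j) L x `^ s) `^ s^-1 * g x) <=
  vv_const s A * \sum_x w x * (rmax w e F L x * rmax w e g L x).
Proof.
move=> w0 ee er e0 s1 A1 reg leafE h0 F0 g0 hF.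
have [pos|] := pselect (forall x, 0 < cavg w e 0 F x).
  exact: (tree_vector_valued w0 ee er s1 A1 reg leafE h0 F0 g0 hF pos).
move=> /existsNP[x0 /negP]; rewrite -leNgt => Fx0.
have s0 : s != 0 by rewrite gt_eqF// (lt_trans ltr01).
have Fz x : F x = 0.
  apply: (cavg_eq0 w0 ee (l := 0) F0); apply/eqP; rewrite eq_le cavg_ge0// andbT.
  by rewrite (cavg_inv w ee F (e0 x x0)).
have hz j x : h j x = 0.
  apply: (@powR_eq0_eq0 _ _ s); apply/eqP; rewrite eq_le powR_ge0 andbT.
  apply: le_trans (le_trans (hF x) _); last by rewrite Fz powR0.
  by rewrite (bigD1 j)//= lerDl sumr_ge0// => i _; exact: powR_ge0.
have rz j x : rmax w e (h j) L x = 0.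
  have cz l : cavg w e l (h j) x = 0.
    by rewrite /cavg big1 ?mul0r// => y _; rewrite hz mulr0.
  by elim: (L) => [|l IH] /=; rewrite ?IH !cz ?maxxx.
rewrite big1 => [|x _]; last first.
  rewrite big1 => [|j _]; last by rewrite rz powR0.
  by rewrite powR0 ?invr_eq0// mul0r mulr0.
rewrite mulr_ge0 ?vv_const_ge0//.
apply: sumr_ge0 => x _; rewrite !mulr_ge0 ?rmax_ge0//; exact: ltW.
Qed.

Section vector_valued_space.
Variables (R : realType) (n : nat).
Local Notation T := (Rn R n).
Local Notation mu := (@lebesgue_Rn R n).

Lemma average_minkowski (J : finType) (h : J -> T -> R) (F : T -> R) (s : R) (Q : set T) :
  1 < s -> cube Q -> (forall j, measurable_fun setT (h j)) -> locally_integrable F ->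
  (forall x, 0 <= F x) ->
  (forall x, \sum_j `|h j x| `^ s <= F x `^ s) ->
  \sum_j fine (average Q (fun y => `|h j y|)) `^ s <=
  fine (average Q (fun y => `|F y|)) `^ s.
Proof.
move=> s1 cQ mh [mF lF] F0 hF.
have s0 : 0 < s by exact: lt_trans ltr01 s1.
have hleF j x : `|h j x| <= F x.
  exact: (le_of_sum_powR (h := fun j => `|h j x|) j s1 (F0 x) (fun i => normr_ge0 _) (hF x)).
have lh j : locally_integrable (h j).
  apply: (@locally_integrable_le _ _ _ F) => // x; rewrite (ger0_norm (F0 x)); exact: hleF.
have [v v0 E] := cube_mu cQ.
have avgE f : locally_integrable f -> exists2 a : R, 0 <= a &
    average Q (fun y => `|f y|) = a%:E /\ (\int[mu]_(x in Q) `|f x|%:E = (v * a)%:E)%E.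
  move=> [mf lf]; have ifin : (\int[mu]_(x in Q) `|f x|%:E)%E \is a fin_num.
    by rewrite ge0_fin_numE ?lf// integral_ge0// => x _; rewrite lee_fin.
  exists (v^-1 * fine (\int[mu]_(x in Q) `|f x|%:E)%E).
    apply: mulr_ge0; first by rewrite invr_ge0 ltW.
    by apply: fine_ge0; apply: integral_ge0 => x _; rewrite lee_fin.
  rewrite /average E /= EFinM fineK//; split=> //.
  by rewrite mulrA divff ?gt_eqF// mul1r fineK.
have /choice[a ha] : forall j, exists a : R, [/\ 0 <= a, average Q (fun y => `|h j y|) = a%:E &
    (\int[mu]_(x in Q) `|h j x|%:E = (v * a)%:E)%E].
  by move=> j; have [a a0 [? ?]] := avgE _ (lh j); exists a.
have [b b0 [bE bI]] := avgE F (conj mF lF).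
rewrite bE /=; under eq_bigr => j _ do (have [_ -> _] := ha j).
have a0 j : 0 <= a j by have [] := ha j.
rewrite /=.
apply: (minkowski_of_dual (h := fun j x => `|h j x|) s1 _ F0 hF a0 b0) => [j x //|c d c0 d0 H].
have : (\int[mu]_(x in Q) (\sum_j (c j)%:E * `|h j x|%:E) <=
    \int[mu]_(x in Q) (d%:E * `|F x|%:E))%E.
  apply: ge0_le_integral.
  - exact: cube_measurable.
  - by move=> x _; apply: sume_ge0 => j _; rewrite mule_ge0 ?lee_fin.
  - apply: emeasurable_sum => j; apply: measurable_funTS.
    exact: (emeasurable_funM (@measurable_cst _ _ _ _ _ _) (measurable_absE (mh j))).
  - apply: measurable_funTS.
    exact: (emeasurable_funM (@measurable_cst _ _ _ _ _ _) (measurable_absE mF)).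
  - move=> x _; under eq_bigr => j _ do rewrite -EFinM mulrC.
    by rewrite sumEFin -EFinM lee_fin (ger0_norm (F0 x)) mulrC.
rewrite ge0_integral_sum; last 3 first.
- exact: cube_measurable.
- move=> j; apply: measurable_funTS.
  exact: (emeasurable_funM (@measurable_cst _ _ _ _ _ _) (measurable_absE (mh j))).
- by move=> j x _; rewrite mule_ge0 ?lee_fin.
have ZZ (k : R) (f : T -> R) : 0 <= k -> measurable_fun setT f ->
    (\int[mu]_(x in Q) (k%:E * `|f x|%:E) = k%:E * \int[mu]_(x in Q) `|f x|%:E)%E.
  move=> k0 mf; apply: ge0_integralZl_EFin.
  - exact: cube_measurable.
  - by move=> x _; rewrite lee_fin.
  - exact/measurable_funTS/measurable_absE.
  - exact: k0.
rewrite ZZ// bI; under eq_bigr => j _ do (rewrite ZZ//; have [_ _ ->] := ha j).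
under eq_bigr => j _ do rewrite -EFinM.
rewrite sumEFin -EFinM lee_fin.
have -> : d * (v * b) = v * (b * d) by ring.
rewrite (_ : \sum_j c j * (v * a j) = v * \sum_j a j * c j); last first.
  by rewrite mulr_sumr; apply: eq_bigr => j _; ring.
by rewrite ler_pM2l.
Qed.

Lemma integral_leaves eps K (c : leaf_index R eps K -> R) (u : T -> R) :
  (forall b, 0 <= c b) -> measurable_fun setT u -> (forall x, 0 <= u x) ->
  (\int[mu]_x ((\sum_b \1_(leaf b) x * c b) * u x)%:E =
   \sum_b ((c b)%:E * \int[mu]_(x in leaf b) (u x)%:E))%E.
Proof.
move=> c0 mu_ u0.
have muE : measurable_fun setT (fun x => (u x)%:E) by exact/measurable_EFinP.
have mi (b : leaf_index R eps K) : measurable_fun setT (\1_(leaf b) : T -> R).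
  by apply: measurable_indic; exact: leaf_measurable.
have E x : (((\sum_b \1_(leaf b) x * c b) * u x)%:E =
    \sum_b ((c b)%:E * (\1_(leaf b) x * u x)%:E))%E.
  under [in RHS]eq_bigr do rewrite -EFinM.
  by rewrite sumEFin mulr_suml; congr (_%:E); apply: eq_bigr => b _; ring.
under eq_integral => x _ do rewrite E.
have m1 (b : leaf_index R eps K) : measurable_fun setT (fun x => (\1_(leaf b) x * u x)%:E).
  by apply/measurable_EFinP; apply: measurable_funM.
have p1 (b : leaf_index R eps K) x : (0 <= (\1_(leaf b) x * u x)%:E)%E by rewrite lee_fin mulr_ge0 ?indicE ?ler0n.
rewrite ge0_integral_sum; last 3 first.
- exact: measurableT.
- by move=> b; exact: (emeasurable_funM (@measurable_cst _ _ _ _ _ _) (m1 b)).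
- by move=> b x _; apply: mule_ge0; [rewrite lee_fin|exact: p1].
apply: eq_bigr => b _; rewrite ge0_integralZl_EFin; [|exact: measurableT|by move=> x _; exact: p1|exact: m1|exact: c0].
congr (_ * _)%E; rewrite [RHS]integral_mkcond; apply: eq_integral => x _.
by rewrite /patch indicE; case: (x \in leaf b); rewrite ?mul1r ?mul0r.
Qed.

Lemma tree_vector_valued_space eps K (J : finType) (h : J -> T -> R) (F g : T -> R) (s : R) :
  1 < s -> (forall j, measurable_fun setT (h j)) -> locally_integrable F ->
  (forall x, 0 <= F x) -> (forall x, \sum_j `|h j x| `^ s <= F x `^ s) ->
  locally_integrable g -> (forall x, 0 <= g x) ->
  (\int[mu]_x ((\sum_j tree_max eps K (h j) x `^ s) `^ s^-1 * g x)%:E <=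
   (vv_const s (2 ^+ n.+1))%:E * \int[mu]_x (maximal F x * maximal g x))%E.
Proof.
move=> s1 mh lF F0 hF lg g0.
have s0 : s != 0 by rewrite gt_eqF// (lt_trans ltr01).
set w := @leaf_mass R n eps K; set e := @same R n eps K.
pose hh j := leaf_avg (eps := eps) (K := K) (h j).
pose FF := leaf_avg (eps := eps) (K := K) F; pose gg := leaf_avg (eps := eps) (K := K) g.
pose L := (2 * K)%N.
pose P b := (\sum_j rmax w e (hh j) L b `^ s) `^ s^-1.
have [mg lgQ] := lg; have [mF lFQ] := lF.
have LE x : (\sum_j tree_max eps K (h j) x `^ s) `^ s^-1 = \sum_b \1_(leaf b) x * P b.
  have [/leaf_exists[b bx]|tx] := pselect (top eps K x).
    rewrite [RHS](bigD1 b)//= indicE mem_set// mul1r [X in _ + X]big1 ?addr0.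
      by rewrite /P; congr (_ `^ _); apply: eq_bigr => j _; rewrite (tree_max_leaf _ bx).
    move=> b' b'b; rewrite indicE memNset ?mul0r// => b'x.
    by move/eqP: b'b; apply; exact: leaf_inj b'x bx.
  rewrite big1 => [|j _]; last by rewrite (tree_max_top _ tx) powR0.
  rewrite powR0 ?invr_eq0// big1// => b _.
  by rewrite indicE memNset ?mul0r// => /leaf_top.
under eq_integral => x _ do rewrite LE.
have P0 b : 0 <= P b by exact: powR_ge0.
rewrite (integral_leaves P0 mg g0).
have gleaf (b : leaf_index R eps K) : (\int[mu]_(x in leaf b) (g x)%:E = (w b * gg b)%:E)%E.
  under eq_integral => x _ do rewrite -(ger0_norm (g0 x)).
  rewrite (integral_average (lgQ _ (@top_cube R n eps K)) (leaf_cube b) (@leaf_top _ _ _ _ b)).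
  by rewrite leaf_mu.
under eq_bigr => b _ do rewrite gleaf -EFinM.
rewrite sumEFin.
(* Here [A] is 2^(n+1), the ratio of the volumes of a grid cube and of its children. *)
have tree : \sum_b w b * (P b * gg b) <= vv_const s (2 ^+ n.+1) *
    \sum_b w b * (rmax w e FF L b * rmax w e gg L b).
  apply: tree_vector_valued_root => //.
  - exact: leaf_mass_gt0.
  - exact: same_equiv.
  - exact: same_refine.
  - exact: same_root.
  - by rewrite -natrX ler1n expn_gt0.
  - by move=> l b lL; exact: cmass_regular.
  - exact: same_leaf.
  - by move=> j b; exact: leaf_avg_ge0.
  - by move=> b; exact: leaf_avg_ge0.
  - by move=> b; exact: leaf_avg_ge0.
  - by move=> b; apply: average_minkowski => //; exact: leaf_cube.
have vv0 : 0 <= vv_const s (2 ^+ n.+1 : R) by exact: vv_const_ge0.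
apply: (@le_trans _ _ (vv_const s (2 ^+ n.+1) *
    \sum_b w b * (rmax w e FF L b * rmax w e gg L b))%:E).
  by rewrite lee_fin (le_trans _ tree)// le_eqVlt; apply/orP; left; apply/eqP;
    apply: eq_bigr => b _; ring.
rewrite EFinM lee_wpmul2l ?lee_fin//.
have r0 f b : 0 <= rmax w e (leaf_avg (eps := eps) (K := K) f) L b.
  by apply: rmax_ge0; [exact: leaf_mass_gt0|exact: same_equiv|exact: leaf_avg_ge0].
have -> : ((\sum_b w b * (rmax w e FF L b * rmax w e gg L b))%:E =
    \int[mu]_x (tree_max eps K F x * tree_max eps K g x)%:E)%E.
  have E x : tree_max eps K F x * tree_max eps K g x =
      (\sum_b \1_(leaf b) x * (rmax w e FF L b * rmax w e gg L b)) * 1.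
    rewrite mulr1; have [/leaf_exists[b bx]|tx] := pselect (top eps K x).
      rewrite (tree_max_leaf _ bx) (tree_max_leaf _ bx) [RHS](bigD1 b)//=.
      rewrite indicE mem_set// mul1r big1 ?addr0// => b' b'b.
      rewrite indicE memNset ?mul0r// => b'x.
      by move/eqP: b'b; apply; exact: leaf_inj b'x bx.
    rewrite (tree_max_top _ tx) mul0r big1// => b _.
    by rewrite indicE memNset ?mul0r// => /leaf_top.
  under eq_integral => x _ do rewrite E.
  rewrite (@integral_leaves eps K (fun b => rmax w e FF L b * rmax w e gg L b) (fun=> 1)) //; last first.
    by move=> b; rewrite mulr_ge0 ?r0.
  rewrite -sumEFin; apply: eq_bigr => b _; rewrite integral_cst; last exact: leaf_measurable.
  by rewrite mul1e (_ : _ (leaf b) = (w b)%:E) ?[LHS]leaf_mu -?EFinM 1?mulrC//; exact: leaf_mu.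
have mt f : measurable_fun setT (fun x => (tree_max eps K f x)%:E).
  by apply/measurable_EFinP; exact: measurable_tree_max.
apply: ge0_le_integral.
- exact: measurableT.
- by move=> x _; rewrite lee_fin mulr_ge0 ?tree_max_ge0.
- by under eq_fun => x do rewrite EFinM; apply: emeasurable_funM; exact: mt.
- by apply: emeasurable_funM; exact: measurable_maximal.
- move=> x _; rewrite EFinM; apply: lee_pmul; rewrite ?lee_fin ?tree_max_ge0//.
    by apply: tree_max_le_maximal => //; exact: lFQ (@top_cube R n eps K).
  by apply: tree_max_le_maximal => //; exact: lgQ (@top_cube R n eps K).
Qed.

End vector_valued_space.

Section power_sums.
Variables (R : realType).
Implicit Types (J : finType) (s : R).

Lemma le_sum_powR J s (c : J -> R) j : 0 < s -> (forall i, 0 <= c i) ->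
  c j <= (\sum_i c i `^ s) `^ s^-1.
Proof.
move=> s0 c0; rewrite -[leLHS](powRK s0)//; apply: le_powR; rewrite ?invr_gt0 ?powR_ge0//.
by rewrite (bigD1 j)//= lerDl sumr_ge0// => i _; exact: powR_ge0.
Qed.

(** A crude bound: each summand over [I] is at most an [s]-norm over [I]. Only the independence of
    [J] matters, as [I] will be the set of grids. *)
Lemma powR_sum_swap (J I : finType) s (t : I -> J -> R) : 0 < s ->
  (forall i j, 0 <= t i j) ->
  (\sum_j (\sum_i t i j) `^ s) `^ s^-1 <=
  #|I|%:R * #|I|%:R `^ s^-1 * \sum_i (\sum_j t i j `^ s) `^ s^-1.
Proof.
move=> s0 t0; have si0 : 0 < s^-1 by rewrite invr_gt0.
pose S i := \sum_j t i j `^ s; pose U := \sum_i (S i) `^ s^-1.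
have S0 i : 0 <= S i by apply: sumr_ge0 => j _; exact: powR_ge0.
have SU i : S i <= U `^ s.
  rewrite -[leLHS](powRVK s0)//; apply: le_powR; rewrite ?powR_ge0//.
  by rewrite /U (bigD1 i)//= lerDl sumr_ge0// => k _; exact: powR_ge0.
have U0 : 0 <= U by apply: sumr_ge0 => i _; exact: powR_ge0.
have inner j : (\sum_i t i j) `^ s <= #|I|%:R `^ s * \sum_i t i j `^ s.
  have T0 : 0 <= \sum_i t i j `^ s by apply: sumr_ge0 => i _; exact: powR_ge0.
  rewrite -[X in _ <= _ * X](powRVK s0 T0) -powRM ?ler0n ?powR_ge0//.
  apply: le_powR => //; first exact: sumr_ge0.
  apply: (@le_trans _ _ (\sum_(i : I) (\sum_i t i j `^ s) `^ s^-1)).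
    by apply: ler_sum => i _; exact: (le_sum_powR (c := t ^~ j)).
  by rewrite sumr_const mulr_natl.
have step : \sum_j (\sum_i t i j) `^ s <= (#|I|%:R * #|I|%:R `^ s^-1 * U) `^ s.
  rewrite powRM ?mulr_ge0 ?ler0n ?powR_ge0// powRM ?ler0n ?powR_ge0// powRVK ?ler0n//.
  apply: (@le_trans _ _ (#|I|%:R `^ s * \sum_i S i)).
    by rewrite /S exchange_big mulr_sumr; apply: ler_sum => j _; exact: inner.
  rewrite -mulrA ler_wpM2l ?powR_ge0//.
  by apply: le_trans (ler_sum _ (fun i _ => SU i)) _; rewrite sumr_const mulr_natl.
rewrite -[leRHS](powRK s0) ?mulr_ge0 ?powR_ge0 ?ler0n//.
apply: le_powR => //; apply: sumr_ge0 => j _; exact: powR_ge0.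
Qed.

End power_sums.

Section vector_valued_bound.
Variables (R : realType) (n : nat).
Local Notation T := (Rn R n).
Local Notation mu := (@lebesgue_Rn R n).
Variable X : fspace R n.
Hypothesis nX : normed_lattice X.
Let fX : function_lattice X := nX.

Lemma lorentz_luxemburg_ge0 (H : T -> \bar R) (c : R) : measurable_fun setT H ->
  (forall x, (0 <= H x)%E) -> 0 <= c ->
  (forall g : T -> R, measurable_fun setT g -> (forall x, 0 <= g x) ->
     (kothe_norm X g < +oo)%E ->
     (\int[mu]_x (H x * (g x)%:E) <= c%:E * kothe_norm X g)%E) ->
  (xnorm X H <= c%:E)%E.
Proof.
move=> mH H0 c0 Hg; apply/lee_addgt0Pr => e e0; rewrite -EFinD.
apply: (lorentz_luxemburg nX) => //; first by rewrite ltr_wpDl.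
move=> g mg g0 gX; apply: le_trans (Hg g mg g0 gX) _.
by apply: lee_wpmul2r; [exact: kothe_norm_ge0|rewrite lee_fin lerDl ltW].
Qed.

(** A finite norm makes the maximal function finite almost everywhere, hence at some point, and one
    point is enough. *)
Lemma locally_integrable_xnorm (Z : fspace R n) (h : T -> R) : measurable_fun setT h ->
  (xnorm Z (maximal h) < +oo)%E -> locally_integrable h.
Proof.
move=> mh /xnorm_fin_ae hfin; have [x fx] := ae_point hfin.
apply: (locally_integrable_maximal (x := x)) => //.
by rewrite -ge0_fin_numE//; exact: maximal_ge0.
Qed.

Variables (C1 C2 : R).
Hypothesis bX : forall f, X f -> (xnorm X (maximal f) <= (C1 * fnorm X f)%:E)%E.
Hypothesis bX' : forall g, kothe_associate X g ->
  (xnorm (kothe_associate X) (maximal g) <= (C2 * fnorm (kothe_associate X) g)%:E)%E.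

(** Hoelder's inequality for the two maximal functions. The absolute values appear because the
    constants of a bounded operator come without a sign. *)
Lemma integral_maximal_mul (F g : T -> R) : X F -> measurable_fun setT g ->
  (kothe_norm X g < +oo)%E ->
  (\int[mu]_x (maximal F x * maximal g x) <=
   (`|C1| * `|C2| * fnorm X F)%:E * kothe_norm X g)%E.
Proof.
move=> XF mg gX; have Xg : kothe_associate X g by [].
have MF : (xnorm X (maximal F) <= (`|C1| * fnorm X F)%:E)%E.
  by apply: le_trans (bX XF) _; rewrite lee_fin ler_wpM2r ?(fl_ge0 fX)// ler_norm.
have MFy := le_lt_trans MF (ltry _).
have mF := fl_measurable fX XF.
have := bX' Xg; set g' := fine \o maximal g.
move=> Mg; have Mgy := le_lt_trans Mg (ltry _).
have [gfin [mg' g'X]] := (xnorm_ltyP _ _).1 Mgy.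
have g'0 x : 0 <= g' x by apply: fine_ge0; exact: maximal_ge0.
have gE : kothe_norm X g \is a fin_num by rewrite ge0_fin_numE ?kothe_norm_ge0.
have g'n : (kothe_norm X g' <= `|C2|%:E * kothe_norm X g)%E.
  move: Mg; rewrite xnorm_mem//= lee_fin -/g' => h.
  rewrite -(fineK gE) -(@fineK _ (kothe_norm X g')) ?ge0_fin_numE ?kothe_norm_ge0//.
  rewrite -EFinM lee_fin (le_trans h)// ler_wpM2r ?ler_norm// fine_ge0//.
  exact: kothe_norm_ge0.
have mM := measurable_maximal mF.
have M0 x : (0 <= maximal F x)%E by exact: maximal_ge0.
apply: (@le_trans _ _ (\int[mu]_x (maximal F x * `|g' x|%:E))%E).
  rewrite le_eqVlt; apply/orP; left; apply/eqP; apply: ae_eq_integral.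
  - exact: measurableT.
  - by apply: emeasurable_funM; [exact: mM|exact: measurable_maximal].
  - by apply: emeasurable_funM; [exact: mM|exact: measurable_absE].
  - by apply: filterS gfin => x fx _; rewrite ger0_norm// /g' /= fineK.
apply: (le_trans (kothe_hoelder fX mM M0 MFy mg')).
apply: (@le_trans _ _ ((`|C2|%:E * kothe_norm X g) * (`|C1| * fnorm X F)%:E)%E).
  apply: lee_pmul; [exact: kothe_norm_ge0|exact: xnorm_ge0|exact: g'n|exact: MF].
by rewrite -(fineK gE) -!EFinM lee_fin; rewrite le_eqVlt; apply/orP; left; apply/eqP; ring.
Qed.

Lemma xnorm_tree_vector eps K (J : finType) (h : J -> T -> R) (F : T -> R) (s : R) :
  1 < s -> (forall j, measurable_fun setT (h j)) -> X F ->
  (forall x, 0 <= F x) -> (forall x, \sum_j `|h j x| `^ s <= F x `^ s) ->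
  (xnorm X (fun x => ((\sum_j tree_max eps K (h j) x `^ s) `^ s^-1)%:E) <=
   (vv_const s (2 ^+ n.+1) * (`|C1| * `|C2| * fnorm X F))%:E)%E.
Proof.
move=> s1 mh XF F0 hF; have mF := fl_measurable fX XF.
have lF : locally_integrable F.
  by apply: (locally_integrable_xnorm (Z := X) mF); apply: le_lt_trans (bX XF) (ltry _).
have vv0 : 0 <= vv_const s (2 ^+ n.+1 : R) by exact: vv_const_ge0.
apply: lorentz_luxemburg_ge0.
- apply/measurable_EFinP; apply: (measurableT_comp (measurable_powR _)).
  by apply: measurable_sum => j; apply: (measurableT_comp (measurable_powR _));
    exact: measurable_tree_max.
- by move=> x; rewrite lee_fin powR_ge0.
- by rewrite mulr_ge0// mulr_ge0 ?(fl_ge0 fX)// mulr_ge0.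
move=> g mg g0 gX.
have lg : locally_integrable g.
  apply: (locally_integrable_xnorm (Z := kothe_associate X) mg).
  by apply: le_lt_trans (bX' _) (ltry _).
under eq_integral => x _ do rewrite -EFinM.
apply: (le_trans (tree_vector_valued_space eps K s1 mh lF F0 hF lg g0)).
rewrite [X in (_ <= X * _)%E]EFinM -muleA lee_wpmul2l ?lee_fin//.
exact: integral_maximal_mul.
Qed.

End vector_valued_bound.

Section vector_valued_maximal.
Variables (R : realType) (n : nat).
Local Notation T := (Rn R n).
Local Notation mu := (@lebesgue_Rn R n).

(** The suprema for different [j] are approached at different [k]. Monotonicity in [k] turns them
    into simultaneous limits, so the finite sum of powers passes to the limit. *)
Lemma poweR_sum_sup (J : finType) (m : J -> \bar R) (a : nat -> J -> R) (s : R) : 0 < s ->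
  (forall k j, 0 <= a k j) -> (forall k j, a k j <= a k.+1 j) -> (forall j, (0 <= m j)%E) ->
  (forall j, (m j <= ereal_sup (range (fun k => (a k j)%:E)))%E) ->
  ((\sum_j m j `^ s) `^ s^-1 <=
   ereal_sup (range (fun k => ((\sum_j a k j `^ s) `^ s^-1)%:E)))%E.
Proof.
move=> s0 a0 aS m0 hm; set S := ereal_sup (range (fun k => ((\sum_j _) `^ _)%:E)).
have [->|Sy] := eqVneq S +oo%E; first exact: leey.
have S0 : (0 <= S)%E.
  by apply: le_trans (ereal_sup_ubound _); last (by exists 0%N); rewrite lee_fin powR_ge0.
have Sfin : S \is a fin_num by rewrite ge0_fin_numE// ltey.
move: (erefl S); rewrite -{2}(fineK Sfin); move: (fine S) (fine_ge0 S0) => sg sg0 SE.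
have aS' k : (\sum_j a k j `^ s) `^ s^-1 <= sg.
  by rewrite -lee_fin -SE; apply: ereal_sup_ubound; exists k.
have asg k j : a k j <= sg by apply: le_trans (aS' k); exact: le_sum_powR.
have nda j : nondecreasing_seq (a ^~ j) by apply/nondecreasing_seqP => k; exact: aS.
pose l j := sup (range (a ^~ j)).
have cl j : a ^~ j @ \oo --> l j.
  by apply: nondecreasing_cvgn => //; exists sg => _ [k _ <-].
have al k j : a k j <= l j.
  by apply: sup_upper_bound; [split; [by exists (a 0%N j), 0%N|by exists sg => _ [i _ <-]]|exists k].
have l0 j : 0 <= l j by apply: le_trans (al 0%N j).
have ml j : (m j <= (l j)%:E)%E.
  by apply: (le_trans (hm j)); apply: ge_ereal_sup => _ [k _ <-]; rewrite lee_fin.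
have suml : \sum_j l j `^ s <= sg `^ s.
  have c : (fun k => \sum_j a k j `^ s) @ \oo --> \sum_j l j `^ s.
    apply: cvg_big => [|j _]; first exact: add_continuous.
    apply: (cvg_powR_nondecreasing s0 _ _ (cl j)) => k //.
  rewrite -(cvg_lim (@Rhausdorff R) c); apply: limr_le; first by apply/cvg_ex; eexists; exact: c.
  apply: nearW => k; rewrite -[leLHS](powRVK s0); last by apply: sumr_ge0 => j _; exact: powR_ge0.
  by apply: le_powR; rewrite ?powR_ge0.
rewrite SE.
have mfin j : m j \is a fin_num by rewrite ge0_fin_numE//; exact: le_lt_trans (ml j) (ltry _).
have -> : (\sum_j m j `^ s = (\sum_j (fine (m j)) `^ s)%:E)%E.
  rewrite -sumEFin; apply: eq_bigr => j _; by rewrite -{1}(fineK (mfin j)) poweR_EFin.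
rewrite poweR_EFin lee_fin -[leRHS](powRK s0)//; apply: le_powR; rewrite ?invr_gt0//.
  by apply: sumr_ge0 => j _; exact: powR_ge0.
apply: le_trans suml; apply: ler_sum => j _; apply: le_powR => //; first exact: fine_ge0.
by rewrite -lee_fin fineK.
Qed.

Variable X : fspace R n.
Hypothesis nX : normed_lattice X.
Let fX : function_lattice X := nX.
Variables (C1 C2 : R).
Hypothesis bX : forall f, X f -> (xnorm X (maximal f) <= (C1 * fnorm X f)%:E)%E.
Hypothesis bX' : forall g, kothe_associate X g ->
  (xnorm (kothe_associate X) (maximal g) <= (C2 * fnorm (kothe_associate X) g)%:E)%E.

(** 6^(n+1) comes from [maximal_le_grid], the next two factors from exchanging the sum over the
    grids with the [s]-norm, and a further 2^(n+1) from adding the norms of the grids. The rest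
    bounds a single tree. *)
Definition fefferman_stein_const (s : R) : R :=
  6 ^+ n.+1 * ((2 ^ n.+1)%:R * (2 ^ n.+1)%:R `^ s^-1 *
    ((2 ^ n.+1)%:R * (vv_const s (2 ^+ n.+1) * (`|C1| * `|C2|)))).

Theorem fefferman_stein (J : finType) (h : J -> T -> R) (s : R) :
  1 < s -> (forall j, measurable_fun setT (h j)) ->
  let F := fun x => (\sum_j `|h j x| `^ s) `^ s^-1 in X F ->
  (xnorm X (fun x => (\sum_j maximal (h j) x `^ s) `^ s^-1) <=
   (fefferman_stein_const s * fnorm X F)%:E)%E.
Proof.
move=> s1 mh F XF; have s0 : 0 < s := lt_trans ltr01 s1.
have F0 x : 0 <= F x by exact: powR_ge0.
have mF := fl_measurable fX XF.
have hF x : \sum_j `|h j x| `^ s <= F x `^ s.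
  by rewrite /F powRVK//; apply: sumr_ge0 => j _; exact: powR_ge0.
have lF : locally_integrable F.
  by apply: (locally_integrable_xnorm (Z := X) mF); apply: le_lt_trans (bX XF) (ltry _).
have lh j : locally_integrable (h j).
  apply: (locally_integrable_le (mh j) lF) => x; rewrite (ger0_norm (F0 x)).
  exact: (le_sum_powR (c := fun j => `|h j x|)).
pose a K x j := 6 ^+ n.+1 * grid_max K (h j) x.
have a0 K x j : 0 <= a K x j by rewrite mulr_ge0 ?exprn_ge0 ?grid_max_ge0.
have aS K x j : a K x j <= a K.+1 x j.
  by rewrite ler_pM2l ?exprn_gt0//; exact: grid_max_homo.
pose G K x := ((\sum_j a K x j `^ s) `^ s^-1)%:E.
have mG K : measurable_fun setT (G K).
  apply/measurable_EFinP; apply: (measurableT_comp (measurable_powR _)).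
  apply: measurable_sum => j; apply: (measurableT_comp (measurable_powR _)).
  by apply: measurable_funM; [exact: measurable_cst|exact: measurable_grid_max].
apply: (@le_trans _ _ (xnorm X (fun x => ereal_sup (range (G ^~ x))))).
  apply: (le_xnorm fX).
  - apply: (measurableT_comp (measurable_poweR _)); apply: emeasurable_sum => j.
    by apply: (measurableT_comp (measurable_poweR _)); exact: measurable_maximal.
  - by move=> x; exact: poweR_ge0.
  - move=> x; apply: (@poweR_sum_sup J _ (a ^~ x)) => // [j|j]; first exact: maximal_ge0.
    exact: maximal_le_grid.
apply: (xnorm_fatou fX mG) => [K x|K x|K].
- by rewrite lee_fin powR_ge0.
- rewrite lee_fin; apply: le_powR; rewrite ?invr_gt0//.
    by apply: sumr_ge0 => j _; exact: powR_ge0.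
  by apply: ler_sum => j _; exact: le_powR.
pose t x (eps : {ffun 'I_n.+1 -> bool}) j := tree_max eps K (h j) x.
have t0 x eps j : 0 <= t x eps j by exact: tree_max_ge0.
pose U eps x := ((\sum_j t x eps j `^ s) `^ s^-1)%:E.
pose c2 : R := (2 ^ n.+1)%:R * (2 ^ n.+1)%:R `^ s^-1.
have c20 : 0 < c2 by rewrite mulr_gt0 ?powR_gt0 ?ltr0n ?expn_gt0.
have mU eps : measurable_fun setT (U eps).
  apply/measurable_EFinP; apply: (measurableT_comp (measurable_powR _)).
  apply: measurable_sum => j; apply: (measurableT_comp (measurable_powR _)).
  exact: measurable_tree_max.
have U0 eps x : (0 <= U eps x)%E by rewrite lee_fin powR_ge0.
have mS : measurable_fun setT (fun x => \sum_eps U eps x)%E.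
  by apply: emeasurable_sum => eps; exact: mU.
apply: (@le_trans _ _ (xnorm X (fun x => (6 ^+ n.+1 * c2)%:E * \sum_eps U eps x)%E)).
  apply: (le_xnorm fX (mG K)) => x; first by rewrite lee_fin powR_ge0.
  rewrite sumEFin -EFinM lee_fin -mulrA.
  have -> : (\sum_j a K x j `^ s) `^ s^-1 =
      6 ^+ n.+1 * (\sum_j (\sum_eps t x eps j) `^ s) `^ s^-1.
    rewrite -[X in _ = X * _](powRK s0 (exprn_ge0 n.+1 (ler0n R 6))) -powRM ?powR_ge0//; last first.
      by apply: sumr_ge0 => j _; exact: powR_ge0.
    congr (_ `^ _); rewrite mulr_sumr; apply: eq_bigr => j _.
    by rewrite -powRM ?exprn_ge0 ?sumr_ge0.
  rewrite ler_pM2l ?exprn_gt0// /c2 -card_eps.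
  exact: powR_sum_swap.
apply: (le_trans (xnormZ_le fX _ mS)); first by rewrite mulr_gt0// exprn_gt0.
have -> : fefferman_stein_const s * fnorm X F = (6 ^+ n.+1 * c2) *
    ((2 ^ n.+1)%:R * (vv_const s (2 ^+ n.+1) * (`|C1| * `|C2| * fnorm X F))).
  by rewrite /fefferman_stein_const /c2; ring.
rewrite [leRHS]EFinM lee_pmul2l ?lte_fin ?mulr_gt0 ?exprn_gt0//.
apply: (le_trans (xnorm_sum nX _ mU U0)).
apply: (@le_trans _ _ (\sum_(eps : {ffun 'I_n.+1 -> bool})
    (vv_const s (2 ^+ n.+1) * (`|C1| * `|C2| * fnorm X F))%:E)%E).
  by apply: lee_sum => eps _; exact: xnorm_tree_vector.
by rewrite sumEFin lee_fin sumr_const card_eps -[leLHS]mulr_natl.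
Qed.

End vector_valued_maximal.

(** * Sparse operators *)

(** Read [sub] as inclusion in a chain of sets. The members whose sum over larger sets is below half
    of the total all contain the smallest of them, so together they weigh at most half. On the
    others the (s-1)-th power is at least that of half the total. *)
Lemma chain_powR_sum (R : realType) (J : finType) (sub : rel J) (A : pred J) (a : J -> R) (s : R) :
  1 < s -> reflexive sub -> transitive sub ->
  {in A &, total sub} -> (forall j, 0 <= a j) ->
  (2^-1 * \sum_(j in A) a j) `^ s <=
  \sum_(j in A) a j * (\sum_(k | sub j k) a k) `^ (s - 1).
Proof.
move=> s1 subr subt tot a0; set sg := \sum_(j in A) a j.
pose Tj j := \sum_(k | sub j k) a k.
have sg0 : 0 <= sg by exact: sumr_ge0.
have Tj0 j : 0 <= Tj j by exact: sumr_ge0.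
pose B j := (j \in A) && (Tj j < 2^-1 * sg).
have small : \sum_(j in A | Tj j < 2^-1 * sg) a j <= 2^-1 * sg.
  have [/existsP[j0 Bj0]|/existsPn nB] := boolP [exists j, B j]; last first.
    by rewrite big1 ?mulr_ge0// => j Bj; have := nB j; rewrite /B Bj.
  (* Having the most sets above it singles out a smallest set of the chain. *)
  have [j Bj hmax] := @arg_maxnP _ j0 B (fun j => #|[pred k | sub j k]|) Bj0.
  have /andP[Aj Tjs] := Bj; apply: le_trans (ltW Tjs).
  rewrite /Tj [leRHS]big_mkcond [leLHS]big_mkcond/=; apply: ler_sum => k _.
  case: ifPn => [Bk|_]; last by case: ifP.
  have /andP[Ak _] := Bk; case: ifPn => // njk.
  have kj : sub k j by have := tot _ _ Ak Aj; rewrite (negPf njk) orbF.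
  have : (#|[pred i | sub k i]| <= #|[pred i | sub j i]|)%N := hmax _ Bk; rewrite leqNgt => /negP[]; apply: proper_card; apply/properP; split.
    by apply/fintype.subsetP => i; rewrite !inE; exact: subt.
  by exists k; rewrite !inE ?subr.
have large : 2^-1 * sg <= \sum_(j in A | ~~ (Tj j < 2^-1 * sg)) a j.
  have : sg = \sum_(j in A | Tj j < 2^-1 * sg) a j +
    \sum_(j in A | ~~ (Tj j < 2^-1 * sg)) a j by rewrite {1}/sg (bigID (fun j => Tj j < 2^-1 * sg)).
  by move=> E; lra.
have h0 : 0 <= 2^-1 * sg by rewrite mulr_ge0.
rewrite -(mulr_powRB1 h0); last by lra.
apply: (@le_trans _ _ (\sum_(j in A | ~~ (Tj j < 2^-1 * sg)) a j * (2^-1 * sg) `^ (s - 1))).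
  by rewrite -mulr_suml ler_wpM2r ?powR_ge0.
rewrite [leRHS](bigID (fun j => Tj j < 2^-1 * sg))/= ler_wpDl//.
  by apply: sumr_ge0 => j _; rewrite mulr_ge0 ?powR_ge0.
apply: ler_sum => j /andP[_]; rewrite -leNgt => hj; rewrite ler_wpM2l//.
by apply: le_powR => //; rewrite subr_gt0.
Qed.

Lemma powR_split (R : realType) (a u : R) : 0 < a -> a `^ u * a `^ (1 - u) = a.
Proof.
move=> a0; rewrite -powRD; last by apply/implyP => _; rewrite gt_eqF.
by rewrite (_ : u + (1 - u) = 1); [rewrite powRr1// ltW|ring].
Qed.

(** The cases compare [a] with d^s t: below it, [a] is replaced by d^s t; above it, [t] by d^(-s)
    a. *)
Lemma powR_geometric_mean (R : realType) (s d a t : R) : 1 < s -> 0 < d -> 0 <= a -> 0 <= t ->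
  a `^ s^-1 * t `^ (1 - s^-1) <= d * t + d `^ (1 - s) * a.
Proof.
move=> s1 d0 a0 t0; have s0 : 0 < s by lra.
have sn : s != 0 by rewrite gt_eqF.
have si1 : 0 < 1 - s^-1 by rewrite subr_gt0 invf_lt1.
have [ad|da] := leP a (d `^ s * t).
  apply: (@le_trans _ _ (d * t)); last by rewrite lerDl mulr_ge0 ?powR_ge0.
  apply: (@le_trans _ _ ((d `^ s * t) `^ s^-1 * t `^ (1 - s^-1))).
    by rewrite ler_wpM2r ?powR_ge0// le_powR ?invr_gt0.
  rewrite powRM ?powR_ge0// (powRK s0 (ltW d0)) -mulrA ler_pM2l//.
  have [->|tn] := eqVneq t 0; first by rewrite powR0 ?invr_eq0// mul0r.
  by rewrite powR_split// lt_def tn.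
apply: (@le_trans _ _ (d `^ (1 - s) * a)); last by rewrite lerDr mulr_ge0 // (ltW d0).
have ap : 0 < a by apply: le_lt_trans da; rewrite mulr_ge0 ?powR_ge0.
apply: (@le_trans _ _ (a `^ s^-1 * (d `^ (- s) * a) `^ (1 - s^-1))).
  rewrite ler_wpM2l ?powR_ge0//; apply: le_powR => //.
  by rewrite powRN mulrC ler_pdivlMr ?powR_gt0// mulrC ltW.
rewrite powRM ?powR_ge0// -powRrM mulrCA.
rewrite powR_split//; suff -> : - s * (1 - s^-1) = 1 - s by [].
by field.
Qed.

Section sparse_of_vector.
Variables (R : realType) (n : nat).
Local Notation T := (Rn R n).
Local Notation mu := (@lebesgue_Rn R n).

Lemma sparse_op_ord (S : set (set T)) : finite_set S ->
  exists N (Q : 'I_N -> set T), [/\ injective Q, forall P, S P <-> exists j, Q j = P &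
    forall f x, sparse_op S f x =
      (\sum_j average (Q j) (fun y => `|f y|%R) * (\1_(Q j) x)%:E)%E].
Proof.
move=> /finite_seqP[s0 Ss0]; pose s := undup s0.
have us : uniq s by exact: undup_uniq.
have Ss : S = [set` s] by rewrite Ss0; apply/seteqP; split => P /=; rewrite mem_undup.
exists (size s), (fun j => nth set0 s j); split.
- by move=> i j /eqP; rewrite nth_uniq// => /eqP/val_inj.
- move=> P; rewrite Ss /=; split=> [/(nthP set0)[i il <-]|[j <-]]; last exact: mem_nth.
  by exists (Ordinal il).
- by move=> f x; rewrite /sparse_op Ss -fsbig_seq// (big_nth set0) big_mkord.
Qed.

Lemma dyadic_grid_cube (D : set (set T)) : dyadic_grid D -> D `<=` @cube R n.
Proof.
by move=> [Dk [-> Dcube _ _ _]] Q [k _ /Dcube [a [l0 ->]]]; exact: half_cube.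
Qed.

Variable X : fspace R n.
Hypothesis nX : normed_lattice X.
Let fX : function_lattice X := nX.
Variables (s C : R).
Hypothesis s1 : 1 < s.
Hypothesis C0 : 0 < C.
Hypothesis vv : forall N (h : 'I_N -> T -> R), (forall j, measurable_fun setT (h j)) ->
  let F := fun x => (\sum_j `|h j x| `^ s) `^ s^-1 in X F ->
  (xnorm X (fun x => (\sum_j maximal (h j) x `^ s) `^ s^-1) <= (C * fnorm X F)%:E)%E.

Let s0 : 0 < s := lt_trans ltr01 s1.

Lemma maximal_of_vector f : X f -> (xnorm X (maximal f) <= (C * fnorm X f)%:E)%E.
Proof.
move=> Xf; have mf := fl_measurable fX Xf; have [<- Xa] := fnorm_abs fX Xf.
have E (x : T) : (\sum_(j < 1) `|f x| `^ s) `^ s^-1 = `|f x|.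
  by rewrite big_ord1 powRK.
have := @vv 1 (fun=> f) (fun=> mf); rewrite /=; under eq_fun do rewrite E.
move=> /(_ Xa); congr (xnorm X _ <= _)%E; apply/funext => x.
rewrite big_ord1 -poweRrM mulfV ?gt_eqF// poweRe1//; exact: maximal_ge0.
Qed.

Lemma sparse_of_vector D S (f : T -> R) : dyadic_grid D -> finite_set S -> S `<=` D ->
  sparse 2^-1 S -> X f ->
  (xnorm X (sparse_op S f) <= (8 * C * (8 * C) `^ (s - 1) * C * fnorm X f)%:E)%E.
Proof.
move=> dD; have [Dk [_ _ _ _ Dnest]] := dD; move=> finS SD [E [tE hE]] Xf.
have mf := fl_measurable fX Xf; have Mf := maximal_of_vector Xf.
have lf : locally_integrable f.
  by apply: (locally_integrable_xnorm (Z := X) mf); apply: le_lt_trans Mf (ltry _).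
have [N [Q [Qinj SQ opE]]] := sparse_op_ord finS.
have SQj j : S (Q j) by apply/SQ; exists j.
have cQ j : cube (Q j) by exact: (dyadic_grid_cube dD (SD _ (SQj j))).
have /choice[v hv] : forall j, exists v : R, 0 < v /\ mu (Q j) = v%:E.
  by move=> j; have [v ? ?] := cube_mu (cQ j); exists v.
have v0 j : 0 < v j by have [] := hv j.
have vE j : mu (Q j) = (v j)%:E by have [] := hv j.
pose a j := fine (average (Q j) (fun y => `|f y|)).
have afin j : average (Q j) (fun y => `|f y|) \is a fin_num.
  rewrite /average vE fin_numM// ge0_fin_numE; last by apply: integral_ge0 => x _; rewrite lee_fin.
  exact: lf.2.
have a0 j : 0 <= a j by rewrite fine_ge0// average_ge0.
pose Ta x := \sum_j a j * \1_(Q j) x.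
have opT x : sparse_op S f x = (Ta x)%:E.
  by rewrite opE /Ta -sumEFin; apply: eq_bigr => j _; rewrite EFinM /a fineK.
pose sub := [rel i j : 'I_N | `[< Q i `<=` Q j >]].
pose Tj j := \sum_(k | sub j k) a k.
have Tj0 j : 0 <= Tj j by exact: sumr_ge0.
pose b j := a j `^ s^-1 * Tj j `^ (1 - s^-1).
have b0 j : 0 <= b j by rewrite mulr_ge0 ?powR_ge0.
have bs j : b j `^ s = a j * Tj j `^ (s - 1).
  rewrite powRM ?powR_ge0// powRVK// -powRrM; congr (_ * _ `^ _).
  by field; rewrite gt_eqF.
pose h j x := b j * \1_(E (Q j)) x.
have mE j : measurable (E (Q j)) by have [] := hE _ (SQj j).
have mh j : measurable_fun setT (h j).
  by apply: measurable_funM; [exact: measurable_cst|exact: measurable_indic].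
have mT : measurable_fun setT Ta.
  apply: measurable_sum => j; apply: measurable_funM; first exact: measurable_cst.
  by apply: measurable_indic; exact: cube_measurable.
have Ta0 x : 0 <= Ta x by apply: sumr_ge0 => j _; rewrite mulr_ge0 ?indicE.
have Mh j x : Q j x -> ((2^-1 * b j)%:E <= maximal (h j) x)%E.
  move=> Qx; apply: le_trans (average_le_maximal _ (cQ j) Qx).
  have [_ EQ muE] := hE _ (SQj j).
  rewrite /average vE /=; under eq_integral => y _ do
    rewrite /h (ger0_norm (mulr_ge0 (b0 j) (ler0n _ _))) EFinM.
  rewrite ge0_integralZl_EFin; last 4 first.
  - exact: cube_measurable.
  - by move=> y _; rewrite lee_fin ler0n.
  - apply: measurable_funTS; apply/measurable_EFinP; exact: measurable_indic.
  - exact: b0.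
  rewrite integral_indic; [|exact: cube_measurable|exact: mE].
  rewrite setIidl// muleCA mulrC EFinM lee_wpmul2l ?lee_fin//.
  by rewrite lee_pdivlMl// muleC -vE.
have TjT j x : Q j x -> Tj j <= Ta x.
  move=> Qx; rewrite /Tj /Ta [leLHS]big_mkcond; apply: ler_sum => k _.
  case: ifPn => [/asboolP jk|_]; last by rewrite mulr_ge0 ?indicE.
  by rewrite indicE mem_set ?mulr1//; exact: jk.
(* One half comes from sparseness, through [Mh], the other from [chain_powR_sum]. *)
have half_le x : (((2^-1 * 2^-1) * Ta x)%:E <= (\sum_j maximal (h j) x `^ s) `^ s^-1)%E.
  apply: (@le_trans _ _ ((\sum_j (2^-1 * b j * \1_(Q j) x) `^ s) `^ s^-1)%:E); last first.
    rewrite -poweR_EFin; apply: le_poweR; rewrite ?invr_gt0//.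
      by rewrite lee_fin sumr_ge0// => j _; exact: powR_ge0.
    rewrite -sumEFin; apply: lee_sum => j _; rewrite -poweR_EFin.
    apply: le_poweR => //; first by rewrite lee_fin indicE; apply: mulr_ge0 => //; exact: mulr_ge0.
    rewrite indicE; case: (boolP (x \in Q j)) => [|_]; last by rewrite mulr0 maximal_ge0.
    by rewrite inE mulr1 => /Mh.
  rewrite lee_fin -[leLHS](powRK s0) ?mulr_ge0//; apply: le_powR; rewrite ?invr_gt0 ?powR_ge0//.
  have -> : \sum_j (2^-1 * b j * \1_(Q j) x) `^ s =
      2^-1 `^ s * \sum_(j | x \in Q j) a j * Tj j `^ (s - 1).
    rewrite mulr_sumr [RHS]big_mkcond; apply: eq_bigr => j _; rewrite indicE.
    case: (x \in Q j); last by rewrite mulr0 powR0// gt_eqF.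
    by rewrite mulr1 powRM// bs.
  rewrite -mulrA powRM ?mulr_ge0// ler_wpM2l ?powR_ge0//.
  have -> : Ta x = \sum_(j | x \in Q j) a j.
    rewrite /Ta [RHS]big_mkcond; apply: eq_bigr => j _; rewrite indicE.
    by case: (x \in Q j); rewrite ?mulr1 ?mulr0.
  apply: (@chain_powR_sum R 'I_N sub [pred j | x \in Q j]) => //.
  - by move=> j; apply/asboolP.
  - by move=> j i k /asboolP ij /asboolP jk; apply/asboolP; exact: subset_trans ij jk.
  - move=> i j; rewrite !inE => Qi Qj.
    have [] := Dnest _ _ (SD _ (SQj i)) (SD _ (SQj j)) => H.
    + by have : (Q i `&` Q j) x by []; rewrite H.
    + by apply/orP; left; apply/asboolP.
    + by apply/orP; right; apply/asboolP.
pose F x := (\sum_j `|h j x| `^ s) `^ s^-1.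
(* Chosen so that 4 C d = 1/2, where the 4 undoes the two halves of [half_le]. *)
pose d := (8 * C)^-1.
have d0 : 0 < d by rewrite invr_gt0 mulr_gt0.
have mF : measurable_fun setT F.
  apply: (measurableT_comp (measurable_powR _)); apply: measurable_sum => j.
  by apply: (measurableT_comp (measurable_powR _)); apply: measurableT_comp.
have FM x : ((F x)%:E <= d%:E * (Ta x)%:E + (d `^ (1 - s))%:E * maximal f x)%E.
  have R0 : (0 <= d%:E * (Ta x)%:E + (d `^ (1 - s))%:E * maximal f x)%E.
    by rewrite adde_ge0// mule_ge0 ?lee_fin ?powR_ge0 ?(ltW d0)// maximal_ge0.
  have [[j Ej]|nE] := pselect (exists j, E (Q j) x); last first.
    rewrite /F big1 ?powR0 ?invr_eq0 ?gt_eqF// => j _.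
    rewrite /h indicE memNset ?mulr0 ?normr0 ?powR0 ?gt_eqF// => Ej; apply: nE; by exists j.
  have Qx : Q j x by have [_ EQ _] := hE _ (SQj j); exact: EQ.
  (* The sets [E (Q j)] are disjoint, so only one term of the sum is nonzero at [x]. *)
  have -> : F x = b j.
    rewrite /F (bigD1 j)//= big1 ?addr0.
      by rewrite /h indicE mem_set// mulr1 powRK// ger0_norm.
    move=> i ij; rewrite /h indicE memNset ?mulr0 ?normr0 ?powR0 ?gt_eqF// => Ei.
    move/eqP: ij; apply; apply: Qinj; apply: (tE _ _ (SQj i) (SQj j)).
    by exists x.
  apply: (@le_trans _ _ (d * Ta x + d `^ (1 - s) * a j)%:E).
    rewrite lee_fin; apply: le_trans (powR_geometric_mean s1 d0 (a0 j) (Tj0 j)) _.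
    by rewrite lerD2r ler_pM2l//; exact: TjT.
  rewrite EFinD leeD ?EFinM// lee_wpmul2l ?lee_fin ?powR_ge0//.
  rewrite /a fineK//; exact: average_le_maximal.
have XQ j : X (\1_(Q j) : T -> R).
  have [k /(_ k (leqnn k)) Qk] := cube_sub_centered (cQ j).
  by apply: (fl_indic_sub fX (k := k)) => //; exact: cube_measurable.
(* Absorbing the norm of [Ta] requires it to be finite. It is, since [Ta] is a finite combination of
   indicators of cubes. *)
have XT : (xnorm X (fun x => (Ta x)%:E) < +oo)%E.
  under eq_fun => x do rewrite /Ta -sumEFin.
  apply: le_lt_trans (xnorm_sum nX _ _ _) _.
  - move=> j; apply/measurable_EFinP; apply: measurable_funM; first exact: measurable_cst.
    by apply: measurable_indic; exact: cube_measurable.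
  - by move=> j x; rewrite lee_fin mulr_ge0 ?indicE.
  - apply: lte_sum_pinfty => j _; apply/xnorm_EFin_lty; exact: (fl_scale fX).
have XTa := (xnorm_EFin_lty _ _).1 XT.
have dT : measurable_fun setT (fun x => d%:E * (Ta x)%:E)%E.
  by apply: emeasurable_funM; [exact: measurable_cst|exact/measurable_EFinP].
have dM : measurable_fun setT (fun x => (d `^ (1 - s))%:E * maximal f x)%E.
  by apply: emeasurable_funM; [exact: measurable_cst|exact: measurable_maximal].
have XF : (xnorm X (fun x => (F x)%:E) <=
    (d * fnorm X Ta + d `^ (1 - s) * (C * fnorm X f))%:E)%E.
  apply: (@le_trans _ _ (xnorm X (fun x => d%:E * (Ta x)%:E + (d `^ (1 - s))%:E * maximal f x)%E)).
    apply: (le_xnorm fX); [exact/measurable_EFinP| |exact: FM].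
    by move=> x; rewrite lee_fin powR_ge0.
  apply: le_trans (xnormD nX dT dM _ _) _.
  - by move=> x; rewrite mule_ge0 ?lee_fin ?(ltW d0).
  - by move=> x; rewrite mule_ge0 ?lee_fin ?powR_ge0// maximal_ge0.
  rewrite EFinD; apply: leeD.
    apply: (le_trans (xnormZ_le fX d0 _)); first exact/measurable_EFinP.
    by rewrite xnorm_EFin// EFinM.
  have dp : 0 < d `^ (1 - s) by exact: powR_gt0.
  apply: (le_trans (xnormZ_le fX dp _)); first exact: measurable_maximal.
  by rewrite [leRHS]EFinM lee_pmul2l ?lte_fin.
have XFF := (xnorm_EFin_lty _ _).1 (le_lt_trans XF (ltry _)).
have main : (xnorm X (fun x => (Ta x)%:E) <= 4%:E * (C * fnorm X F)%:E)%E.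
  apply: (@le_trans _ _ (4%:E * xnorm X (fun x => (\sum_j maximal (h j) x `^ s) `^ s^-1))%E).
    have mm : measurable_fun setT (fun x => (\sum_j maximal (h j) x `^ s) `^ s^-1)%E.
      apply: (measurableT_comp (measurable_poweR _)); apply: emeasurable_sum => j.
      by apply: (measurableT_comp (measurable_poweR _)); exact: measurable_maximal.
    apply: le_trans (xnormZ_le fX _ mm); last by [].
    apply: (le_xnorm fX); [exact/measurable_EFinP|by move=> x; rewrite lee_fin|].
    move=> x; apply: le_trans (lee_wpmul2l _ (half_le x)); last by [].
    by rewrite -EFinM lee_fin; lra.
  by rewrite lee_pmul2l//; exact: vv.
rewrite (_ : sparse_op S f = fun x => (Ta x)%:E); last by apply/funext => x; exact: opT.
move: main XF; rewrite !xnorm_EFin// -EFinM !lee_fin => main XF.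
have : fnorm X Ta <= 4 * (C * (d * fnorm X Ta + d `^ (1 - s) * (C * fnorm X f))).
  by apply: le_trans main _; rewrite !ler_pM2l.
have -> : 4 * (C * (d * fnorm X Ta + d `^ (1 - s) * (C * fnorm X f))) =
    2^-1 * fnorm X Ta + 2^-1 * (8 * C * d `^ (1 - s) * C * fnorm X f).
  by rewrite {1}/d; field; rewrite gt_eqF.
have -> : d `^ (1 - s) = (8 * C) `^ (s - 1).
  by rewrite /d -powR_inv1 ?mulr_ge0 ?ltW// -powRrM; congr (_ `^ _); ring.
by move=> H; lra.
Qed.

End sparse_of_vector.

(** * Sparse families from the stopping time *)

Section last_jump.
Variables (R : realType) (I : finType) (w : I -> R) (e : nat -> rel I).

Lemma ustop_last_jump F L x : exists l, [/\ (l <= L)%N, jump w e F l x &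
  ustop w e F L x = cavg w e l F x].
Proof.
elim: L => [|L [l [lL jl El]]]; first by exists 0%N.
have [j|nj] := boolP (jump w e F L.+1 x).
  by exists L.+1; split => //; exact: ustop_jump.
by exists l; split => //; [exact: leqW|rewrite ustop_stay].
Qed.

End last_jump.

Section tree_sparse.
Variables (R : realType) (n : nat).
Local Notation T := (Rn R n).
Local Notation mu := (@lebesgue_Rn R n).
Variables (eps : {ffun 'I_n.+1 -> bool}) (K : nat).

Lemma tree_sparse (h : T -> R) : locally_integrable h ->
  exists S : set (set T), [/\ S `<=` grid eps, finite_set S, sparse 2^-1 S &
    forall x, ((tree_max eps K h x)%:E <= 2%:E * sparse_op S h x)%E].
Proof.
move=> [mh lh].
have hfin := lh _ (@top_cube R n eps K).
set w := @leaf_mass R n eps K; set e := @same R n eps K.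
pose I := leaf_index R eps K.
have w0 : forall b, 0 < w b := @leaf_mass_gt0 R n eps K.
have ee : forall l, equivalence_rel (e l) := @same_equiv R n eps K.
have er : forall l x y, e l.+1 x y -> e l x y := @same_refine R n eps K.
pose F : I -> R := leaf_avg h.
have F0 b : 0 <= F b by exact: leaf_avg_ge0.
pose L := (2 * K)%N.
pose Q (b : I) l : set T := gcube eps (lvl K l) (pt b).
(* [ustop_sparse] asks for a positive average, and cubes of average zero add nothing to the sparse
   operator. *)
pose good (b : I) l := jump w e F l b && (0 < cavg w e l F b).
pose S := [set P : set T | exists b l, [/\ (l <= L)%N, good b l & P = Q b l]].
have avgQ b l : (l <= L)%N -> fine (average (Q b l) (fun y => `|h y|)) = cavg w e l F b.
  by move=> lL; rewrite /F cavg_average.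
(* Each new jump more than doubles the stopped value, so the final value of a leaf identifies the
   last of its cubes that jumped. Described in this way, [E] depends on the set [P] alone and not on
   a level. *)
pose E (P : set T) := [set x | P x /\ exists2 b : I, leaf b x &
  ustop w e F L b = fine (average P (fun y => `|h y|))].
have leafQ (b b' : I) l x : (l <= L)%N -> leaf b' x -> Q b l x -> e l b b'.
  move=> lL bx Qx; apply/sameP.
  have hl : lvl K l <= K%:Z by rewrite /lvl; lia.
  by move=> i; rewrite -(Qx i) (gcube_sub hl bx i).
have Qe (b b' : I) l : e l b b' -> Q b l = Q b' l.
  by move=> /sameP h1; rewrite /Q (gcube_eq h1).
have finS : finite_set S.
  apply: (@sub_finite_set _ _ ((fun p : I * 'I_L.+1 => Q p.1 p.2) @` setT)).
    by move=> P [b [l [lL _ ->]]]; exists (b, Ordinal (lL : (l < L.+1)%N)).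
  by apply: finite_image; exact: finite_finset.
exists S; split => //.
- by move=> _ [b [l [_ _ ->]]]; exists (lvl K l) => //; exists (pt b).
- have mleafs (P : set T) : E P = P `&` \big[setU/set0]_(b <- index_enum I | ustop w e F L b ==
      fine (average P (fun y => `|h y|))) leaf b.
    rewrite -bigcup_seq_cond; apply/seteqP; split => x [Px].
      by move=> [b bx ub]; split => //; exists b => //=; rewrite mem_index_enum/= ub.
    by move=> [b /= /andP[_ /eqP ub] bx]; split => //; exists b.
  exists E; split.
    move=> _ _ [b [l [lL gl ->]]] [b' [l' [lL' gl' ->]]] [x [[Qx [c cx uc]] [Qx' [c' cx' uc']]]].
    have cc := leaf_inj cx' cx; subst c'.
    move: uc uc'; rewrite !avgQ//.
    have h1 := leafQ _ _ _ _ lL cx Qx; have h2 := leafQ _ _ _ _ lL' cx Qx'.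
    rewrite (Qe _ _ _ h1) (Qe _ _ _ h2).
    rewrite (cavg_inv w ee F h1) (cavg_inv w ee F h2).
    have : good c l by move: gl; rewrite /good (jump_inv w ee er F h1) (cavg_inv w ee F h1).
    have : good c l' by move: gl'; rewrite /good (jump_inv w ee er F h2) (cavg_inv w ee F h2).
    have key m m' : (m < m')%N -> good c m -> good c m' -> cavg w e m F c <> cavg w e m' F c.
      move=> mm' /andP[jm pm] /andP[jm' pm'] EE; case: m' mm' jm' pm' EE => // m' mm' jm' pm' EE.
      have := ustop_homo w0 ee c F0 (mm' : (m <= m')%N); rewrite (ustop_jump jm) EE.
      by move: jm' => /=; lra.
    move=> g' g u u'; have EE : cavg w e l F c = cavg w e l' F c by rewrite -u -u'.
    have [ll'|ll'|->//] := ltngtP l l'; first by have := key _ _ ll' g g'.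
    by have := key _ _ ll' g' g; rewrite EE.
  move=> _ [b [l [lL /andP[jl cl] ->]]].
  have mQ : measurable (Q b l) by exact: gcube_measurable.
  have mE : measurable (E (Q b l)).
    rewrite mleafs; apply: measurableI => //; apply: bigsetU_measurable => c _.
    exact: leaf_measurable.
  split=> //; first by move=> x [].
  have -> : mu (Q b l) = (cmass w e l b)%:E by rewrite /w /e cmass_grid// gcube_mu.
  have -> : mu (E (Q b l)) = (\int[mu]_(x in Q b l) (\1_(E (Q b l)) x)%:E)%E.
    by rewrite integral_indic// setIidl// => x [].
  rewrite integral_gcube_leaves; last 3 first.
  - exact: lL.
  - by apply/measurable_EFinP; exact: measurable_indic.
  - by move=> x; rewrite lee_fin.
  apply: (@le_trans _ _ (\sum_(y | e l b y && (ustop w e F L y == ustop w e F l y)) w y)%:E).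
    by rewrite -EFinM lee_fin; exact: ustop_sparse.
  rewrite -sumEFin big_mkcondr/=; apply: lee_sum => y ly; case: ifPn => [/eqP uy|_]; last first.
    by apply: integral_ge0 => x _; rewrite lee_fin.
  rewrite integral_indic//; last exact: leaf_measurable.
  have <- : mu (leaf y) = (w y)%:E by exact: leaf_mu.
  rewrite setIidr; first exact: lexx.
  move=> x yx; split.
    rewrite (Qe _ _ _ ly); have hl : lvl K l <= K%:Z by rewrite /lvl; lia.
    exact: gcube_sub hl _ yx.
  by exists y => //; rewrite avgQ// uy -(ustop_inv w ee er F ly) ustop_jump.
have [N [Q' [_ SQ opE]]] := sparse_op_ord finS.
have cQ' j : cube (Q' j).
  have [b [l [_ _ ->]]] : S (Q' j) by apply/SQ; exists j.
  exact: gcube_cube.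
have term0 j x : (0 <= average (Q' j) (fun y => `|h y|%R) * (\1_(Q' j) x)%:E)%E.
  by rewrite mule_ge0 ?average_ge0// lee_fin.
have op0 x : (0 <= sparse_op S h x)%E by rewrite opE; apply: sume_ge0.
move=> x; have [/leaf_exists[b bx]|tx] := pselect (top eps K x); last first.
  by rewrite (tree_max_top _ tx) mule_ge0.
rewrite (tree_max_leaf h bx).
apply: (@le_trans _ _ (2 * ustop w e F L b)%:E).
  by rewrite lee_fin; exact: rmax_le_ustop.
rewrite EFinM lee_pmul2l//.
have [l [lL jl ->]] := ustop_last_jump w e F L b.
have [c0|c0] := leP (cavg w e l F b) 0; first by apply: le_trans (op0 x); rewrite lee_fin.
have [j Qj] : exists j, Q' j = Q b l.
  by apply/SQ; exists b, l; split => //; rewrite /good jl c0.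
rewrite opE (bigD1 j)//= Qj.
have Qx : Q b l x.
  by have hl : lvl K l <= K%:Z by [rewrite /lvl; lia]; exact: gcube_sub hl _ bx.
rewrite indicE mem_set// mule1 -avgQ// fineK; last first.
  exact: (average_fin hfin (gcube_cube _ _ _) (@gcube_sub_top _ _ _ _ _ _)).
by rewrite leeDl// sume_ge0.
Qed.

End tree_sparse.

(** * Self-adjointness of sparse operators, and the bounds on X and X' *)

Section sparse_duality.
Variables (R : realType) (n : nat).
Local Notation T := (Rn R n).
Local Notation mu := (@lebesgue_Rn R n).

Lemma average_fin_num Q (g : T -> R) : cube Q -> locally_integrable g ->
  average Q (fun y => `|g y|) \is a fin_num.
Proof.
move=> cQ lg; have [v v0 E] := cube_mu cQ; rewrite /average E fin_numM//.
by rewrite ge0_fin_numE ?lg.2//; apply: integral_ge0 => x _; rewrite lee_fin.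
Qed.

Lemma sparse_op_ge0 S (f : T -> R) x : finite_set S -> S `<=` @cube R n ->
  (0 <= sparse_op S f x)%E.
Proof.
move=> finS cS; have [N [Q [_ SQ ->]]] := sparse_op_ord finS; apply: sume_ge0 => j _.
have cQ : cube (Q j) by apply: cS; apply/SQ; exists j.
by rewrite mule_ge0 ?average_ge0// lee_fin.
Qed.

Lemma measurable_sparse_op S (f : T -> R) : finite_set S -> S `<=` @cube R n ->
  measurable_fun setT (sparse_op S f).
Proof.
move=> finS cS; have [N [Q [_ SQ opE]]] := sparse_op_ord finS.
rewrite (_ : sparse_op S f = fun x =>
  (\sum_j average (Q j) (fun y => `|f y|%R) * (\1_(Q j) x)%:E)%E); last exact/funext/opE.
apply: emeasurable_sum => j; apply: emeasurable_funM; first exact: measurable_cst.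
apply/measurable_EFinP/measurable_indic/cube_measurable/cS/SQ; by exists j.
Qed.

(** Both sides are the sum over [S] of the measure of the cube times the product of the two
    averages. *)
Lemma integral_sparse_op S (f g : T -> R) : finite_set S -> S `<=` @cube R n ->
  locally_integrable f -> locally_integrable g ->
  (\int[mu]_x (`|f x|%:E * sparse_op S g x) = \int[mu]_x (`|g x|%:E * sparse_op S f x))%E.
Proof.
move=> finS cS; have [N [Q [_ SQ opE]]] := sparse_op_ord finS.
have cQ j : cube (Q j) by apply: cS; apply/SQ; exists j.
have main u h : locally_integrable u -> locally_integrable h ->
    (\int[mu]_x (`|u x|%:E * sparse_op S h x) =
     \sum_j mu (Q j) * (average (Q j) (fun y => `|h y|%R) * average (Q j) (fun y => `|u y|%R)))%E.
  move=> lu lh; have mu_ := measurable_absE lu.1.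
  have m1 j : measurable_fun setT (fun x => (`|u x|%:E * (\1_(Q j) x)%:E)%E).
    apply: (emeasurable_funM mu_); apply/measurable_EFinP/measurable_indic.
    exact: cube_measurable.
  have p1 j x : (0 <= `|u x|%:E * (\1_(Q j) x)%:E)%E by rewrite mule_ge0// lee_fin.
  have [a ha] : {a : 'I_N -> R | forall j, average (Q j) (fun y => `|h y|%R) = (a j)%:E}.
    by exists (fun j => fine (average (Q j) (fun y => `|h y|%R))) => j;
      rewrite fineK// average_fin_num.
  have a0 j : 0 <= a j by rewrite -lee_fin -ha average_ge0.
  have E x : (`|u x|%:E * sparse_op S h x =
      \sum_j (a j)%:E * (`|u x|%:E * (\1_(Q j) x)%:E))%E.
    rewrite opE; under eq_bigr do rewrite ha -EFinM.
    under [in RHS]eq_bigr do rewrite -!EFinM.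
    by rewrite !sumEFin -EFinM mulr_sumr; congr (_%:E); apply: eq_bigr => j _; ring.
  under eq_integral => x _ do rewrite E.
  rewrite ge0_integral_sum; last 3 first.
  - exact: measurableT.
  - by move=> j; apply: emeasurable_funM; [exact: measurable_cst|exact: m1].
  - by move=> j x _; apply: mule_ge0; [rewrite lee_fin|exact: p1].
  apply: eq_bigr => j _.
  rewrite ge0_integralZl_EFin; [|exact: measurableT|by move=> x _; exact: p1|exact: m1|exact: a0].
  rewrite ha muleCA; congr (_ * _)%E.
  have [v v0 vE] := cube_mu (cQ j).
  rewrite /average vE /= muleA -EFinM divff ?gt_eqF// mul1e.
  rewrite [RHS]integral_mkcond; apply: eq_integral => x _.
  by rewrite /patch indicE; case: (x \in Q j); rewrite ?mule1 ?mule0.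
move=> lf lg; rewrite !main//; apply: eq_bigr => j _; by rewrite (muleC (average _ _)).
Qed.

End sparse_duality.

Section maximal_of_bounded.
Variables (R : realType) (n : nat).
Local Notation T := (Rn R n).
Variable X : fspace R n.
Hypothesis fX : function_lattice X.

(** Elements of [X] are not yet known to be locally integrable, but bounded functions are.
    Truncations increase to |f|, their maximal functions dominate that of [f] in the limit, and the
    Fatou property concludes. *)
Lemma maximal_of_bounded (c : R) : 0 <= c ->
  (forall (g : T -> R) M, X g -> (forall x, `|g x| <= M) ->
     (xnorm X (maximal g) <= (c * fnorm X g)%:E)%E) ->
  forall f : T -> R, X f -> (xnorm X (maximal f) <= (c * fnorm X f)%:E)%E.
Proof.
move=> c0 H f Xf; have mf := fl_measurable fX Xf.
pose F (k : nat) (x : T) : R := Num.min `|f x| k%:R.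
have F0 k x : 0 <= F k x by rewrite le_min normr_ge0 ler0n.
have FS k x : F k x <= F k.+1 x.
  by rewrite le_min ge_min lexx/= ge_min ler_nat leqnSn orbT.
have mF k : measurable_fun setT (F k).
  by apply: measurable_minr; [exact: measurableT_comp|exact: measurable_cst].
have Ff k x : `|F k x| <= `|f x| by rewrite ger0_norm// ge_min lexx.
have XF k : X (F k) /\ fnorm X (F k) <= fnorm X f.
  by apply: (fl_ideal fX Xf (mF k)); apply: aeW => x; exact: Ff.
apply: (@le_trans _ _ (xnorm X (fun x => ereal_sup (range (fun k => maximal (F k) x))))).
  apply: (le_xnorm fX); [exact: measurable_maximal|by move=> x; exact: maximal_ge0|move=> x].
  apply: maximal_leP => [|Q cQ Qx].
    by apply: le_trans (maximal_ge0 (F 0%N) x) _; apply: ereal_sup_ubound; exists 0%N.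
  apply: (average_sup (F := F)) => // [y|k].
    apply/eqP; rewrite eq_le; apply/andP; split; last first.
      by apply: ge_ereal_sup => _ [k _ <-]; rewrite lee_fin ge_min lexx.
    apply: ereal_sup_ubound; exists (Num.truncn `|f y|).+1 => //.
    by rewrite /F min_l// ltW// truncnS_gt.
  apply: le_trans (ereal_sup_ubound _); last by exists k.
  have FE : (fun y => `|F k y|) = F k by apply/funext => y; exact: ger0_norm (F0 k y).
  by have := @average_le_maximal _ _ Q (F k) x cQ Qx; rewrite FE.
apply: (xnorm_fatou fX) => [k|k x|k x|k].
- exact: measurable_maximal.
- exact: maximal_ge0.
- by apply: maximal_mono => // y; rewrite !ger0_norm.
- have [XFk nFk] := XF k; apply: (@le_trans _ _ (c * fnorm X (F k))%:E).
    by apply: (H _ k%:R XFk) => x; rewrite ger0_norm// ge_min lexx orbT.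
  by rewrite lee_fin ler_wpM2l.
Qed.

End maximal_of_bounded.

Section maximal_of_sparse.
Variables (R : realType) (n : nat).
Local Notation T := (Rn R n).
Local Notation mu := (@lebesgue_Rn R n).
Variable X : fspace R n.
Hypothesis nX : normed_lattice X.
Let fX : function_lattice X := nX.
Variable C : R.
Hypothesis C0 : 0 < C.
Hypothesis sp : forall D S f, dyadic_grid D -> finite_set S -> S `<=` D -> sparse 2^-1 S ->
  X f -> locally_integrable f -> (xnorm X (sparse_op S f) <= (C * fnorm X f)%:E)%E.

Let grid_cubes eps S : S `<=` grid eps -> S `<=` @cube R n.
Proof. by move=> SD P /SD[k _ [x _ <-]]; exact: gcube_cube. Qed.

Lemma maximal_of_sparse_loc f : X f -> locally_integrable f ->
  (xnorm X (maximal f) <= (grid_const R n * (2 * C * fnorm X f))%:E)%E.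
Proof.
move=> Xf lf; have c0 : 0 <= 2 * C * fnorm X f.
  by rewrite mulr_ge0 ?(fl_ge0 fX)// mulr_ge0// ltW.
apply: (xnorm_maximal_grid nX lf c0) => eps K.
have [S [SD finS spS leS]] := tree_sparse eps K lf.
have mS := measurable_sparse_op f finS (grid_cubes SD).
apply: (@le_trans _ _ (xnorm X (fun x => 2%:E * sparse_op S f x)%E)).
  apply: (le_xnorm fX); [|by move=> x; rewrite lee_fin tree_max_ge0|exact: leS].
  by apply/measurable_EFinP; exact: measurable_tree_max.
apply: (le_trans (xnormZ_le fX _ mS)); first by [].
rewrite -mulrA EFinM lee_pmul2l//; exact: @sp _ _ _ (@grid_dyadic R n eps) finS SD spS Xf lf.
Qed.

Lemma maximal_of_sparse f : X f ->
  (xnorm X (maximal f) <= (grid_const R n * (2 * C) * fnorm X f)%:E)%E.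
Proof.
apply: (maximal_of_bounded fX) => [|g M Xg gM].
  by rewrite mulr_ge0 ?mulr_ge0 ?(ltW C0)// ltW// grid_const_gt0.
have mg := fl_measurable fX Xg.
by rewrite -!mulrA; apply: (le_trans (maximal_of_sparse_loc Xg (locally_integrable_bounded mg gM)));
  rewrite -!mulrA.
Qed.

(** Indicators of cubes belong to [X], so the pairing of [g] with them is finite. *)
Lemma locally_integrable_kothe g : kothe_associate X g -> locally_integrable g.
Proof.
move=> [mg gX]; split => // Q cQ.
have [k /(_ k (leqnn k)) Qk] := cube_sub_centered cQ.
have mQ := cube_measurable cQ.
have XQ := fl_indic_sub fX mQ Qk.
have := kothe_hoelder fX (u := fun x => (\1_Q x)%:E) _ _ _ mg.
rewrite xnorm_EFin// => H.
have {}H : (\int[mu]_x ((\1_Q x)%:E * `|g x|%:E) <= kothe_norm X g * (fnorm X \1_Q)%:E)%E.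
  apply: H; [|by move=> x; rewrite lee_fin|exact: ltry].
  by apply/measurable_EFinP; exact: measurable_indic.
apply: (@le_lt_trans _ _ (kothe_norm X g * (fnorm X \1_Q)%:E)%E).
  apply: le_trans H; rewrite integral_mkcond le_eqVlt; apply/orP; left; apply/eqP.
  by apply: eq_integral => x _; rewrite /patch indicE; case: (x \in Q); rewrite ?mul1e ?mul0e.
have gE : kothe_norm X g \is a fin_num by rewrite ge0_fin_numE ?(kothe_norm_ge0 nX).
by rewrite -(fineK gE) -EFinM ltry.
Qed.

Lemma integral_mul_maximal (f g : T -> R) : X f -> kothe_associate X g ->
  (\int[mu]_x (`|f x|%:E * maximal g x) <=
   (grid_const R n)%:E * ((2 * C * fnorm X f)%:E * kothe_norm X g))%E.
Proof.
move=> Xf X'g; have lg := locally_integrable_kothe X'g; have [mg gX] := X'g.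
have mf := fl_measurable fX Xf.
have lf : locally_integrable f.
  by apply: (locally_integrable_xnorm (Z := X) mf); apply: le_lt_trans (maximal_of_sparse Xf) (ltry _).
have c0 : 0 <= 2 * C * fnorm X f.
  by rewrite mulr_ge0 ?(fl_ge0 fX)// mulr_ge0// ltW.
apply: (integral_maximal_grid (u := fun x => `|f x|)).
- exact: lg.
- by apply: measurableT_comp; [exact: normr_measurable|exact: mf].
- by move=> x; exact: normr_ge0.
- by rewrite mule_ge0 ?lee_fin// (kothe_norm_ge0 nX).
move=> eps K; have [S [SD finS spS leS]] := tree_sparse eps K lg.
have mSg := measurable_sparse_op g finS (grid_cubes SD).
have mSf := measurable_sparse_op f finS (grid_cubes SD).
have Sg0 x := sparse_op_ge0 g x finS (grid_cubes SD).
have Sf0 x := sparse_op_ge0 f x finS (grid_cubes SD).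
have maf := measurable_absE mf.
have spf := @sp _ _ _ (@grid_dyadic R n eps) finS SD spS Xf lf.
apply: (@le_trans _ _ (\int[mu]_x (2%:E * (`|f x|%:E * sparse_op S g x)))%E).
  apply: ge0_le_integral.
  - exact: measurableT.
  - by move=> x _; rewrite mule_ge0 ?lee_fin// tree_max_ge0.
  - apply: (emeasurable_funM maf); apply/measurable_EFinP; exact: measurable_tree_max.
  - exact: (emeasurable_funM (@measurable_cst _ _ _ _ _ _) (emeasurable_funM maf mSg)).
  - by move=> x _; rewrite muleCA lee_wpmul2l ?lee_fin.
rewrite ge0_integralZl_EFin; last 4 first.
- exact: measurableT.
- by move=> x _; rewrite mule_ge0 ?lee_fin.
- exact: (emeasurable_funM maf mSg).
- by [].
(* Self-adjointness moves the sparse operator from [g] to [f], where its bound on [X] applies. *)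
rewrite (integral_sparse_op finS (grid_cubes SD) lf lg).
rewrite -mulrA EFinM -muleA lee_pmul2l//.
under eq_integral => x _ do rewrite muleC.
apply: (le_trans (kothe_hoelder fX mSf Sf0 _ mg)).
  exact: le_lt_trans spf (ltry _).
by rewrite muleC lee_wpmul2r ?(kothe_norm_ge0 nX).
Qed.

(** Pairing with the indicators of the centred cubes shows that the maximal function is integrable
    on each of them. *)
Lemma maximal_kothe_fin g : kothe_associate X g ->
  {ae mu, forall x, maximal g x \is a fin_num}.
Proof.
move=> X'g; have [mg gX] := X'g.
have mM := measurable_maximal mg.
have gE : kothe_norm X g \is a fin_num by rewrite ge0_fin_numE ?(kothe_norm_ge0 nX).
have H k : {ae mu, forall x, centered_cube k x -> maximal g x \is a fin_num}.
  apply: integrable_ae; first exact: measurable_centered_cube.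
  apply/integrableP; split; first exact: measurable_funTS.
  have := integral_mul_maximal (fl_cube fX k) X'g.
  rewrite -(fineK gE) -!EFinM => I; apply: le_lt_trans (ltry _); apply: le_trans I.
  rewrite integral_mkcond le_eqVlt; apply/orP; left; apply/eqP; apply: eq_integral => x _.
  rewrite /patch indicE (gee0_abs (maximal_ge0 _ _)).
  by case: (x \in _); rewrite ?normr1 ?normr0 ?mul1e ?mul0e.
have /choice[N hN] : forall k, exists N, mu.-negligible N /\
    [set x | ~ (centered_cube k x -> maximal g x \is a fin_num)] `<=` N.
  by move=> k; exists [set x | ~ (centered_cube k x -> maximal g x \is a fin_num)]; split => //; exact: H.
have : mu.-negligible (\bigcup_k N k) by apply: negligible_bigcup => k; have [] := hN k.
apply: negligibleS => x /= nfin; have [k xk] := centered_cube_cover x.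
by exists k => //; have [_] := hN k; apply => /= /(_ xk).
Qed.

Lemma maximal_of_sparse_kothe g : kothe_associate X g ->
  (xnorm (kothe_associate X) (maximal g) <=
   (grid_const R n * (2 * C) * fnorm (kothe_associate X) g)%:E)%E.
Proof.
move=> X'g; have [mg gX] := X'g; have gfin := maximal_kothe_fin X'g.
have mM := measurable_maximal mg.
have K0 := kothe_norm_ge0 nX.
have gE : kothe_norm X g \is a fin_num by rewrite ge0_fin_numE ?K0.
have mfM : measurable_fun setT (fine \o maximal g) by apply: measurableT_comp.
have kle : (kothe_norm X (fine \o maximal g) <=
    (grid_const R n * (2 * C) * fine (kothe_norm X g))%:E)%E.
  apply: ge_ereal_sup => _ [f [Xf f1] <-].
  have mf := fl_measurable fX Xf.
  apply: (@le_trans _ _ (\int[mu]_x (`|f x|%:E * maximal g x))%E).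
    apply: ge0_le_integral.
    - exact: measurableT.
    - by move=> x _; rewrite lee_fin.
    - exact/measurable_absE/(measurable_funM mf mfM).
    - by apply: emeasurable_funM; [exact: measurable_absE|].
    - move=> x _; rewrite normrM EFinM lee_wpmul2l ?lee_fin//.
      rewrite ger0_norm ?fine_ge0 ?maximal_ge0//=.
      have := maximal_ge0 g x; case: (maximal g x) => [r _|_|]; rewrite /= ?leey//.
  apply: (le_trans (integral_mul_maximal Xf X'g)).
  rewrite -(fineK gE) -!EFinM lee_fin -!mulrA ler_pM2l ?grid_const_gt0// !ler_pM2l//.
  by rewrite ler_piMl ?fine_ge0 ?K0.
have Mm : xmem (kothe_associate X) (maximal g).
  by split => //; split => //; exact: le_lt_trans kle (ltry _).
rewrite xnorm_mem//= lee_fin -lee_fin fineK//.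
by rewrite ge0_fin_numE ?K0//; exact: le_lt_trans kle (ltry _).
Qed.

End maximal_of_sparse.

(** * Transfer between the space and its power *)

Section transfer.
Variables (R : realType) (n : nat).
Local Notation T := (Rn R n).
Local Notation mu := (@lebesgue_Rn R n).
Variables (r : R) (Y : fspace R n).
Hypothesis r0 : 0 < r.
Hypothesis fY : function_lattice Y.
Local Notation X := (power_space Y r).
Let fX : function_lattice X := power_space_lattice r0 fY.
Let rn0 : r != 0. Proof. by rewrite gt_eqF. Qed.
Let ri0 : 0 < r^-1. Proof. by rewrite invr_gt0. Qed.

Lemma poweRK (p : R) (a : \bar R) : 0 < p -> (0 <= a)%E -> ((a `^ p) `^ p^-1 = a)%E.
Proof. by move=> p0 a0; rewrite -poweRrM mulfV ?gt_eqF// poweRe1. Qed.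

Lemma poweRVK (p : R) (a : \bar R) : 0 < p -> (0 <= a)%E -> ((a `^ p^-1) `^ p = a)%E.
Proof. by move=> p0 a0; rewrite -poweRrM mulVf ?gt_eqF// poweRe1. Qed.

Lemma le_of_le_poweR (p : R) (a b : \bar R) : 0 < p -> (0 <= a)%E -> (0 <= b)%E ->
  (a `^ p <= b `^ p)%E -> (a <= b)%E.
Proof.
move=> p0 a0 b0 ab; rewrite -(poweRK p0 a0) -(poweRK p0 b0).
by apply: le_poweR; rewrite ?invr_gt0 ?poweR_ge0.
Qed.

Lemma average_abs Q (f g : T -> R) : (forall x, `|f x| = `|g x|) ->
  average Q (fun y => `|f y|) = average Q (fun y => `|g y|).
Proof. by move=> fg; congr average; apply/funext. Qed.

Lemma maximal_abs (f g : T -> R) : (forall x, `|f x| = `|g x|) -> maximal f = maximal g.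
Proof.
move=> fg; apply/funext => x; rewrite /maximal; congr ereal_sup.
by apply/seteqP; split => _ [Q cQ <-]; exists Q => //; rewrite (average_abs _ fg).
Qed.

Lemma sparse_op_abs S (f g : T -> R) : (forall x, `|f x| = `|g x|) ->
  sparse_op S f = sparse_op S g.
Proof.
move=> fg; apply/funext => x; rewrite /sparse_op.
by apply: eq_fsbigr => Q _; rewrite (average_abs _ fg).
Qed.

Lemma maximal_r_ge0 (f : T -> R) x : (0 <= maximal_r r f x)%E.
Proof. exact: poweR_ge0. Qed.

Lemma measurable_powR_abs (f : T -> R) (p : R) : measurable_fun setT f ->
  measurable_fun setT (fun x => `|f x| `^ p).
Proof.
move=> mf; apply: (measurableT_comp (measurable_powR _)).
exact: (measurableT_comp (@normr_measurable R setT)).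
Qed.

Lemma measurable_maximal_r (f : T -> R) : measurable_fun setT f ->
  measurable_fun setT (maximal_r r f).
Proof.
move=> mf; apply: (measurableT_comp (measurable_poweR _)); apply: measurable_maximal.
exact: measurable_powR_abs.
Qed.

Lemma power_space_powR f : Y f -> X (fun x => `|f x| `^ r) /\
  fnorm X (fun x => `|f x| `^ r) = fnorm Y f `^ r.
Proof.
move=> Yf; have E : (fun x => `| `|f x| `^ r| `^ r^-1) = (fun x => `|f x|).
  by apply/funext => x; rewrite ger0_norm ?powR_ge0// powRK.
have mf := fl_measurable fY Yf; have [nf Yaf] := fnorm_abs fY Yf.
split; last by rewrite /= E nf.
by split; [exact: measurable_powR_abs|rewrite E].
Qed.

Lemma powR_power_space h : X h -> Y (fun x => `|h x| `^ r^-1) /\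
  fnorm X h = fnorm Y (fun x => `|h x| `^ r^-1) `^ r.
Proof. by move=> [_ Yh]. Qed.

Lemma Lr_loc_of_maximal_bounded (c : R) :
  (forall h, X h -> (xnorm X (maximal h) <= (c * fnorm X h)%:E)%E) ->
  carrier Y `<=` Lr_loc r.
Proof.
move=> H f Yf; have [Xf _] := power_space_powR Yf.
have /xnorm_fin_ae hfin := le_lt_trans (H _ Xf) (ltry _).
have [x fx] := ae_point hfin.
apply: (Lr_loc_of_maximal (x := x)); first exact: (fl_measurable fY Yf).
by rewrite -ge0_fin_numE//; exact: maximal_ge0.
Qed.

Section families.
Variables (q : R) (N : nat) (f h : 'I_N -> T -> R).
Hypothesis mh : forall j, measurable_fun setT (h j).
Hypothesis fh : forall j x, `|f j x| `^ r = `|h j x|.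

Lemma xnorm_power_sum :
  (xnorm X (fun x => ((\sum_(j < N) `|h j x| `^ (q / r)) `^ (r / q))%:E) =
   xnorm Y (fun x => ((\sum_(j < N) `|f j x| `^ q) `^ q^-1)%:E) `^ r)%E.
Proof.
rewrite xnorm_power; [|exact: r0| |]; last 2 first.
- apply/measurable_EFinP; apply: (measurableT_comp (measurable_powR _)).
  by apply: measurable_sum => j; exact: measurable_powR_abs.
- by move=> x; rewrite lee_fin powR_ge0.
congr (xnorm Y _ `^ r)%E; apply/funext => x.
rewrite poweR_EFin -powRrM mulrAC (mulfV rn0) mul1r; congr ((_ `^ _)%:E).
apply: eq_bigr => j _; rewrite -fh -powRrM; congr (_ `^ _); field; exact: rn0.
Qed.

Lemma xnorm_power_maximal :
  (xnorm X (fun x => (\sum_(j < N) maximal (h j) x `^ (q / r)) `^ (r / q)) =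
   xnorm Y (fun x => (\sum_(j < N) maximal_r r (f j) x `^ q) `^ q^-1) `^ r)%E.
Proof.
rewrite xnorm_power; [|exact: r0| |]; last 2 first.
- apply: (measurableT_comp (measurable_poweR _)); apply: emeasurable_sum => j.
  by apply: (measurableT_comp (measurable_poweR _)); exact: measurable_maximal.
- by move=> x; exact: poweR_ge0.
congr (xnorm Y _ `^ r)%E; apply/funext => x.
rewrite -poweRrM mulrAC (mulfV rn0) mul1r; congr (_ `^ _)%E.
apply: eq_bigr => j _; rewrite /maximal_r -poweRrM (@maximal_abs _ (h j)).
  by congr (_ `^ _)%E; rewrite mulrC.
by move=> y; rewrite ger0_norm ?powR_ge0// fh.
Qed.

End families.

(** A single bounded function is an admissible family, since its power lies in L^r_loc;
    [maximal_of_bounded] then reaches all of X. *)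
Lemma maximal_of_vector_valued q C : 0 < q -> 0 < C -> vector_valued_bound Y r q C ->
  forall h : T -> R, X h -> (xnorm X (maximal h) <= (C `^ r * fnorm X h)%:E)%E.
Proof.
move=> q0 C0 vv; apply: (maximal_of_bounded fX); first exact: powR_ge0.
move=> h M Xh hM; have mh := fl_measurable fX Xh.
pose f x := `|h x| `^ r^-1.
have mf : measurable_fun setT f by exact: measurable_powR_abs.
have fh x : `|f x| `^ r = `|h x| by rewrite ger0_norm ?powR_ge0// powRVK.
have lf : Lr_loc r f.
  apply: (@Lr_loc_bounded _ _ f r (M `^ r^-1)) => // x.
  by rewrite ger0_norm ?powR_ge0//; apply: le_powR.
have [Yf ->] := powR_power_space Xh.
have := vv 1%N (fun=> f) (fun=> lf).
have E1 (x : T) : (\sum_(j < 1) `|f x| `^ q) `^ q^-1 = f x.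
  by rewrite big_ord1 powRK// ger0_norm// powR_ge0.
have E2 (x : T) : ((\sum_(j < 1) maximal_r r f x `^ q) `^ q^-1 = maximal_r r f x)%E.
  by rewrite big_ord1 poweRK// maximal_r_ge0.
rewrite /=; under eq_fun do rewrite E1; under [X in (xnorm _ X <= _)%E]eq_fun do rewrite E2.
rewrite xnorm_EFin// => /(_ (ltry _)) H.
rewrite xnorm_power; [|exact: r0| |]; last 2 first.
- exact: measurable_maximal.
- by move=> x; exact: maximal_ge0.
rewrite -(powRM _ (ltW C0) (fl_ge0 fY Yf)) -poweR_EFin; apply: (le_poweR r0).
  exact: xnorm_ge0.
rewrite EFinM; apply: le_trans H; rewrite le_eqVlt; apply/orP; left; apply/eqP.
congr (xnorm Y _); apply/funext => x; rewrite /maximal_r (@maximal_abs _ h)// => y.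
by rewrite ger0_norm ?powR_ge0.
Qed.

Lemma Lr_loc_of_vector_valued q C : 0 < q -> 0 < C -> vector_valued_bound Y r q C ->
  carrier Y `<=` Lr_loc r.
Proof.
by move=> q0 C0 vv; apply: (@Lr_loc_of_maximal_bounded (C `^ r)); exact: maximal_of_vector_valued vv.
Qed.

Let norm_le (u v : \bar R) C : 0 < C -> (0 <= u)%E -> (0 <= v)%E ->
  (u `^ r <= (C `^ r)%:E * v `^ r)%E <-> (u <= C%:E * v)%E.
Proof.
move=> C0 u0 v0; have Cv : (0 <= C%:E * v)%E by rewrite mule_ge0// lee_fin ltW.
rewrite -poweR_EFin -poweRM ?lee_fin ?(ltW C0)//; split; first exact: le_of_le_poweR.
exact: le_poweR.
Qed.

(** The two bounds range over different families, L^r_loc on one side and measurable on the other.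
    From left to right the gap is closed by the inclusion of [Y] in L^r_loc, itself a consequence of
    the bound: each member is dominated by the right-hand side, which lies in [Y]. *)
Lemma vector_valued_bound_powerP q C : 0 < q -> 0 < C ->
  vector_valued_bound Y r q C <-> vector_valued_bound_power Y r q C.
Proof.
move=> q0 C0; split => [vv|vv N f lf].
  rewrite /vector_valued_bound_power /= => N h mh; pose f j x := `|h j x| `^ r^-1.
  have fh j x : `|f j x| `^ r = `|h j x| by rewrite ger0_norm ?powR_ge0// powRVK.
  rewrite (xnorm_power_sum q mh fh) (xnorm_power_maximal q mh fh).
  move=> /lty_poweRy; rewrite gt_eqF// => /(_ isT) Fy.
  apply/norm_le; rewrite ?xnorm_ge0//; apply: (vv N f _ Fy) => j.
  apply: (Lr_loc_of_vector_valued q0 C0 vv).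
  have YF := (xnorm_EFin_lty _ _).1 Fy.
  have mfj : measurable_fun setT (f j) by exact: measurable_powR_abs.
  apply: (proj1 (fl_ideal fY YF mfj _)); apply: aeW => x; rewrite [leRHS]ger0_norm ?powR_ge0//.
  exact: (le_sum_powR (c := fun j => `|f j x|)).
pose h j x := `|f j x| `^ r.
have mh j : measurable_fun setT (h j) by apply: measurable_powR_abs; have [] := lf j.
have fh j x : `|f j x| `^ r = `|h j x| by rewrite (ger0_norm (powR_ge0 _ _)).
move=> /= Fy; have := vv N h mh.
rewrite /= (xnorm_power_sum q mh fh) (xnorm_power_maximal q mh fh) => H.
by apply/(norm_le C0); rewrite ?xnorm_ge0//; apply: H; exact: poweR_lty.
Qed.

Lemma locally_integrable_Lr_loc (f h : T -> R) : measurable_fun setT f ->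
  (forall x, `|f x| `^ r = `|h x|) -> locally_integrable h -> Lr_loc r f.
Proof.
move=> mf fh [mh lh]; apply: Lr_loc_of_cubes => // k; exists k => //.
by under eq_integral => x _ do rewrite fh; exact/lh/centered_cube_cube.
Qed.

Lemma sparse_bound_power C : 0 < C -> sparse_bound Y r C ->
  forall D S (h : T -> R), dyadic_grid D -> finite_set S -> S `<=` D -> sparse 2^-1 S ->
  X h -> locally_integrable h -> (xnorm X (sparse_op S h) <= (C `^ r * fnorm X h)%:E)%E.
Proof.
move=> C0 sp D S h dD finS SD spS Xh lh; have mh := fl_measurable fX Xh.
pose f x := `|h x| `^ r^-1.
have fh x : `|f x| `^ r = `|h x| by rewrite ger0_norm ?powR_ge0// powRVK.
have [Yf nf] := powR_power_space Xh.
have lf : Lr_loc r f by apply: (locally_integrable_Lr_loc _ fh lh); exact: measurable_powR_abs.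
have := sp D S dD finS SD spS f Yf lf.
have cS : S `<=` @cube R n := subset_trans SD (dyadic_grid_cube dD).
have sE : sparse_op S (fun y => `|f y| `^ r) = sparse_op S h.
  by apply: sparse_op_abs => x; rewrite fh normr_id.
rewrite /sparse_op_r sE => H.
rewrite xnorm_power; [|exact: r0| |]; last 2 first.
- exact: measurable_sparse_op.
- by move=> x; exact: sparse_op_ge0.
rewrite nf -powRM ?(ltW C0) ?(fl_ge0 fY)// -poweR_EFin; apply: le_poweR => //.
exact: xnorm_ge0.
Qed.

Lemma sparse_power_bound K : 0 <= K ->
  (forall D S (h : T -> R), dyadic_grid D -> finite_set S -> S `<=` D -> sparse 2^-1 S ->
    X h -> (xnorm X (sparse_op S h) <= (K * fnorm X h)%:E)%E) ->
  sparse_bound Y r (K `^ r^-1).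
Proof.
move=> K0 sp D S dD finS SD spS f Yf _.
have mf := fl_measurable fY Yf.
have [Xf nf] := power_space_powR Yf.
have cS : S `<=` @cube R n := subset_trans SD (dyadic_grid_cube dD).
have := sp D S _ dD finS SD spS Xf; rewrite nf xnorm_power//; last 2 first.
- by apply: measurable_sparse_op => //.
- by move=> x; exact: sparse_op_ge0.
move=> H; apply: (le_of_le_poweR r0).
- exact: xnorm_ge0.
- by rewrite lee_fin mulr_ge0 ?powR_ge0 ?(fl_ge0 fY).
by rewrite poweR_EFin powRM ?powR_ge0 ?(fl_ge0 fY)// powRVK.
Qed.

End transfer.

(** * The implications between the four conditions *)

Section equivalences.
Variables (R : realType) (n : nat).
Local Notation T := (Rn R n).
Variables (r : R) (Y : fspace R n).
Hypothesis r0 : 0 < r.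
Hypothesis fY : function_lattice Y.
Hypothesis cY : convex_const_one r Y.
Local Notation X := (power_space Y r).
Let nX : normed_lattice X := power_space_normed r0 fY cY.
Let fX : function_lattice X := nX.

Lemma vector_valued_of_maximal q : r < q ->
  bounded_on (@maximal R n) X -> bounded_on (@maximal R n) (kothe_associate X) ->
  exists2 C : R, 0 < C & vector_valued_bound Y r q C.
Proof.
move=> rq [C1 b1] [C2 b2]; have q0 : 0 < q := lt_trans r0 rq.
have s1 : 1 < q / r by rewrite ltr_pdivlMr// mul1r.
(* The absolute value and the added 1 make the constant positive, whatever its origin. *)
pose K := `|fefferman_stein_const n C1 C2 (q / r)| + 1.
have K0 : 0 < K by rewrite ltr_wpDl.
exists (K `^ r^-1); first exact: powR_gt0.
apply/vector_valued_bound_powerP => //; first exact: powR_gt0.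
move=> N h mh /=; rewrite -(invf_div q r) => /xnorm_EFin_lty XF.
rewrite xnorm_EFin// (powRVK r0 (ltW K0)) -EFinM.
apply: le_trans (fefferman_stein nX b1 b2 s1 mh XF) _.
rewrite lee_fin ler_wpM2r ?(fl_ge0 fX)//.
by rewrite /K (le_trans (ler_norm _))// lerDl.
Qed.

Lemma sparse_of_vector_valued q C : r < q -> 0 < C -> vector_valued_bound Y r q C ->
  exists2 C' : R, 0 < C' & sparse_bound Y r C'.
Proof.
move=> rq C0 vv; have q0 : 0 < q := lt_trans r0 rq.
have s1 : 1 < q / r by rewrite ltr_pdivlMr// mul1r.
have Cr : 0 < C `^ r by exact: powR_gt0.
pose K := 8 * C `^ r * (8 * C `^ r) `^ (q / r - 1) * C `^ r.
have K0 : 0 < K by rewrite !mulr_gt0// powR_gt0// mulr_gt0.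
exists (K `^ r^-1); first exact: powR_gt0.
apply: (sparse_power_bound r0 fY (ltW K0)) => D S h dD finS SD spS Xh.
apply: (sparse_of_vector nX s1 Cr _ dD finS SD spS Xh) => N u mu_ F XF.
have /vector_valued_bound_powerP := vv; move=> /(_ r0 fY q0 C0) /(_ N u mu_) /=.
by rewrite -(invf_div q r) xnorm_EFin// => /(_ (ltry _)); rewrite EFinM.
Qed.

Lemma maximal_of_sparse_bound C : 0 < C -> sparse_bound Y r C ->
  bounded_on (@maximal R n) X /\ bounded_on (@maximal R n) (kothe_associate X).
Proof.
move=> C0 sp; have Cr : 0 < C `^ r by exact: powR_gt0.
have sp' := sparse_bound_power r0 fY C0 sp.
split; exists (grid_const R n * (2 * C `^ r)) => f Xf.
  exact: (maximal_of_sparse nX Cr).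
exact: (maximal_of_sparse_kothe nX Cr).
Qed.

End equivalences.

(** * Exponents below the convexity exponent *)

Section slabs.
Variables (R : realType) (n : nat).
Local Notation V := 'rV[R]_n.+1.
Local Notation T := (Rn R n).
Local Notation mu := (@lebesgue_Rn R n).

(** Thin in the first coordinate only. The other sides have length 2, so that a cube of side at most
    1 based in the unit cube does not leave the slab in those directions. *)
Definition slab (N j : nat) : set T :=
  box true true (\row_i (if i == ord0 then j%:R / N%:R else 0) : V)
                (\row_i (if i == ord0 then j.+1%:R / N%:R else 2)).

Lemma slabP N j (x : T) : slab N j x <-> forall i : 'I_n.+1,
  (if i == ord0 then j%:R / N%:R else 0) <= (x : V) ord0 i <
  (if i == ord0 then j.+1%:R / N%:R else 2).
Proof. by split => h i; have := h i; rewrite !mxE in_itv. Qed.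

Lemma measurable_slab N j : measurable (slab N j).
Proof. exact: measurable_box. Qed.

Lemma slab_inj N j k (x : T) : (0 < N)%N -> slab N j x -> slab N k x -> j = k.
Proof.
move=> N0 /slabP/(_ ord0) + /slabP/(_ ord0); rewrite eqxx => /andP[a b] /andP[c d].
have Np : 0 < N%:R :> R by rewrite ltr0n.
have := le_lt_trans a d; have := le_lt_trans c b.
by rewrite !ltr_pM2r ?invr_gt0// !ltr_nat; lia.
Qed.

Definition unit_cube (l : R) : set T := box true true (0 : V) (0 + const_mx l).

Lemma unit_cubeP l (x : T) : unit_cube l x <-> forall i : 'I_n.+1, 0 <= (x : V) ord0 i < l.
Proof. by split => h i; have := h i; rewrite !mxE in_itv/= add0r. Qed.

Lemma slab_sub N j : (0 < N)%N -> (j < 2 * N)%N -> slab N j `<=` unit_cube 2.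
Proof.
move=> N0 jN x /slabP h; apply/unit_cubeP => i; have := h i; case: ifP => // _ /andP[a b].
have Np : 0 < N%:R :> R by rewrite ltr0n.
apply/andP; split; first by apply: le_trans a; rewrite divr_ge0.
by apply: lt_le_trans b _; rewrite ler_pdivrMr// -natrM ler_nat.
Qed.

(** The slab [t] steps above that of [x] has thickness 1/N and crosses a cube of side (t+1)/N that
    contains [x], hence fills at least a fraction 1/(t+1) of it. *)
Lemma maximal_slab N t (x : T) : (0 < N)%N -> (t < N)%N -> unit_cube 1 x ->
  (((t.+1)%:R^-1)%:E <=
   maximal (\1_(slab N (Num.truncn (N%:R * (x : V) ord0 ord0) + t))) x)%E.
Proof.
move=> N0 tN /unit_cubeP x1; set i := Num.truncn _.
have Np : 0 < N%:R :> R by rewrite ltr0n.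
have /andP[x0 _] := x1 ord0.
have iN : i%:R / N%:R <= (x : V) ord0 ord0.
  by rewrite ler_pdivrMr// mulrC truncn_le// mulr_ge0.
have Ni : (x : V) ord0 ord0 < i.+1%:R / N%:R by rewrite ltr_pdivlMr// mulrC truncnS_gt.
pose l : R := t.+1%:R / N%:R.
have l0 : 0 < l by rewrite divr_gt0.
have l1 : l <= 1 by rewrite ler_pdivrMr// mul1r ler_nat.
have tl : i.+1%:R / N%:R <= i%:R / N%:R + l.
  rewrite /l -mulrDl ler_pM2r ?invr_gt0// -natrD ler_nat; lia.
have El : (i + t).+1%:R / N%:R = i%:R / N%:R + l.
  by rewrite /l -mulrDl -natrD addnS.
pose a : V := \row_k (if k == ord0 then i%:R / N%:R else (x : V) ord0 k).
set Q : set T := box true true a (a + const_mx l).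
have cQ : cube Q by exact: half_cube.
have Qx : Q x.
  move=> k; rewrite !mxE in_itv/=; case: ifP => [/eqP ->|_].
    by rewrite iN (lt_le_trans Ni).
  by rewrite lexx ltrDl.
apply: le_trans (average_le_maximal _ cQ Qx).
pose b : V := \row_k (if k == ord0 then (i + t)%:R / N%:R else (x : V) ord0 k).
pose c : V := \row_k (if k == ord0 then (i + t).+1%:R / N%:R else (x : V) ord0 k + l).
pose P : set T := box true true b c.
have PQ : P `<=` slab N (i + t) `&` Q.
  move=> y Py; split.
    apply/slabP => k; have := Py k; have := x1 k; rewrite !mxE in_itv/=.
    by case: ifP => // _; lra.
  move=> k; have := Py k; rewrite !mxE in_itv/= in_itv/=; case: ifP => // _.
  rewrite El => /andP[h1 ->]; rewrite andbT; apply: le_trans h1.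
  by rewrite ler_pM2r ?invr_gt0// ler_nat leq_addr.
have mQ : measurable Q by exact: measurable_box.
have muP : mu P = (N%:R^-1 * l ^+ n)%:E.
  rewrite lebesgue_Rn_box /box_volume big_ord_recl !mxE eqxx El.
  have -> : i%:R / N%:R + l - (i + t)%:R / N%:R = N%:R^-1.
    by rewrite /l natrD -[t.+1]addn1 natrD; field; rewrite gt_eqF.
  rewrite max_r ?invr_ge0//; congr ((_ * _)%:E).
  rewrite (eq_bigr (fun=> l)) ?prodr_const ?card_ord// => k _.
  by rewrite !mxE /= addrAC subrr add0r max_r// ltW.
rewrite /average lebesgue_Rn_cube//=.
have -> : (\int[mu]_(y in Q) `|\1_(slab N (i + t)) y|%:E = mu (slab N (i + t) `&` Q))%E.
  under eq_integral => y _ do rewrite (ger0_norm (ler0n _ _)).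
  by rewrite integral_indic//; exact: measurable_slab.
have -> : (t.+1%:R^-1)%:E = (((l ^+ n.+1)^-1)%:E * mu P)%E.
  rewrite muP -EFinM; congr (_%:E); rewrite exprS /l; field.
  rewrite !gt_eqF//= ?exprn_gt0 ?divr_gt0//.
apply: lee_wpmul2l; first by rewrite lee_fin invr_ge0 exprn_ge0// ltW.
apply: (@le_measure _ _ _ mu); rewrite ?inE//; first exact: measurable_box.
by apply: measurableI => //; exact: measurable_slab.
Qed.

Variables (r : R) (Y : fspace R n).
Hypothesis r0 : 0 < r.
Hypothesis fY : function_lattice Y.

Lemma fl_unit_cube l : Y (\1_(unit_cube l) : T -> R).
Proof.
apply: (fl_indic_sub fY (k := Num.truncn `|l|)); first exact: measurable_box.
move=> x /unit_cubeP h; apply/centered_cubeP => i; have /andP[a b] := h i.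
have := truncnS_gt `|l|; have := ler_norm l; move: a b; set c := _.+1%:R; lra.
Qed.

Lemma vector_valued_exponent q C : 0 < q -> q <= r -> 0 < C -> ~ vector_valued_bound Y r q C.
Proof.
move=> q0 qr C0 vv; pose A := fnorm Y (\1_(unit_cube 1) : T -> R).
have A0 : 0 < A.
  rewrite lt_def (fl_ge0 fY (fl_unit_cube 1)) andbT; apply/eqP => A0.
  have := fnorm_indic_eq0 fY _ (fl_unit_cube 1) A0.
  rewrite lebesgue_Rn_cube//= expr1n => /(_ (measurable_box _ _ _ _)) [] /eqP.
  by rewrite oner_eq0.
pose B := fnorm Y (\1_(unit_cube 2) : T -> R).
have B0 : 0 <= B by exact: (fl_ge0 fY (fl_unit_cube 2)).
suff bnd N : (0 < N)%N -> series harmonic N <= (C * B / A) `^ q.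
  apply: (@dvg_harmonic R); apply: nondecreasing_is_cvgn.
    apply/nondecreasing_seqP => k; rewrite /series/= big_nat_recr//= lerDl.
    by rewrite /harmonic/= invr_ge0.
  exists ((C * B / A) `^ q) => _ [[|k] _ <-]; last exact: bnd.
  by rewrite /series/= big_geq// powR_ge0.
move=> N0; pose f (j : 'I_(2 * N)) : T -> R := \1_(slab N j).
have mf j : measurable_fun setT (f j) by apply: measurable_indic; exact: measurable_slab.
have f01 j x : f j x = (x \in slab N j)%:R by rewrite /f indicE.
have lf j : Lr_loc r (f j).
  by apply: (@Lr_loc_bounded _ _ (f j) r 1) => // x; rewrite f01; case: (_ \in _);
    rewrite ?normr1 ?normr0.
have qn : q != 0 by rewrite gt_eqF.
pose F x := (\sum_j `|f j x| `^ q) `^ q^-1.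
(* The slabs are disjoint, so the right-hand side stays bounded while [N] grows. *)
have FB x : `|F x| <= `|(\1_(unit_cube 2) : T -> R) x|.
  rewrite [leLHS]ger0_norm ?powR_ge0//.
  have [[j Sj]|nS] := pselect (exists j : 'I_(2 * N), slab N j x).
    rewrite /F (bigD1 j)//= big1 ?addr0; last first.
      move=> k kj; rewrite f01 memNset ?normr0 ?powR0// => Sk.
      by move/eqP: kj; apply; apply: val_inj; exact: slab_inj Sk Sj.
    rewrite f01 mem_set// normr1 !powR1 indicE mem_set ?normr1//.
    exact: slab_sub Sj.
  rewrite /F big1 ?powR0 ?invr_eq0// => j _.
  by rewrite f01 memNset ?normr0 ?powR0// => Sj; apply: nS; exists j.
have mF : measurable_fun setT F.
  apply: (measurableT_comp (measurable_powR _)); apply: measurable_sum => j.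
  exact: measurable_powR_abs.
have [YF nF] := fl_ideal fY (fl_unit_cube 2) mF (aeW _ FB).
have := vv _ f lf; rewrite /= -/F xnorm_EFin// => /(_ (ltry _)) main.
pose H := series (@harmonic R) N.
have H0 : 0 <= H by apply: sumr_ge0 => k _; rewrite /harmonic/= invr_ge0.
have low : ((H `^ q^-1 * A)%:E <= (C * B)%:E)%E.
  have Xc : Y (fun x => H `^ q^-1 * \1_(unit_cube 1) x) by apply: (fl_scale fY); exact: fl_unit_cube.
  have <- : xnorm Y (fun x => (H `^ q^-1 * \1_(unit_cube 1) x)%:E) = (H `^ q^-1 * A)%:E.
    rewrite xnorm_EFin// (fl_normZ fY)//; last exact: fl_unit_cube.
    by rewrite ger0_norm// powR_ge0.
  apply: (@le_trans _ _ (C%:E * (fnorm Y F)%:E)%E); last by rewrite -EFinM lee_fin ler_pM2l.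
  apply: le_trans main; apply: (le_xnorm fY).
  - by apply/measurable_EFinP; apply: measurable_funM; [exact: measurable_cst|
      apply: measurable_indic; exact: measurable_box].
  - by move=> x; rewrite lee_fin mulr_ge0 ?powR_ge0 ?indicE.
  move=> x; rewrite indicE; case: (boolP (x \in unit_cube 1)) => [|_]; last first.
    by rewrite mulr0 poweR_ge0.
  rewrite inE mulr1 => Ux; rewrite -poweR_EFin; apply: le_poweR; rewrite ?invr_gt0//.
  pose g (j : nat) : T -> R := \1_(slab N j).
  have -> : (\sum_j maximal_r r (f j) x `^ q = \sum_(0 <= j < 2 * N) maximal_r r (g j) x `^ q)%E.
    by rewrite big_mkord.
  pose i := Num.truncn (N%:R * (x : V) ord0 ord0).
  have iN : (i + N <= 2 * N)%N.
    have /unit_cubeP/(_ ord0)/andP[x0 x1] := Ux.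
    have : (i < N)%N.
      rewrite /i -(ltr_nat R); apply: (@le_lt_trans _ _ (N%:R * (x : V) ord0 ord0)).
        by rewrite truncn_le// mulr_ge0.
      by rewrite gtr_pMr// ltr0n.
    by move=> iN; rewrite mul2n -addnn leq_add2r ltnW.
  have t0 j : (0 <= maximal_r r (g j) x `^ q)%E by exact: poweR_ge0.
  apply: (@le_trans _ _ (\sum_(i <= j < i + N) maximal_r r (g j) x `^ q)%E); last first.
    rewrite (big_cat_nat (leq0n i) (leq_trans (leq_addr N i) iN))/=.
    rewrite (big_cat_nat (leq_addr N i) iN)/=.
    apply: (@le_trans _ _ (\sum_(i <= j < i + N) maximal_r r (g j) x `^ q +
        \sum_(i + N <= j < 2 * N) maximal_r r (g j) x `^ q)%E).
      by rewrite leeDl// sume_ge0.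
    by rewrite leeDr// sume_ge0.
  rewrite -{1}[i]add0n big_addn addKn /H /series/= -sumEFin [leLHS]big_nat [leRHS]big_nat.
  apply: lee_sum => t /andP[_ tN]; rewrite /maximal_r -poweRrM.
  have ab : maximal (fun y => `|g (t + i)%N y| `^ r) = maximal (g (t + i)%N).
    apply: maximal_abs => y; rewrite /g indicE; case: (_ \in _).
      by rewrite normr1 powR1 normr1.
    by rewrite normr0 powR0 ?normr0// gt_eqF.
  rewrite ab; have := maximal_slab N0 tN Ux; rewrite -/i addnC -/(g _) => M.
  apply: (@le_trans _ _ (((t.+1%:R^-1)%:E : \bar R) `^ (r^-1 * q))%E); last first.
    by apply: le_poweR; [rewrite mulr_gt0// invr_gt0|rewrite lee_fin invr_ge0|exact: M].
  rewrite poweR_EFin lee_fin /harmonic/=.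
  (* Here [q <= r] enters: a number in (0, 1] does not decrease when raised to a power q/r of at
     most 1. *)
  apply: ger1_powR; first by rewrite invr_gt0 ltr0n/= invf_le1// ler1n.
  by rewrite mulrC ler_pdivrMr// mul1r.
move: low; rewrite lee_fin -ler_pdivlMr// => low.
rewrite -/H -[leLHS](powRVK q0)//; apply: le_powR => //; exact: powR_ge0.
Qed.

End slabs.

(** * Sequences and maxima *)

Section sequences_and_maxima.
Variables (R : realType) (n : nat).
Local Notation T := (Rn R n).

(** A positive power and its inverse are both increasing, so the power commutes with the supremum of
    the partial sums. *)
Lemma poweR_nneseries (u : nat -> \bar R) (p : R) : 0 < p -> (forall j, (0 <= u j)%E) ->
  ((\sum_(j <oo) u j) `^ p = ereal_sup (range (fun N => (\sum_(j < N) u j) `^ p)))%E.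
Proof.
move=> p0 u0; apply/eqP; rewrite eq_le; apply/andP; split; last first.
  apply: ge_ereal_sup => _ [N _ <-]; apply: (le_poweR p0); first exact: sume_ge0.
  by rewrite -(big_mkord xpredT u); exact: nneseries_lim_ge.
set S := ereal_sup _.
have S0 : (0 <= S)%E.
  by apply: le_trans (ereal_sup_ubound _); last (by exists 0%N); exact: poweR_ge0.
rewrite -[leRHS](poweRVK p0 S0); apply: (le_poweR p0); first exact: nneseries_ge0.
apply: lime_le; first exact: is_cvg_nneseries.
apply: nearW => N; rewrite big_mkord.
have s0 : (0 <= \sum_(j < N) u j)%E by exact: sume_ge0.
rewrite -[leLHS](poweRK p0 s0); apply: le_poweR; rewrite ?invr_gt0 ?poweR_ge0//.
by apply: ereal_sup_ubound; exists N.
Qed.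

Lemma maximal_r0 (r : R) (x : T) : 0 < r -> maximal_r r (fun=> 0) x = 0%E.
Proof.
move=> r0; have rn : r != 0 by rewrite gt_eqF.
rewrite /maximal_r (_ : maximal _ x = 0%E) ?poweR0r ?invr_eq0//.
apply/eqP; rewrite eq_le maximal_ge0 andbT; apply: maximal_leP => // Q cQ Qx.
by rewrite /average integral0_eq ?mule0// => y _; rewrite normr0 powR0// normr0.
Qed.

Lemma maximal_r_mono (r : R) (f g : T -> R) x : 0 < r ->
  measurable_fun setT f -> measurable_fun setT g ->
  (forall y, `|f y| <= `|g y|) -> (maximal_r r f x <= maximal_r r g x)%E.
Proof.
move=> r0 mf mg fg; apply: le_poweR; [by rewrite invr_gt0|exact: maximal_ge0|].
apply: maximal_mono => [||y]; [exact: measurable_powR_abs|exact: measurable_powR_abs|].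
by rewrite !(ger0_norm (powR_ge0 _ _)); apply: le_powR; [exact: r0|exact: normr_ge0|exact: fg].
Qed.

Lemma measurable_bigmaxe (I : Type) (s : seq I) (u : I -> T -> \bar R) :
  (forall i, measurable_fun setT (u i)) ->
  measurable_fun setT (fun x => \big[maxe/0%E]_(i <- s) u i x).
Proof.
move=> mu_; elim: s => [|i s IH].
  by under eq_fun do rewrite big_nil; exact: measurable_cst.
by under eq_fun do rewrite big_cons; apply: measurable_maxe.
Qed.

Lemma measurable_bigmaxr (I : Type) (s : seq I) (u : I -> T -> R) :
  (forall i, measurable_fun setT (u i)) ->
  measurable_fun setT (fun x => \big[Num.max/0]_(i <- s) u i x).
Proof.
move=> mu_; elim: s => [|i s IH].
  by under eq_fun do rewrite big_nil; exact: measurable_cst.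
by under eq_fun do rewrite big_cons; apply: measurable_maxr.
Qed.

Lemma bigmaxr_ge0 (I : Type) (s : seq I) (u : I -> R) : 0 <= \big[Num.max/0]_(i <- s) u i.
Proof. by elim: s => [|i s IH]; rewrite ?big_nil// big_cons le_max IH orbT. Qed.

Lemma bigmaxe_ge0 (I : Type) (s : seq I) (u : I -> \bar R) :
  (0 <= \big[maxe/0%E]_(i <- s) u i)%E.
Proof. by elim: s => [|i s IH]; rewrite ?big_nil// big_cons le_max IH orbT. Qed.

Variables (r : R) (Y : fspace R n).
Hypothesis r0 : 0 < r.
Hypothesis fY : function_lattice Y.

(** From left to right, each [f j] is dominated by a partial sum in [Y], hence lies in L^r_loc, and
    the Fatou property applies to the partial sums. Conversely a finite family is padded with zeros,
    whose maximal function is zero. *)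
Lemma vector_valued_bound_seqP q C : 0 < q -> 0 < C ->
  vector_valued_bound Y r q C <-> vector_valued_bound_seq Y r q C.
Proof.
move=> q0 C0; have qi0 : 0 < q^-1 by rewrite invr_gt0.
have qn : q != 0 by rewrite gt_eqF.
split=> [vv f mf F YF|vv N f lf F FY].
  have lY := Lr_loc_of_vector_valued r0 fY q0 C0 vv.
  have FS : F = fun x => ereal_sup (range (fun N => ((\sum_(j < N) (`|f j x| `^ q)%:E) `^ q^-1)%E)).
    by apply/funext => x; rewrite /F poweR_nneseries// => j; rewrite lee_fin powR_ge0.
  have Fy : (xnorm Y F < +oo)%E by apply/xnorm_ltyP.
  pose G N (x : T) := (\sum_(j < N) `|f j x| `^ q) `^ q^-1.
  have mG N : measurable_fun setT (G N).
    apply: (measurableT_comp (measurable_powR _)); apply: measurable_sum => j.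
    exact: measurable_powR_abs.
  have GF N : (xnorm Y (fun x => (G N x)%:E) <= xnorm Y F)%E.
    apply: (le_xnorm fY); [exact/measurable_EFinP|by move=> x; rewrite lee_fin powR_ge0|].
    move=> x; rewrite FS; apply: ereal_sup_ubound; exists N => //.
    by rewrite sumEFin poweR_EFin.
  have YG N : Y (G N) by apply/xnorm_EFin_lty; exact: le_lt_trans (GF N) Fy.
  have lf j : Lr_loc r (f j).
    apply: lY; apply: (proj1 (fl_ideal fY (YG j.+1) (mf j) _)); apply: aeW => x.
    rewrite [leRHS]ger0_norm ?powR_ge0//.
    exact: (@le_sum_powR _ 'I_j.+1 _ (fun i => `|f i x|) ord_max).
  have -> : (fun x => (\sum_(j <oo) maximal_r r (f j) x `^ q) `^ q^-1)%E =
      fun x => ereal_sup (range (fun N => ((\sum_(j < N) maximal_r r (f j) x `^ q) `^ q^-1)%E)).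
    by apply/funext => x; rewrite poweR_nneseries// => j; exact: poweR_ge0.
  apply: (xnorm_fatou fY) => [N|N x|N x|N].
  - apply: (measurableT_comp (measurable_poweR _)); apply: emeasurable_sum => j.
    apply: (measurableT_comp (measurable_poweR _)); exact: measurable_maximal_r.
  - exact: poweR_ge0.
  - apply: (le_poweR qi0); first by apply: sume_ge0 => j _; exact: poweR_ge0.
    by rewrite big_ord_recr/= leeDl// poweR_ge0.
  - apply: le_trans (vv N (fun j => f j) (fun j => lf j) _) _; first exact: le_lt_trans (GF N) Fy.
    by apply: lee_wpmul2l; [rewrite lee_fin ltW|exact: GF].
pose g (j : nat) : T -> R := if insub j is Some i then f i else fun=> 0.
have gf (j : 'I_N) : g j = f j by rewrite /g valK.
have g0 j : (N <= j)%N -> g j = fun=> 0.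
  by move=> Nj; rewrite /g insubF// ltnNge Nj.
have mg j : measurable_fun setT (g j).
  by rewrite /g; case: insub => [i|]; [have [] := lf i|exact: measurable_cst].
have trunc (u : nat -> \bar R) : (forall j, 0 <= u j)%E -> (forall j, (N <= j)%N -> u j = 0%E) ->
    (\sum_(j <oo) u j = \sum_(j < N) u j)%E.
  move=> u0 uN; rewrite (nneseries_split 0 N)// add0n eseries0 ?adde0 ?big_mkord// => j Nj _.
  exact: uN.
have FE : (fun x => ((\sum_(j <oo) (`|g j x| `^ q)%:E) `^ q^-1)%E) = F.
  apply/funext => x; rewrite trunc => [|j|j Nj]; last 2 first.
  - by rewrite lee_fin powR_ge0.
  - by rewrite g0// normr0 powR0.
  by rewrite sumEFin poweR_EFin; congr ((_ `^ _)%:E); apply: eq_bigr => j _; rewrite gf.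
have ME : (fun x => ((\sum_(j <oo) maximal_r r (g j) x `^ q) `^ q^-1)%E) =
    fun x => ((\sum_(j < N) maximal_r r (f j) x `^ q) `^ q^-1)%E.
  apply/funext => x; rewrite trunc => [|j|j Nj]; last 2 first.
  - exact: poweR_ge0.
  - by rewrite g0// maximal_r0// poweR0r.
  apply: (congr1 (fun z : \bar R => (z `^ q^-1)%E)); apply: eq_bigr => j _; by rewrite gf.
have := vv g mg; rewrite /= FE ME; apply; exact/xnorm_ltyP.
Qed.

(** Every single maximal function lies below that of the pointwise maximum, so the constant is
    unchanged. *)
Lemma maximal_r_bound_to_max C : maximal_r_bound Y r C -> maximal_r_bound_max Y r C.
Proof.
move=> b N f mf F YF; apply: le_trans (b F YF); apply: (le_xnorm fY).
- by apply: measurable_bigmaxe => j; exact: measurable_maximal_r.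
- by move=> x; exact: bigmaxe_ge0.
move=> x; apply: bigmax_le => [|j _]; first exact: poweR_ge0.
apply: maximal_r_mono => //; first exact: (fl_measurable fY YF).
by move=> y; rewrite (ger0_norm (bigmaxr_ge0 _ _)); exact: (le_bigmax 0 (fun j => `|f j y|)).
Qed.

(** The finite maxima of the maximal functions increase to their supremum, and those of the |f_j|
    stay below theirs. *)
Lemma maximal_r_bound_max_to_sup C : 0 < C ->
  maximal_r_bound_max Y r C -> maximal_r_bound_sup Y r C.
Proof.
move=> C0 b f mf F YF.
have Fy : (xnorm Y F < +oo)%E by apply/xnorm_ltyP.
pose G N (x : T) := \big[Num.max/0]_(j < N) `|f j x|.
have mG N : measurable_fun setT (G N).
  by apply: measurable_bigmaxr => j; exact: (measurableT_comp (@normr_measurable R setT)).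
have GF N : (xnorm Y (fun x => (G N x)%:E) <= xnorm Y F)%E.
  apply: (le_xnorm fY); [exact/measurable_EFinP|by move=> x; rewrite lee_fin bigmaxr_ge0|].
  move=> x; have fF j : (`|f j x|%:E <= F x)%E by apply: ereal_sup_ubound; exists j.
  rewrite /G; elim/big_ind: _ => [|a c ha hc|j _]; last exact: fF.
    by apply: le_trans (fF 0%N); rewrite lee_fin.
  by rewrite EFin_max ge_max ha hc.
have YG N : Y (G N) by apply/xnorm_EFin_lty; exact: le_lt_trans (GF N) Fy.
pose H N x := \big[maxe/0%E]_(j < N) maximal_r r (f j) x.
have -> : (fun x => ereal_sup (range (fun j => maximal_r r (f j) x))) =
    fun x => ereal_sup (range (H ^~ x)).
  apply/funext => x; apply/eqP; rewrite eq_le; apply/andP; split; apply: ge_ereal_sup => _ [N _ <-].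
    apply: le_trans (ereal_sup_ubound _); last by exists N.+1.
    exact: (@le_bigmax _ _ 'I_N.+1 0%E (fun j => maximal_r r (f j) x) ord_max).
  have le j : (maximal_r r (f j) x <= ereal_sup (range (fun j => maximal_r r (f j) x)))%E.
    by apply: ereal_sup_ubound; exists j.
  apply: bigmax_le => [|j _]; last exact: le.
  by apply: le_trans (le 0%N); exact: poweR_ge0.
apply: (xnorm_fatou fY) => [N|N x|N x|N].
- by apply: measurable_bigmaxe => j; exact: measurable_maximal_r.
- exact: bigmaxe_ge0.
- apply: bigmax_le => [|j _]; first exact: bigmaxe_ge0.
  exact: (@le_bigmax _ _ 'I_N.+1 0%E (fun j => maximal_r r (f j) x) (widen_ord (leqnSn N) j)).
- apply: le_trans (b N (fun j => f j) (fun j => mf j) (YG N)) _.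
  rewrite EFinM; apply: lee_wpmul2l; first by rewrite lee_fin ltW.
  have := GF N; rewrite (xnorm_EFin (YG N)); exact.
Qed.

Lemma maximal_r_bound_of_sup C : maximal_r_bound_sup Y r C -> maximal_r_bound Y r C.
Proof.
move=> b f Yf; have mf := fl_measurable fY Yf.
have supc (c : \bar R) : ereal_sup (range (fun _ : nat => c)) = c.
  rewrite (_ : range _ = [set c]) ?ereal_sup1//.
  by apply/seteqP; split => [_ [_ _ <-]//|_ ->]; exists 0%N.
have [na Ya] := fnorm_abs fY Yf.
have := b (fun=> f) (fun=> mf); rewrite /=.
under eq_fun do rewrite supc; under [X in (xnorm _ X <= _)%E]eq_fun do rewrite supc.
by move=> /(_ (xmem_EFin Ya)); rewrite (xnorm_EFin Ya) na -EFinM.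
Qed.

End sequences_and_maxima.

Theorem theorem1p3 (R : realType) (n : nat) (r : R) (Y : fspace R n)
    (hr : 0 < r) (hY : ball_quasi_banach Y) (hconv : convex_const_one r Y) :
  let X := power_space Y r in
  let cond_a := bounded_on (@maximal R n) X /\
                bounded_on (@maximal R n) (kothe_associate X) in
  let cond_b := exists q C : R,
                  [/\ r < q, 0 < C & vector_valued_bound Y r q C] in
  let cond_c := forall q : R, r < q ->
                  exists2 C : R, 0 < C & vector_valued_bound Y r q C in
  let cond_d := exists2 C : R, 0 < C & sparse_bound Y r C in
  (* (i) *)
  ([<-> cond_a; cond_b; cond_c; cond_d] /\
   [/\ cond_a -> carrier Y `<=` Lr_loc r,
       cond_b -> carrier Y `<=` Lr_loc r,
       cond_c -> carrier Y `<=` Lr_loc r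
     & cond_d -> carrier Y `<=` Lr_loc r] /\
   (forall q C : R, r < q -> 0 < C ->
      (vector_valued_bound Y r q C <-> vector_valued_bound_power Y r q C))) /\
  (* (ii) *)
  ((forall q : R, 0 < q ->
      (exists2 C : R, 0 < C & vector_valued_bound Y r q C) ->
      r < q /\ carrier Y `<=` Lr_loc r) /\
   (forall q : R, 0 < q <= r ->
      ~ exists2 C : R, 0 < C & vector_valued_bound Y r q C)) /\
  (* (iii) *)
  (forall q C : R, r < q -> 0 < C ->
     (vector_valued_bound Y r q C <-> vector_valued_bound_seq Y r q C)) /\
  (* (iv) *)
  (carrier Y `<=` Lr_loc r ->
     [<-> exists2 C : R, 0 < C & maximal_r_bound Y r C;
          exists2 C : R, 0 < C & maximal_r_bound_max Y r C;
          exists2 C : R, 0 < C & maximal_r_bound_sup Y r C] /\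
     (forall C : R, 0 < C ->
        [<-> maximal_r_bound Y r C;
             maximal_r_bound_max Y r C;
             maximal_r_bound_sup Y r C])).

Proof.
move=> X cond_a cond_b cond_c cond_d.
have fY := ball_quasi_banach_lattice hY.
have ac : cond_a -> cond_c.
  by move=> [b1 b2] q rq; exact: vector_valued_of_maximal.
have cb : cond_c -> cond_b.
  have rq : r < r + 1 by rewrite ltrDl.
  by move=> /(_ _ rq)[C C0 vv]; exists (r + 1), C.
have bd : cond_b -> cond_d.
  by move=> [q [C [rq C0 vv]]]; exact: (sparse_of_vector_valued hr fY hconv rq C0 vv).
have da : cond_d -> cond_a.
  by move=> [C C0 sp]; exact: (maximal_of_sparse_bound hr fY hconv C0 sp).
have bY : cond_b -> carrier Y `<=` Lr_loc r.
  by move=> [q [C [rq C0 vv]]]; exact: (Lr_loc_of_vector_valued hr fY (lt_trans hr rq) C0 vv).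
have small q : 0 < q <= r -> ~ exists2 C : R, 0 < C & vector_valued_bound Y r q C.
  by move=> /andP[q0 qr] [C C0]; exact: vector_valued_exponent.
split; [split; [|split]|split; [|split]].
(* The implications proved form the cycle a, c, b, d; the listed order results from composing
   them. *)
- by tfae; [move=> /ac/cb|move=> /bd/da/ac|move=> /cb/bd|].
- by split=> // [/ac/cb/bY|/cb/bY|/da/ac/cb/bY].
- by move=> q C rq C0; apply: vector_valued_bound_powerP => //; exact: lt_trans hr rq.
- split=> // q q0 vv; split; last first.
    by have [C C0 vC] := vv; exact: (Lr_loc_of_vector_valued hr fY q0 C0 vC).
  by rewrite ltNge; apply/negP => qr; apply: (small q) => //; rewrite q0.
- by move=> q C rq C0; apply: vector_valued_bound_seqP => //; exact: lt_trans hr rq.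
move=> _; have b1 C := @maximal_r_bound_to_max R n r Y hr fY C.
have b2 C := @maximal_r_bound_max_to_sup R n r Y fY C.
have b3 C := @maximal_r_bound_of_sup R n r Y fY C.
split=> [|C C0]; tfae.
- by move=> [C C0 /b1]; exists C.
- by move=> [C C0 /(b2 _ C0)]; exists C.
- by move=> [C C0 /b3]; exists C.
- exact: b1.
- exact: b2.
- exact: b3.
Qed.
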